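(* Let $0<p<1$, let $\mathbf g=-dt^2+t^{2p}\delta_{ij}dx^idx^j$ on $\mathbb R^+\times\mathbb R^3$, let $0<t_0<t_1$, and let $k\ge0$ be an integer. There is a constant $A>0$, depending only on $p$, $k$ and $t_0$ (and allowed to blow up as $p\to0$), such that for every smooth $\phi:\mathbb R^+\times\mathbb R^3\to\mathbb R$ with $\phi(t,\cdot)\in C_c^\infty(\mathbb R^3)$ for every $t\in(t_0,t_1)$, and for every $t\in(t_0,t_1)$, $$\big\|t\,\partial_t\phi_{\le k}(t,\cdot)\big\|_{L^\infty}+\big\|t^{1-p}\nabla_x\phi_{\le k}(t,\cdot)\big\|_{L^\infty}\le A\Big(E^{1/2}[\phi_{\le k+4}](t_0)+\big\|t^{p+\frac12}(\square_{\mathbf g}\phi)_{\le k+4}\big\|_{L^2[t_0,t_1]}+\big\|t^{p+1}(\square_{\mathbf g}\phi)_{\le k+1}(t,\cdot)\big\|_{L^2(\mathbb R^3)}\Big).$$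
   Context: $\square_{\mathbf g}\phi=-\partial_t^2\phi-\frac{3p}{t}\partial_t\phi+\frac1{t^{2p}}\Delta\phi$. Put $a(t)=t^p$ and let $\tau=\frac{t^{1-p}}{1-p}$ be the conformal time, so $\partial_\tau=t^p\partial_t$. Consider the vector fields $\partial_\tau$, $\partial_i=\partial_{x^i}$, $S=\tau\partial_\tau+r\partial_r$ (with $r=|x|$, $r\partial_r=x^i\partial_i$), and $\Omega_{ij}=x^i\partial_j-x^j\partial_i$ $(1\le i<j\le3)$. For $\alpha=(i,j,k)$ with $i$ a multi-index for $\nabla_{\tau,x}=(\partial_\tau,\partial_1,\partial_2,\partial_3)$, $j$ a multi-index for $\Omega=(\Omega_{12},\Omega_{13},\Omega_{23})$ and $k\ge0$ an integer, set $|\alpha|=|i|+|j|+k$ and $\phi_\alpha=\nabla_{\tau,x}^i\Omega^jS^k\phi$. A subscript $\le n$ in a norm means the sum over all $\alpha$ with $|\alpha|\le n$; e.g. $\|\partial_t\phi_{\le n}\|=\sum_{|\alpha|\le n}\|\partial_t\phi_\alpha\|$, $\|(\square_{\mathbf g}\phi)_{\le n}\|=\sum_{|\alpha|\le n}\|(\square_{\mathbf g}\phi)_\alpha\|$, and $E^{1/2}[\phi_{\le n}](t)=\sum_{|\alpha|\le n}E^{1/2}[\phi_\alpha](t)$. The energy is $E[\psi](t)=\frac12\int_{\mathbb R^3}\big(t^{2p}(\partial_t\psi)^2+|\nabla_x\psi|^2\big)(t,x)\,dx$, and $\|f\|_{L^2[t_0,t_1]}^2=\int_{t_0}^{t_1}\int_{\mathbb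 R^3}|f|^2\,dx\,dt$. Norms may take the value $+\infty$. *)

(* Defs.v *)
From HB Require Import structures.
From mathcomp Require Import all_boot all_order all_algebra.
From mathcomp Require Import all_classical all_reals all_analysis.

Set Implicit Arguments.
Unset Strict Implicit.
Unset Printing Implicit Defensive.

Import Order.TTheory GRing.Theory Num.Theory.
Import numFieldNormedType.Exports.

Local Open Scope classical_set_scope.
Local Open Scope ring_scope.

(* C^oo on an open set U of a finite-dimensional space: all iterated
   directional derivatives 'D_v1 ('D_v2 (... g)) exist and are continuous at
   every point of U. *)
Definition smooth_on (R : realType) (V : normedModType R) (U : set V)
    (g : V -> R) : Prop :=
  forall (s : seq V) (x : V), U x ->
    {for x, continuous (foldr (fun v h => 'D_v h) g s)} /\
    forall v : V, derivable (foldr (fun v h => 'D_v h) g s) x v.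

Section Defs.
Context {R : realType}.

(* Functions of (t, x), with x in R^3; only the values at t > 0 matter. *)
Definition field := R -> 'rV[R]_3 -> R.

Implicit Types (f phi psi : field) (g : 'rV[R]_3 -> R) (p t : R).

Definition smooth_field phi : Prop :=
  smooth_on [set z : R * 'rV[R]_3 | 0 < z.1] (fun z => phi z.1 z.2).

Definition test_function g : Prop :=
  smooth_on setT g /\ compact (closure [set x | g x != 0]).

Definition dt f : field := fun t x => derive1 (f ^~ x) t.

Definition dx (i : 'I_3) f : field := fun t x => 'D_(delta_mx 0 i) (f t) x.

Definition grad_norm f : field :=
  fun t x => Num.sqrt (\sum_(i < 3) dx i f t x ^+ 2).

(* The wave operator of -dt^2 + t^(2p) (dx1^2 + dx2^2 + dx3^2). *)
Definition box p f : field := fun t x =>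
  - dt (dt f) t x - 3 * p / t * dt f t x
  + (t `^ (2 * p))^-1 * \sum_(i < 3) dx i (dx i f) t x.

Definition tau p t : R := t `^ (1 - p) / (1 - p).

Definition dtau p f : field := fun t x => t `^ p * dt f t x.

Definition scaling p f : field := fun t x =>
  tau p t * dtau p f t x + \sum_(i < 3) x 0 i * dx i f t x.

Definition rotation (i j : 'I_3) f : field := fun t x =>
  x 0 i * dx j f t x - x 0 j * dx i f t x.

(* D_1^(e_1) (D_2^(e_2) (... f)): the exponents count repetitions, and the
   operators are composed in the order in which they are listed. *)
Definition monomial (D : seq (field -> field)) (e : seq nat) f : field :=
  foldr (fun De h => iter De.2 De.1 h) f (zip D e).

(* alpha = (i, j, k); bounding each exponent by n loses none of the alpha with
   |alpha| <= n. *)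
Definition multiindex (n : nat) : finType :=
  (4.-tuple 'I_n.+1 * 3.-tuple 'I_n.+1 * 'I_n.+1)%type.

Definition mi_size n (a : multiindex n) : nat :=
  (\sum_(m < 4) tnth a.1.1 m + \sum_(m < 3) tnth a.1.2 m + a.2)%N.

Definition apply_mi p n (a : multiindex n) f : field :=
  monomial [:: dtau p; dx 0; dx 1; dx 2] (map val a.1.1)
    (monomial [:: rotation 0 1; rotation 0 2; rotation 1 2] (map val a.1.2)
      (iter a.2 (scaling p) f)).

Local Open Scope ereal_scope.

(* N(f_{<= n}): the sum of N(f_alpha) over |alpha| <= n. *)
Definition sum_le p (n : nat) (N : field -> \bar R) f : \bar R :=
  \sum_(a : multiindex n | (mi_size a <= n)%N) N (apply_mi p a f).

Definition leb3 :=
  ((@lebesgue_measure R \x @lebesgue_measure R) \x @lebesgue_measure R)%E.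

Definition vec3 (y : R * R * R) : 'rV[R]_3 :=
  \row_(i < 3) tnth [tuple y.1.1; y.1.2; y.2] i.

Definition L2x g : \bar R := 'N[leb3]_2%:E [EFin \o (g \o vec3)].

Definition Linftyx g : \bar R := 'N[leb3]_+oo [EFin \o (g \o vec3)].

Definition L2tx (t0 t1 : R) f : \bar R :=
  sqrte (\int[lebesgue_measure]_(t in `[t0, t1])
           \int[leb3]_y (`|f t (vec3 y)| ^+ 2)%:E).

Definition energy p psi t : \bar R :=
  (2^-1)%:E * \int[leb3]_y
    (t `^ (2 * p) * dt psi t (vec3 y) ^+ 2
     + \sum_(i < 3) dx i psi t (vec3 y) ^+ 2)%:E.

End Defs.

(* Main.v *)
(* Multiply the equation by d_t f and by the square of the positive part of
   (rho - tau)^2 - r^2, and let rho go to infinity: the energy at time T plus a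
   positive bulk term is bounded by the initial energy and the L^2 norm of
   t^(p + 1/2) box f, without any assumption at spatial infinity. The bracket of
   two of the eight generators is a multiple of a generator, and box commutes with
   them up to multiples of box and terms t^(-a) dtau with a >= 1 + p, which the bulk
   term absorbs. By induction on the length, all words in the generators have
   bounded energy; reordering letters reduces them to the monomials of the norms.

   For r <= tau / 2 the Klainerman-Sideris identity expresses (tau^2 - r^2) Lap f
   through first derivatives of Gamma f and tau^2 t^(2p) box f, so that integration
   by parts bounds second derivatives by O(1 / tau) in L^2. If all |x_i| <= tau / 16,
   a one-dimensional estimate with weight s^2 along the rays from x, averaged over
   a cone of rays, bounds f(x)^2 by L^2 norms of f, grad f and Hess f near x. If not,
   let |x_i| be maximal. On the sphere through x, a graph over the other two
   coordinates, the coordinate derivatives are Omega / x_i; two one-dimensional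
   estimates there and one in the direction i bound r^2 f(x)^2 by L^2 norms of
   Omega^j f and d_i Omega^j f, |j| <= 2. Either way derivatives are O(1 / tau), and
   t^(1 - p) = (1 - p) tau. *)
Require Import Defs.
From HB Require Import structures.
From mathcomp Require Import all_boot all_order all_algebra.
From mathcomp Require Import all_classical all_reals all_analysis.
From mathcomp Require Import measurable_realfun.
From mathcomp Require Import ring lra.
Set Implicit Arguments.
Unset Strict Implicit.
Unset Printing Implicit Defensive.
Import Order.TTheory GRing.Theory Num.Theory.
Import numFieldNormedType.Exports.
Local Open Scope classical_set_scope.
Local Open Scope ring_scope.

(** * Directional derivatives *)

(** No norm may be assumed finite, so every integral is that of a nonnegative function with values
    in the extended reals; a divergence enters only through its positive and negative parts, whose
    integrals agree and are finite on the support of a cut-off. Constants are uniform in the field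
    because an operator is a fixed finite list of words with coefficients $c\,t^{-a}$. The friction
    $3p/t$ outweighs the growth of $t^{2p}$ and leaves $-4p/t$ times the kinetic term: half is kept
    as bulk, half absorbs the source, whence the factor $1/p$. A commutation error
    $t^{-1-p}\partial_\tau$ of a shorter word, squared against the source weight $t^{1+2p}$, is
    exactly of the bulk density $1/t$. In the interior a derivative of a word has bounded $L^2$
    norm, and both its gradient and its Hessian are $O(1/\tau)$. The ray estimate therefore has two
    lengths: one of size $\tau$ for the function, a fixed one that balances gradient against
    Hessian. Orders: the exterior adds two rotations and one derivative to a derivative of a word of
    length $k$; the interior uses the Klainerman-Sideris identity on words of length $k+1$, hence
    the source on the slice at order $k+1$. *)

Section Directional.
Context {R : realType} {V : normedModType R}.
Implicit Types (f g : V -> R) (x u v : V).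

Lemma near_normP x (P : V -> Prop) : (\near x, P x) ->
  exists2 e : R, 0 < e & forall y, `|y - x| < e -> P y.
Proof.
move=> /nbhs_ballP[e /= e0 he]; exists e => // y hy.
by apply: he; rewrite -ball_normE /ball_ /= distrC.
Qed.

Lemma is_derive_line f x v (s : R) : derivable f (x + s *: v) v ->
  is_derive s 1 (fun r => f (x + r *: v)) ('D_v f (x + s *: v)).
Proof.
move=> df.
have E : (fun h : R => h^-1 *: (((fun r => f (x + r *: v)) \o shift s) (h *: 1)
            - f (x + s *: v))) =
         (fun h : R => h^-1 *: ((f \o shift (x + s *: v)) (h *: v)
            - f (x + s *: v))).
  apply/funext => h /=; congr (_ *: (f _ - _)).
  by rewrite [h%:A]mulr1 scalerDl addrCA.
split; first by rewrite /derivable E.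
by rewrite /derive E.
Qed.

Lemma continuous_line (a : R -> R) x v (s : R) : {for s, continuous a} ->
  {for s, continuous (fun r => x + a r *: v)}.
Proof.
move=> ca; apply: cvgD; first exact: cvg_cst.
by apply: cvgZr_tmp.
Qed.

(* The first factor is handled by the mean value theorem, so that only one of
   the two partial derivatives has to be continuous. *)
Lemma is_derive_curve f u v z (a b : R -> R) (s a' b' : R) :
  is_derive s 1 a a' -> is_derive s 1 b b' ->
  (\forall y \near z + a s *: u + b s *: v, derivable f y u) ->
  {for z + a s *: u + b s *: v, continuous ('D_u f)} ->
  derivable f (z + a s *: u + b s *: v) v ->
  is_derive s 1 (fun r => f (z + a r *: u + b r *: v))
    (a' * 'D_u f (z + a s *: u + b s *: v)
     + b' * 'D_v f (z + a s *: u + b s *: v)).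
Proof.
move=> da db; move Ex : (z + a s *: u + b s *: v) => x dfu cfu dfv.
have ca : {for s, continuous a}.
  by apply: differentiable_continuous; apply/derivable1_diffP; case: da.
have cb : {for s, continuous b}.
  by apply: differentiable_continuous; apply/derivable1_diffP; case: db.
pose P r q := z + q *: u + b r *: v.
have [e e0 He] := near_normP dfu.
(* Uniform in [q]: the mean value theorem locates the intermediate point only between [a s] and
   [a r], so all such points must be close to [x] at once. *)
have close : forall e : R, 0 < e -> \forall r \near s, forall q,
    `|q - a s| <= `|a r - a s| -> `|P r q - x| < e.
  move=> d d0.
  pose K := (`|u| + `|v| + 1); have K0 : 0 < K by rewrite ltr_wpDl// addr_ge0.
  have Ka : \forall r \near s, `|a r - a s| < d / (2 * K).
    move/cvgrPdist_lt: ca => /(_ (d / (2 * K))) /=.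
    rewrite divr_gt0 ?mulr_gt0// => /(_ isT); apply: filterS => r.
    by rewrite distrC.
  have Kb : \forall r \near s, `|b r - b s| < d / (2 * K).
    move/cvgrPdist_lt: cb => /(_ (d / (2 * K))) /=.
    rewrite divr_gt0 ?mulr_gt0// => /(_ isT); apply: filterS => r.
    by rewrite distrC.
  near=> r => q hq.
  have -> : P r q - x = (q - a s) *: u + (b r - b s) *: v.
    rewrite /P -Ex !scalerBl !opprD !addrA.
    by rewrite (ACl (2*5*3*6*(1*4)))/= subrr addr0.
  apply: (le_lt_trans (ler_normD _ _)); rewrite !normrZ.
  have h1 : `|a r - a s| < d / (2 * K) by near: r.
  have h2 : `|b r - b s| < d / (2 * K) by near: r.
  have : (`|q - a s|) * `|u| + `|b r - b s| * `|v| <= d / (2*K) * (`|u| + `|v|).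
    by rewrite mulrDr lerD// ler_wpM2r// ?ltW// (le_lt_trans hq).
  move/le_lt_trans; apply.
  rewrite mulrAC ltr_pdivrMr ?mulr_gt0//.
  rewrite ltr_pM2l// /K; have := normr_ge0 u; have := normr_ge0 v; lra.
have MV : \forall r \near s, exists2 q, `|q - a s| <= `|a r - a s| &
   f (P r (a r)) - f (P r (a s)) = (a r - a s) * 'D_u f (P r q).
  have := close e e0; apply: filterS => r Hr.
  have dl q : `|q - a s| <= `|a r - a s| ->
      is_derive q 1 (fun q => f (P r q)) ('D_u f (P r q)).
    move=> hq.
    have E y : P r y = (z + b r *: v) + y *: u by rewrite /P addrAC.
    rewrite E; under eq_fun do rewrite E.
    by apply: is_derive_line; rewrite -E; apply: He; exact: Hr.
  have cl q : `|q - a s| <= `|a r - a s| -> {for q, continuous (fun q => f (P r q))}.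
    by move=> /dl[dd _]; apply: differentiable_continuous; apply/derivable1_diffP.
  have [le|/ltW le] := leP (a s) (a r).
    have hin y : y \in `[a s, a r] -> `|y - a s| <= `|a r - a s|.
      by rewrite in_itv/= => /andP[h1 h2]; rewrite !ger0_norm ?subr_ge0// lerD2r.
    have [||c hc ->] := @MVT_segment R (fun q => f (P r q)) (fun q => 'D_u f (P r q)) _ _ le.
    - by move=> y hy; apply/dl/hin; apply: subset_itv_oo_cc.
    - apply: derivable_within_continuous => y hy.
      by have [] := dl y (hin _ hy).
    - by exists c; [exact: hin|rewrite mulrC].
  have hin y : y \in `[a r, a s] -> `|y - a s| <= `|a r - a s|.
    rewrite in_itv/= => /andP[h1 h2]; rewrite !ler0_norm ?subr_le0// lerN2.
    by rewrite lerD2r.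
  have [||c hc E] := @MVT_segment R (fun q => f (P r q)) (fun q => 'D_u f (P r q)) _ _ le.
  - by move=> y hy; apply/dl/hin; apply: subset_itv_oo_cc.
  - apply: derivable_within_continuous => y hy.
    by have [] := dl y (hin _ hy).
  - exists c; first exact: hin.
    by rewrite -opprB E mulrC -mulNr opprB.
have db2 : is_derive s 1 (fun r => f (P r (a s))) (b' * 'D_v f x).
  have H := @is_derive_line f (z + a s *: u) v (b s).
  rewrite Ex in H; move: H => /(_ dfv) H.
  have := is_derive1_comp H db.
  by rewrite /= mulrC.
suff da2 : is_derive s 1 (fun r => f (P r (a r)) - f (P r (a s))) (a' * 'D_u f x).
  have -> : (fun r => f (z + a r *: u + b r *: v)) =
    (fun r => f (P r (a r)) - f (P r (a s))) \+ (fun r => f (P r (a s))).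
    by apply/funext => r /=; rewrite subrK.
  exact: is_deriveD.
have H : (fun h => h^-1 *: (((fun r => f (P r (a r)) - f (P r (a s))) \o shift s) (h *: 1)
       - (f (P s (a s)) - f (P s (a s))))) @ 0^' --> (a' * 'D_u f x).
  have /cvgrPdist_lt cD : (fun h : R => h^-1 *: ((a \o shift s) (h *: 1) - a s)) @ 0^' --> a'.
    by case: da => + <-.
  apply/cvgrPdist_lt => /= d d0.
  pose D := 'D_u f x; pose K := `|a'| + `|D| + 2.
  have K1 : 1 < K by rewrite /K; have := normr_ge0 a'; have := normr_ge0 D; lra.
  have K0 : 0 < K by lra.
  (* The error of the product is at most [m] times [|D| + |a'| + 1]; the cap at 1 is what bounds the
     difference quotient [A] by [|a'| + 1]. *)
  pose m := Num.min 1 (d / (2 * K)).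
  have m0 : 0 < m by rewrite lt_min ltr01/= divr_gt0// mulr_gt0.
  have m1 : m <= 1 by rewrite ge_min lexx.
  have m2 : m * (2 * K) <= d by rewrite -ler_pdivlMr ?mulr_gt0// ge_min lexx orbT.
  have [e2 e20 He2] : exists2 e2 : R, 0 < e2 &
      forall y, `|y - x| < e2 -> `|D - 'D_u f y| < m.
    by apply: near_normP; move/cvgrPdist_lt: cfu => /(_ m m0).
  have near0 (Q : R -> Prop) : (\forall r \near s, Q r) -> \forall h \near 0^', Q (h + s).
    move=> /nbhs_ballP[r /= r0 hr]; apply: nbhs_dnbhs; apply/nbhs_ballP.
    exists r => //= h; rewrite -ball_normE /ball_ /= sub0r normrN => hh.
    by apply: hr; rewrite -ball_normE /ball_ /= opprD addrCA subrr addr0 normrN.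
  have A1 := near0 _ (close e2 e20).
  have A2 := near0 _ MV.
  have A3 := cD _ m0.
  near=> h.
  have hn0 : h != 0 by near: h; exact: nbhs_dnbhs_neq.
  have : forall q, `|q - a s| <= `|a (h + s) - a s| -> `|P (h + s) q - x| < e2.
    by near: h.
  have [q hq] : exists2 q, `|q - a s| <= `|a (h + s) - a s| &
     f (P (h + s) (a (h + s))) - f (P (h + s) (a s)) = (a (h + s) - a s) * 'D_u f (P (h + s) q).
    by near: h.
  rewrite /= [h%:A]mulr1 => -> /(_ q hq) /He2.
  rewrite subrr subr0.
  have : `|a' - h^-1 *: ((a \o shift s) (h *: 1) - a s)| < m by near: h.
  rewrite /= [h%:A]mulr1.
  rewrite -[_ *: ((_ - _) * _)]/(_ * ((_ - _) * _)) -[_ *: (_ - _)]/(_ * (_ - _)) mulrA.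
  move: (_ * (a _ - _)) ('D_u f _) => A B hA hB.
  have -> : a' * 'D_u f x - A * B = (a' - A) * D + A * (D - B) by rewrite /D; ring.
  apply: (le_lt_trans (ler_normD _ _)); rewrite !normrM.
  have hA' : `|A| <= `|a'| + 1.
    have -> : A = a' - (a' - A) by ring.
    apply: (le_trans (ler_normB _ _)); rewrite lerD2l; apply: ltW.
    exact: (lt_le_trans hA).
  have : `|a' - A| * `|D| + `|A| * `|D - B| <= m * (`|D| + (`|a'| + 1)).
    rewrite mulrDr [X in _ <= _ + X]mulrC lerD//.
      by rewrite ler_wpM2r// ltW.
    by rewrite ler_pM// ltW.
  move/le_lt_trans; apply; apply: (lt_le_trans _ m2).
  rewrite ltr_pM2l// /K; have := normr_ge0 a'; have := normr_ge0 D; lra.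
split; first by apply/cvg_ex; exists (a' * 'D_u f x).
by rewrite /derive; apply/cvg_lim.
Unshelve. all: by end_near. Qed.

End Directional.

Lemma dist_mid (R : realFieldType) (a b c e : R) :
  `|a - c| < e / 2 -> `|b - c| < e / 2 -> `|a - b| <= e.
Proof. by rewrite !ltr_norml ler_norml => *; lra. Qed.

(** * Calculus of smooth functions on an open set *)

Section Smooth.
Context {R : realType} {V : normedModType R} (U : set V).
Hypothesis oU : open U.
Implicit Types (f g : V -> R) (x u v : V).

Lemma smooth_onW f x : smooth_on U f -> U x -> {for x, continuous f}.
Proof. by move=> sf Ux; have [] := sf [::] x Ux. Qed.

Lemma smooth_on_derivable f x v : smooth_on U f -> U x -> derivable f x v.
Proof. by move=> sf Ux; have [_] := sf [::] x Ux; apply. Qed.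

Lemma smooth_on_derive f v : smooth_on U f -> smooth_on U ('D_v f).
Proof.
move=> sf s x Ux.
by have := sf (rcons s v) x Ux; rewrite foldr_rcons.
Qed.

Lemma near_open x (P : set V) : U x -> (forall y, U y -> P y) -> \near x, P x.
Proof.
move=> Ux H; have : nbhs x U by apply: open_nbhs_nbhs.
by apply: filterS.
Qed.

Lemma eq_on_derive f g x v : U x -> (forall y, U y -> f y = g y) ->
  'D_v f x = 'D_v g x.
Proof. by move=> Ux H; apply: near_eq_derive; exact: near_open. Qed.

(** By induction on the list of directions each iterated derivative agrees on [U] with a member of
    [K]; openness of [U] lets equality on [U] pass to derivatives. Taking for [K] a family of
    explicit formulas closed under derivation proves those formulas smooth. *)
Lemma smooth_on_coind (K : (V -> R) -> Prop) :
  (forall f x, K f -> U x -> {for x, continuous f} /\ forall v, derivable f x v) ->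
  (forall f v, K f -> exists2 g, K g & forall x, U x -> 'D_v f x = g x) ->
  forall f, K f -> smooth_on U f.
Proof.
move=> K1 K2 f Kf s.
have [g Kg fg] : exists2 g, K g &
    forall x, U x -> foldr (fun v h => 'D_v h) f s x = g x.
  elim: s => [|v s [g Kg fg]]; first by exists f.
  have [g' Kg' gg'] := K2 g v Kg; exists g' => // x Ux.
  by rewrite -gg'//=; apply: eq_on_derive.
move=> x Ux; have [cg dg] := K1 g x Kg Ux.
have nfg : \near x, g x = foldr (fun v h => 'D_v h) f s x.
  by apply: near_open => // y /fg ->.
split; last by move=> v; apply: near_eq_derivable (dg v).
rewrite /prop_for /continuous_at fg//; apply: cvg_trans cg.
exact: near_eq_cvg.
Qed.

(* The smallest algebra containing the smooth functions: closed under
   derivation up to equality on U, hence made of smooth functions. *)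
Inductive smooth_alg : (V -> R) -> Prop :=
| salg_base f : smooth_on U f -> smooth_alg f
| salg_eq f g : smooth_alg f -> (forall x, U x -> f x = g x) -> smooth_alg g
| salg_add f g : smooth_alg f -> smooth_alg g -> smooth_alg (f \+ g)
| salg_mul f g : smooth_alg f -> smooth_alg g -> smooth_alg (f \* g).

Lemma smooth_alg_smooth f : smooth_alg f -> smooth_on U f.
Proof.
have K1 : forall h x, smooth_alg h -> U x ->
    {for x, continuous h} /\ forall v, derivable h x v.
  move=> h x; elim=> {h}.
  - move=> h sh Ux; split; first exact: smooth_onW.
    by move=> v; apply: smooth_on_derivable.
  - move=> h g _ IH E Ux; have [ch dh] := IH Ux.
    have nE : \near x, h x = g x by apply: near_open.
    split; last by move=> v; apply: near_eq_derivable (dh v).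
    rewrite /prop_for /continuous_at -E//; apply: cvg_trans ch.
    by apply: near_eq_cvg; apply: filterS nE => y ->.
  - move=> h g _ IH _ IH' Ux; have [ch dh] := IH Ux; have [cg dg] := IH' Ux.
    split; first exact: cvgD.
    by move=> v; apply: derivableD.
  - move=> h g _ IH _ IH' Ux; have [ch dh] := IH Ux; have [cg dg] := IH' Ux.
    split; first exact: cvgM.
    by move=> v; apply: derivableM.
apply: smooth_on_coind => // h v; elim=> {h}.
- move=> h sh; exists ('D_v h) => //; apply: salg_base.
  exact: smooth_on_derive.
- move=> h g _ [h' Kh' hh'] E; exists h' => // x Ux.
  by rewrite -hh'//; apply/esym/eq_on_derive.
- move=> h g Kh [h' Kh' hh'] Kg [g' Kg' gg']; exists (h' \+ g').
    exact: salg_add.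
  move=> x Ux; rewrite -[h \+ g]/(h + g) deriveD.
  + by rewrite hh'// gg'.
  + by have [_] := K1 h x Kh Ux; exact.
  + by have [_] := K1 g x Kg Ux; exact.
- move=> h g Kh [h' Kh' hh'] Kg [g' Kg' gg']; exists ((h \* g') \+ (g \* h')).
    by apply: salg_add; apply: salg_mul.
  move=> x Ux; rewrite -[h \* g]/(h * g) deriveM.
  + by rewrite hh'// gg'.
  + by have [_] := K1 h x Kh Ux; exact.
  + by have [_] := K1 g x Kg Ux; exact.
Qed.

Lemma smooth_on_eq f g : smooth_on U f -> (forall x, U x -> f x = g x) ->
  smooth_on U g.
Proof. by move=> /salg_base sf E; apply: smooth_alg_smooth; apply: salg_eq sf E. Qed.

Lemma smooth_onD f g : smooth_on U f -> smooth_on U g -> smooth_on U (f \+ g).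
Proof. by move=> /salg_base sf /salg_base sg; apply/smooth_alg_smooth/salg_add. Qed.

Lemma smooth_onM f g : smooth_on U f -> smooth_on U g -> smooth_on U (f \* g).
Proof. by move=> /salg_base sf /salg_base sg; apply/smooth_alg_smooth/salg_mul. Qed.

Lemma smooth_on_cst (c : R) : smooth_on U (fun=> c).
Proof.
apply: (smooth_on_coind (K := fun f => exists c, f = fun=> c)); last by exists c.
- move=> f x [d ->] _; split; first exact: cvg_cst.
  by move=> v; apply: derivable_cst.
- move=> f v [d ->]; exists (fun=> 0); first by exists 0.
  by move=> x _; apply: derive_cst.
Qed.

Let segment_derive f x u v (s : R) : smooth_on U f -> U (x + s *: u + v) ->
  is_derive s 1 (fun s => f (x + s *: u + v)) ('D_u f (x + s *: u + v)).
Proof.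
move=> sf; have E y : x + y *: u + v = (x + v) + y *: u by rewrite addrAC.
rewrite E; under eq_fun do rewrite E.
by move=> h; apply: is_derive_line; exact: smooth_on_derivable.
Qed.

(** The mean value theorem is used twice: first in the direction [u], for the increment of [f] along
    [h *: v], then in the direction [v], for the derivative so obtained. *)
Let second_difference f x u v (h : R) : smooth_on U f -> 0 <= h ->
  (forall s r, 0 <= s <= h -> 0 <= r <= h -> U (x + s *: u + r *: v)) ->
  exists s r, [/\ 0 <= s <= h, 0 <= r <= h &
    f (x + h *: u + h *: v) - f (x + h *: u) - (f (x + h *: v) - f x)
    = 'D_v ('D_u f) (x + s *: u + r *: v) * h * h].
Proof.
move=> sf h0 HU.
have HU0 s : 0 <= s <= h -> U (x + s *: u + 0).
  by move=> hs; have := HU s 0 hs; rewrite scale0r lexx; apply.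
pose g (s : R) := f (x + s *: u + h *: v) - f (x + s *: u + 0).
have dg s : s \in `[0, h] -> is_derive s 1 g
    ('D_u f (x + s *: u + h *: v) - 'D_u f (x + s *: u + 0)).
  rewrite in_itv/= => hs; apply: is_deriveB; apply: segment_derive => //.
    by apply: HU => //; rewrite lexx h0.
  exact: HU0.
have cg : {within `[0, h], continuous g}.
  by apply: derivable_within_continuous => y /dg[].
have [s hs Es] := @MVT_segment R g _ 0 h h0
  (fun y hy => dg y (subset_itv_oo_cc hy)) cg.
have hs' := hs; rewrite in_itv/= in hs'.
have dk r : r \in `[0, h] -> is_derive r 1 (fun r => 'D_u f (x + s *: u + r *: v))
    ('D_v ('D_u f) (x + s *: u + r *: v)).
  rewrite in_itv/= => hr; apply: is_derive_line; apply: smooth_on_derivable.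
    exact: smooth_on_derive.
  exact: HU.
have ck : {within `[0, h], continuous (fun r => 'D_u f (x + s *: u + r *: v))}.
  by apply: derivable_within_continuous => y /dk[].
have [r hr Er] := @MVT_segment R (fun r => 'D_u f (x + s *: u + r *: v)) _ 0 h h0
  (fun y hy => dk y (subset_itv_oo_cc hy)) ck.
exists s, r; split=> //.
move: Es Er; rewrite /g !scale0r !subr0 !addr0 => -> ->.
by [].
Qed.

(** Schwarz's theorem. The second difference is symmetric in [u] and [v], so the two mixed
    derivatives share a value at points arbitrarily close to [x], and both are continuous there. *)
Lemma derive_swap f x u v : smooth_on U f -> U x ->
  'D_u ('D_v f) x = 'D_v ('D_u f) x.
Proof.
move=> sf Ux.
have cvu := smooth_onW (smooth_on_derive v (smooth_on_derive u sf)) Ux.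
have cuv := smooth_onW (smooth_on_derive u (smooth_on_derive v sf)) Ux.
apply/eqP; rewrite -subr_eq0 -normr_eq0; apply/eqP.
apply/le_anti; rewrite normr_ge0 andbT; apply/ler_addgt0Pl => e e0.
rewrite addr0; have e20 : 0 < e / 2 by rewrite divr_gt0.
have [d1 d10 Hd1] := near_normP (near_open Ux (fun y Uy => Uy)).
have [d2 d20 Hd2] : exists2 d2 : R, 0 < d2 &
    forall y, `|y - x| < d2 -> `|'D_u ('D_v f) x - 'D_u ('D_v f) y| < e / 2.
  by apply: near_normP; move/cvgrPdist_lt: cuv => /(_ _ e20).
have [d3 d30 Hd3] : exists2 d3 : R, 0 < d3 &
    forall y, `|y - x| < d3 -> `|'D_v ('D_u f) x - 'D_v ('D_u f) y| < e / 2.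
  by apply: near_normP; move/cvgrPdist_lt: cvu => /(_ _ e20).
pose d := Num.min d1 (Num.min d2 d3).
have d0 : 0 < d by rewrite !lt_min d10 d20.
have Hd y : `|y - x| < d -> [/\ U y,
    `|'D_u ('D_v f) x - 'D_u ('D_v f) y| < e / 2 &
    `|'D_v ('D_u f) x - 'D_v ('D_u f) y| < e / 2].
  by rewrite !lt_min => /and3P[h1 h2 h3]; split; [exact: Hd1|exact: Hd2|exact: Hd3].
pose K := `|u| + `|v| + 1.
have K0 : 0 < K by rewrite ltr_wpDl// addr_ge0.
pose h := d / (2 * K); have h0 : 0 < h by rewrite divr_gt0// mulr_gt0.
have Hin s r : 0 <= s <= h -> 0 <= r <= h -> `|x + s *: u + r *: v - x| < d.
  move=> /andP[s0 sh] /andP[r0 rh].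
  rewrite -(addrA x) (addrC x) addrK.
  apply: (le_lt_trans (ler_normD _ _)); rewrite !normrZ !ger0_norm//.
  have : s * `|u| + r * `|v| <= h * (`|u| + `|v|).
    by rewrite mulrDr lerD// ler_wpM2r.
  move/le_lt_trans; apply; rewrite /h mulrAC ltr_pdivrMr ?mulr_gt0// ltr_pM2l//.
  by rewrite /K; have := normr_ge0 u; have := normr_ge0 v; lra.
have [s [r [hs hr E1]]] := @second_difference f x u v h sf (ltW h0)
   (fun s r hs hr => let: And3 a _ _ := Hd _ (Hin s r hs hr) in a).
have Hin' s' r' : 0 <= s' <= h -> 0 <= r' <= h -> `|x + s' *: v + r' *: u - x| < d.
  by move=> hs' hr'; rewrite (addrAC x); exact: Hin.
have [s' [r' [hs' hr' E2]]] := @second_difference f x v u h sf (ltW h0)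
   (fun s r hs hr => let: And3 a _ _ := Hd _ (Hin' s r hs hr) in a).
have [_ _ A1] := Hd _ (Hin s r hs hr).
have [_ A2 _] := Hd _ (Hin' s' r' hs' hr').
have E : 'D_v ('D_u f) (x + s *: u + r *: v) = 'D_u ('D_v f) (x + s' *: v + r' *: u).
  apply: (mulIf (lt0r_neq0 h0)); apply: (mulIf (lt0r_neq0 h0)).
  apply: etrans (esym E1) _; apply: etrans _ E2.
  rewrite (addrAC x (h *: v)).
  move: (f _) (f _) (f _) (f _) => B1 B2 B3 B4; ring.
rewrite E in A1; exact: dist_mid A2 A1.
Qed.

(** A directional derivative is a limit along a single line, so additivity in the direction is a
    chain rule: along [r] in [x + r *: u + r *: v], where the continuity of the [u]-derivative
    enters. *)
Lemma deriveDv f x u v : smooth_on U f -> U x ->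
  'D_(u + v) f x = 'D_u f x + 'D_v f x.
Proof.
move=> sf Ux.
have E0 : x + (0 : R) *: u + (0 : R) *: v = x by rewrite !scale0r !addr0.
have did : is_derive (0 : R) (1 : R) (fun r : R => r) 1 := is_derive_id _ _.
have := @is_derive_curve R V f u v x _ _ 0 1 1 did did.
rewrite E0 => /(_ (near_open Ux (fun y Uy => smooth_on_derivable sf Uy))
  (smooth_onW (smooth_on_derive u sf) Ux) (smooth_on_derivable sf Ux))[_].
rewrite !mul1r => <-.
have := @is_derive_line R V f x (u + v) 0.
rewrite scale0r addr0 => /(_ (smooth_on_derivable sf Ux))[_ <-].
have -> // : (fun r : R => f (x + r *: (u + v))) =
  (fun r : R => f (x + r *: u + r *: v)).
by apply/funext => r; rewrite scalerDr addrA.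
Qed.

Lemma deriveZv f x (c : R) u : smooth_on U f -> U x ->
  'D_(c *: u) f x = c * 'D_u f x.
Proof.
move=> sf Ux.
have E0 : x + (0 : R) *: u + (c * 0) *: u = x by rewrite mulr0 !scale0r !addr0.
have did : is_derive (0 : R) (1 : R) (fun r : R => r) 1 := is_derive_id _ _.
have dc : is_derive (0 : R) 1 (fun r : R => c * r) c.
  by have := is_deriveZ c did; rewrite [c%:A]mulr1.
have d0 : is_derive (0 : R) (1 : R) (fun r : R => 0 : R) 0 := is_derive_cst _ _ _.
have := @is_derive_curve R V f u u x _ _ 0 0 c d0 dc.
rewrite E0 => /(_ (near_open Ux (fun y Uy => smooth_on_derivable sf Uy))
  (smooth_onW (smooth_on_derive u sf) Ux) (smooth_on_derivable sf Ux))[_].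
rewrite !mul0r add0r => <-.
have := @is_derive_line R V f x (c *: u) 0.
rewrite scale0r addr0 => /(_ (smooth_on_derivable sf Ux))[_ <-].
have -> // : (fun r : R => f (x + r *: (c *: u))) =
  (fun r : R => f (x + (0 : R) *: u + (c * r) *: u)).
by apply/funext => r; rewrite scalerA mulrC scale0r addr0.
Qed.

End Smooth.

Lemma ord3P (P : 'I_3 -> Prop) : P 0 -> P 1 -> P 2 -> forall i, P i.
Proof.
move=> P0 P1 P2 [[|[|[|//]]] hi].
- by rewrite (_ : Ordinal hi = 0)//; apply/val_inj.
- by rewrite (_ : Ordinal hi = 1)//; apply/val_inj.
- by rewrite (_ : Ordinal hi = 2)//; apply/val_inj.
Qed.

Lemma sum3E (R : nmodType) (F : 'I_3 -> R) : \sum_(i < 3) F i = F 0 + F 1 + F 2.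
Proof.
rewrite !big_ord_recr big_ord0 /= add0r.
by congr (F _ + F _ + F _); apply/val_inj.
Qed.

(* Sealed copies, so that unification never unfolds them into limits. *)
HB.lock Definition Dt {R : realType} (f : @field R) : @field R := dt f.
HB.lock Definition Dx {R : realType} (i : 'I_3) (f : @field R) : @field R := dx i f.
HB.lock Definition Smooth {R : realType} (f : @field R) : Prop := smooth_field f.

(** * Space-time fields *)

Section Fields.
Context {R : realType}.
Local Notation field := (@field R).
Implicit Types (f g : field) (t a : R) (x : 'rV[R]_3).

Definition uncurry_field f (z : R * 'rV[R]_3) : R := f z.1 z.2.

Lemma open_future : open [set z : R * 'rV[R]_3 | 0 < z.1].
Proof.
rewrite (_ : [set z | _] = fst @^-1` [set t : R | 0 < t])//.
apply: open_comp; last exact: open_gt.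
by move=> z _; exact: cvg_fst.
Qed.

Let U := [set z : R * 'rV[R]_3 | 0 < z.1].
Let oU : open U := open_future.

Lemma SmoothE f : Smooth f = smooth_on U (uncurry_field f).
Proof. by rewrite Smooth.unlock. Qed.

(** Fields are smooth at positive times only, and the powers and inverses of [t] have their meaning
    there. The region is open, so such an equality may be differentiated. *)
Definition eq_pos f g := forall t x, 0 < t -> f t x = g t x.

Lemma DtE f t x : Dt f t x = 'D_(1, 0) (uncurry_field f) (t, x).
Proof.
rewrite Dt.unlock /dt /derive1 /derive.
set F := fun h : R => _; set G := fun h : R => _; have -> // : F = G.
by apply/funext => h; rewrite /F /G /uncurry_field /= scaler0 add0r [_%:A]mulr1.
Qed.

Lemma DxE i f t x : Dx i f t x = 'D_(0, delta_mx 0 i) (uncurry_field f) (t, x).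
Proof.
rewrite Dx.unlock /dx /derive.
set F := fun h : R => _; set G := fun h : R => _; have -> // : F = G.
by apply/funext => h; rewrite /F /G /uncurry_field /= scaler0 add0r.
Qed.

Lemma dt_uncurry f : uncurry_field (Dt f) = 'D_(1, 0) (uncurry_field f).
Proof. by apply/funext => -[t x]; rewrite {1}/uncurry_field /= DtE. Qed.

Lemma dx_uncurry i f :
  uncurry_field (Dx i f) = 'D_(0, delta_mx 0 i) (uncurry_field f).
Proof. by apply/funext => -[t x]; rewrite {1}/uncurry_field /= DxE. Qed.

Lemma smooth_Dt f : Smooth f -> Smooth (Dt f).
Proof.
rewrite !SmoothE => sf; rewrite dt_uncurry.
exact: (@smooth_on_derive _ (R * 'rV[R]_3)%type _ _ (1, 0) sf).
Qed.

Lemma smooth_Dx i f : Smooth f -> Smooth (Dx i f).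
Proof.
rewrite !SmoothE => sf; rewrite dx_uncurry.
exact: (@smooth_on_derive _ (R * 'rV[R]_3)%type _ _ (0, delta_mx 0 i) sf).
Qed.

Lemma eq_pos_dt f g : eq_pos f g -> eq_pos (Dt f) (Dt g).
Proof.
move=> E t x t0; rewrite !DtE; apply: (eq_on_derive oU) => //.
by move=> -[s y] s0; exact: E.
Qed.

Lemma eq_pos_dx i f g : eq_pos f g -> eq_pos (Dx i f) (Dx i g).
Proof.
move=> E t x t0; rewrite !DxE; apply: (eq_on_derive oU) => //.
by move=> -[s y] s0; exact: E.
Qed.

Lemma Dx_Dt i f : Smooth f -> eq_pos (Dx i (Dt f)) (Dt (Dx i f)).
Proof.
rewrite SmoothE => sf t x t0; rewrite DxE DtE dt_uncurry dx_uncurry.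
exact: (@derive_swap R (R * 'rV[R]_3)%type U oU _ (t, x) _ _ sf t0).
Qed.

Lemma Dx_Dx i j f : Smooth f -> eq_pos (Dx i (Dx j f)) (Dx j (Dx i f)).
Proof.
rewrite SmoothE => sf t x t0; rewrite !DxE !dx_uncurry.
exact: (@derive_swap R (R * 'rV[R]_3)%type U oU _ (t, x) _ _ sf t0).
Qed.

(** Smoothness is bundled with closed formulas for all first derivatives, so that sums and products
    of jets can be assembled by following the syntax of an expression. *)
Definition jet f (f0 : field) (f1 : 'I_3 -> field) :=
  [/\ Smooth f, eq_pos (Dt f) f0 & forall i, eq_pos (Dx i f) (f1 i)].

Lemma jet_smooth f : Smooth f -> jet f (Dt f) (fun i => Dx i f).
Proof. by split. Qed.

Lemma smooth_eq_pos f g : eq_pos f g -> Smooth f -> Smooth g.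
Proof.
by rewrite !SmoothE => E sf; apply: (smooth_on_eq oU sf) => -[t x] /= t0; exact: E.
Qed.

Lemma jet_eq f g f0 (f1 : 'I_3 -> field) g0 (g1 : 'I_3 -> field) : eq_pos f g -> eq_pos f0 g0 ->
  (forall i, eq_pos (f1 i) (g1 i)) -> jet f f0 f1 -> jet g g0 g1.
Proof.
move=> E E0 E1 [sf h0 h1]; split; first exact: smooth_eq_pos sf.
- by move=> t x t0; rewrite -(eq_pos_dt E)// h0// E0.
- by move=> i t x t0; rewrite -(eq_pos_dx i E)// h1// E1.
Qed.

Lemma jet_congr f f0 (f1 : 'I_3 -> field) g0 (g1 : 'I_3 -> field) : jet f f0 f1 ->
  eq_pos f0 g0 -> (forall i, eq_pos (f1 i) (g1 i)) -> jet f g0 g1.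
Proof. by move=> Jf E0 E1; apply: jet_eq E0 E1 Jf. Qed.

Lemma jetD f g f0 (f1 : 'I_3 -> field) g0 (g1 : 'I_3 -> field) : jet f f0 f1 -> jet g g0 g1 ->
  jet (fun t x => f t x + g t x) (fun t x => f0 t x + g0 t x)
    (fun i t x => f1 i t x + g1 i t x).
Proof.
rewrite /jet !SmoothE => -[sf f0E f1E] [sg g0E g1E].
split; first exact: (smooth_onD oU sf sg).
- move=> t x t0; rewrite -f0E// -g0E// !DtE.
  have df := smooth_on_derivable sf (t0 : U (t, x)).
  have dg := smooth_on_derivable sg (t0 : U (t, x)).
  exact: deriveD (df _) (dg _).
- move=> i t x t0; rewrite -f1E// -g1E// !DxE.
  have df := smooth_on_derivable sf (t0 : U (t, x)).
  have dg := smooth_on_derivable sg (t0 : U (t, x)).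
  exact: deriveD (df _) (dg _).
Qed.

Lemma jetM f g f0 (f1 : 'I_3 -> field) g0 (g1 : 'I_3 -> field) : jet f f0 f1 -> jet g g0 g1 ->
  jet (fun t x => f t x * g t x) (fun t x => f t x * g0 t x + g t x * f0 t x)
    (fun i t x => f t x * g1 i t x + g t x * f1 i t x).
Proof.
rewrite /jet !SmoothE => -[sf f0E f1E] [sg g0E g1E].
split; first exact: (smooth_onM oU sf sg).
- move=> t x t0; rewrite -f0E// -g0E// !DtE.
  have df := smooth_on_derivable sf (t0 : U (t, x)).
  have dg := smooth_on_derivable sg (t0 : U (t, x)).
  exact: deriveM (df _) (dg _).
- move=> i t x t0; rewrite -f1E// -g1E// !DxE.
  have df := smooth_on_derivable sf (t0 : U (t, x)).
  have dg := smooth_on_derivable sg (t0 : U (t, x)).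
  exact: deriveM (df _) (dg _).
Qed.

Lemma jet_cst (c : R) : jet (fun _ _ => c) (fun _ _ => 0) (fun _ _ _ => 0).
Proof.
split; first by rewrite SmoothE; exact: (smooth_on_cst oU).
- by move=> t x t0; rewrite DtE; exact: derive_cst.
- by move=> i t x t0; rewrite DxE; exact: derive_cst.
Qed.

Lemma jetN f f0 (f1 : 'I_3 -> field) : jet f f0 f1 ->
  jet (fun t x => - f t x) (fun t x => - f0 t x) (fun i t x => - f1 i t x).
Proof.
move=> Jf; apply: jet_eq (jetM (jet_cst (-1)) Jf).
- by move=> t x _; rewrite mulN1r.
- by move=> t x _; rewrite mulN1r mulr0 addr0.
- by move=> i t x _; rewrite mulN1r mulr0 addr0.
Qed.

Lemma is_derive_affine (V : normedModType R) (f L : V -> R) (x v : V) :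
  (forall h : R, f (h *: v + x) = f x + h * L v) -> is_derive x v f (L v).
Proof.
move=> H.
have cv : (fun h => h^-1 *: ((f \o shift x) (h *: v) - f x)) @ 0^' --> L v.
  apply: cvg_near_cst; have := @nbhs_dnbhs_neq R 0; apply: filterS => h h0.
  by rewrite /= H addrAC subrr add0r [_ *: _]mulrA mulVf// mul1r.
split; first by apply/cvg_ex; exists (L v).
exact: cvg_lim cv.
Qed.

Lemma jet_coord j : jet (fun _ x => x 0 j) (fun _ _ => 0) (fun i _ _ => (i == j)%:R).
Proof.
have D (c d : R) z v : is_derive z v (fun z : R * 'rV[R]_3 => c * z.2 0 j + d) (c * v.2 0 j).
  refine (@is_derive_affine _ (fun z : R * 'rV[R]_3 => c * z.2 0 j + d)
    (fun v => c * v.2 0 j) z v _) => h /=.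
  by rewrite !mxE; ring.
have C (c d : R) z : {for z, continuous (fun z : R * 'rV[R]_3 => c * z.2 0 j + d)}.
  apply: cvgD; last exact: cvg_cst.
  apply: cvgM; first exact: cvg_cst.
  exact: (@continuous_comp _ _ _ snd (fun M : 'rV[R]_3 => M 0 j) z cvg_snd
    (@coord_continuous _ _ _ 0 j _)).
split.
- rewrite SmoothE; apply: (smooth_on_eq oU (f := fun z : R * 'rV[R]_3 => 1 * z.2 0 j + 0)); last first.
    by move=> z _; rewrite mul1r addr0.
  pose K (f : R * 'rV[R]_3 -> R) := exists c d, f = fun z => c * z.2 0 j + d.
  have HK : forall u, K u -> smooth_on U u; last by apply: HK; exists 1, 0.
  refine (@smooth_on_coind _ _ U oU K _ _).
  + by move=> f z [c [d ->]] _; split => // v; have [] := D c d z v.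
  + move=> f v [c [d ->]]; exists (fun z : R * 'rV[R]_3 => 0 * z.2 0 j + c * v.2 0 j).
      by exists 0, (c * v.2 0 j).
    by move=> z _; have [_ ->] := D c d z v; rewrite mul0r add0r.
- move=> t x t0; rewrite DtE /=.
  have := D 1 0 (t, x) (1, 0); rewrite /= mxE mulr0 => -[_ E].
  apply: etrans E; by apply: (eq_on_derive oU) => // z _; rewrite mul1r addr0.
- move=> i t x t0; rewrite DxE /=.
  have := D 1 0 (t, x) (0, delta_mx 0 i); rewrite /= mxE /= mul1r eq_sym => -[_ E].
  apply: etrans E; by apply: (eq_on_derive oU) => // z _; rewrite mul1r addr0.
Qed.

Lemma is_derive_fst (V : normedModType R) (c : R -> R) (c' : R) (z v : R * V) :
  is_derive z.1 1 c c' -> is_derive z v (fun z => c z.1) (c' * v.1).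
Proof.
move=> dc.
have d2 : is_derive (0 : R) (1 : R) (fun h : R => h * v.1 + z.1) v.1.
  have := @is_derive_affine R (fun h : R => h * v.1 + z.1) (fun r => r * v.1) 0 1.
  rewrite mul1r; apply => h.
  by rewrite [h%:A]mulr1 addr0 mul0r add0r addrC.
have E0 : z.1 = (fun h : R => h * v.1 + z.1) 0 by rewrite /= mul0r add0r.
rewrite {1}E0 in dc.
have [D1 D2] := @is_derive1_comp R c (fun h : R => h * v.1 + z.1) 0 c' v.1 dc d2.
split.
  by apply/derivable1P.
rewrite -D2 /derive.
rewrite (_ : (fun h : R => h^-1 *: ((_ \o shift z) _ - _)) =
  (fun h : R => h^-1 *: (((c \o (fun h : R => h * v.1 + z.1)) \o shift 0) (h *: 1)
  - (c \o (fun h : R => h * v.1 + z.1)) 0)))//.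
apply/funext => h /=.
by rewrite [h%:A]mulr1 addr0 mul0r add0r.
Qed.

Lemma jet_powR a : jet (fun t _ => t `^ a) (fun t _ => a * t `^ a / t) (fun _ _ _ => 0).
Proof.
have D (c b : R) (z v : R * 'rV[R]_3) : U z ->
    is_derive z v (fun z => c * z.1 `^ b) (c * (b * z.1 `^ (b - 1)) * v.1).
  move=> z0.
  have H := is_deriveZ c (is_derive1_powR b z0).
  exact: (@is_derive_fst _ (fun t => c * t `^ b) _ z v H).
have C (c b : R) (z : R * 'rV[R]_3) : U z -> {for z, continuous (fun z => c * z.1 `^ b)}.
  move=> z0; apply: cvgM; first exact: cvg_cst.
  apply: (@continuous_comp _ _ _ fst (fun t : R => t `^ b) z cvg_fst).
  apply: differentiable_continuous.
  by apply/derivable1_diffP; have [] := is_derive1_powR b z0.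
have powB1 (t : R) : 0 < t -> t `^ (a - 1) = t `^ a / t.
  by move=> t0; rewrite powRB; [rewrite powRr1// ltW|rewrite (gt_eqF t0) implybT].
split.
- rewrite SmoothE; apply: (smooth_on_eq oU (f := fun z : R * 'rV[R]_3 => 1 * z.1 `^ a)); last first.
    by move=> z _; rewrite mul1r.
  (* The exponent must be free: each derivative lowers it by one, and only the family of all
     multiples of real powers is closed under derivation. *)
  pose K (f : R * 'rV[R]_3 -> R) := exists c b, f = fun z => c * z.1 `^ b.
  have HK : forall u, K u -> smooth_on U u; last by apply: HK; exists 1, a.
  refine (@smooth_on_coind _ _ U oU K _ _).
  + by move=> f z [c [d ->]] z0; split; [exact: C|move=> v; have [] := D c d z v z0].
  + move=> f v [c [b ->]]; exists (fun z : R * 'rV[R]_3 => (c * b * v.1) * z.1 `^ (b - 1)).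
      by exists (c * b * v.1), (b - 1).
    by move=> z z0; have [_ ->] := D c b z v z0; ring.
- move=> t x t0; rewrite DtE -mulrA -powB1//.
  have := D 1 a (t, x) (1, 0) t0; rewrite /= mul1r mulr1 => -[_ E].
  apply: etrans E; by apply: (eq_on_derive oU) => // z _; rewrite mul1r.
- move=> i t x t0; rewrite DxE.
  have := D 1 a (t, x) (0, delta_mx 0 i) t0; rewrite /= mulr0 => -[_ E].
  apply: etrans E; by apply: (eq_on_derive oU) => // z _; rewrite mul1r.
Qed.

Lemma jet_id : jet (fun t _ => t) (fun _ _ => 1) (fun _ _ _ => 0).
Proof.
apply: jet_eq (jet_powR 1) => //.
- by move=> t x t0; rewrite powRr1// ltW.
- by move=> t x t0; rewrite powRr1 ?ltW// mul1r mulfV// gt_eqF.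
Qed.

Lemma jet_inv : jet (fun t _ => t^-1) (fun t _ => - (t^-1 * t^-1)) (fun _ _ _ => 0).
Proof.
apply: jet_eq (jet_powR (-1)) => //.
- by move=> t x t0; rewrite powR_inv1// ltW.
- by move=> t x t0; rewrite powR_inv1 ?ltW// -mulrA mulN1r.
Qed.

End Fields.

Ltac smooth_tac :=
  repeat first [assumption | apply: smooth_Dt | apply: smooth_Dx].

Ltac jet_tac :=
  cbv beta; lazymatch goal with
  | |- jet (fun t x => (@?A t x + @?B t x)%R) _ _ =>
      refine (@jetD _ A B _ _ _ _ _ _); jet_tac
  | |- jet (fun t x => (@?A t x * @?B t x)%R) _ _ =>
      refine (@jetM _ A B _ _ _ _ _ _); jet_tac
  | |- jet (fun t x => (- @?A t x)%R) _ _ => refine (@jetN _ A _ _ _); jet_tac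
  | |- jet (fun t x => (t)^-1%R) _ _ => apply: jet_inv
  | |- jet (fun t x => powR t ?a) _ _ => exact: (jet_powR a)
  | |- jet (fun t x => fun_of_matrix x _ ?j) _ _ => exact: (jet_coord j)
  | |- jet (fun t x => Dt ?f t x) _ _ => apply: (@jet_smooth _ (Dt f)); smooth_tac
  | |- jet (fun t x => Dx ?i ?f t x) _ _ => apply: (@jet_smooth _ (Dx i f)); smooth_tac
  | |- jet (Dt ?f) _ _ => apply: (@jet_smooth _ (Dt f)); smooth_tac
  | |- jet (Dx ?i ?f) _ _ => apply: (@jet_smooth _ (Dx i f)); smooth_tac
  | |- jet (fun t x => t) _ _ => apply: jet_id
  | |- jet (fun t x => ?c) _ _ => exact: (jet_cst c)
  end.

(** After the derivatives and coordinates have become variables, a commutator identity is a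
    polynomial or rational identity for [ring] or [field]. *)
Ltac atomize :=
  repeat match goal with
  | |- context [Dt ?f ?t ?x] => move: (Dt f t x) => ?
  | |- context [Dx ?i ?f ?t ?x] => move: (Dx i f t x) => ?
  end;
  repeat match goal with
  | |- context [fun_of_matrix ?x ?i ?j] => move: (fun_of_matrix x i j) => ?
  end.

(** * The generators and the wave operator *)

Section Generators.
Context {R : realType} (p : R).
Hypothesis p01 : 0 < p < 1.
Local Notation field := (@field R).
Implicit Types (f g : field) (t a : R) (x : 'rV[R]_3).

Let p1 : 1 - p != 0. Proof. by case/andP: p01 => _ ?; rewrite subr_eq0 gt_eqF. Qed.

Lemma tau_powR t : 0 < t -> tau p t * t `^ p = t / (1 - p).
Proof.
move=> t0; rewrite /tau mulrAC -powRD ?(gt_eqF t0) ?implybT//.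
by rewrite subrK powRr1// ltW.
Qed.

Lemma powR2p t : t `^ (2 * p) = t `^ p * t `^ p.
Proof. by rewrite mulrC powRrM powR_mulrn ?expr2// powR_ge0. Qed.

Definition Dtau f : field := fun t x => t `^ p * Dt f t x.

Definition Rot (i j : 'I_3) f : field :=
  fun t x => x 0 i * Dx j f t x - x 0 j * Dx i f t x.

(** Since $\tau t^p = t/(1-p)$, the part $\tau\partial_\tau$ of the scaling field is
    $t\partial_t/(1-p)$, free of real powers of [t]. The agreement with [scaling] holds at positive
    times. *)
Definition Scal f : field := fun t x =>
  (1 - p)^-1 * (t * Dt f t x)
  + (x 0 0 * Dx 0 f t x + x 0 1 * Dx 1 f t x + x 0 2 * Dx 2 f t x).

Lemma dtauE f : dtau p f = Dtau f.
Proof. by rewrite /Dtau Dt.unlock. Qed.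

Lemma rotationE i j f : rotation i j f = Rot i j f.
Proof. by rewrite /Rot Dx.unlock. Qed.

Lemma scalingE f : eq_pos (scaling p f) (Scal f).
Proof.
move=> t x t0; rewrite /scaling sum3E /dtau mulrA tau_powR// /Scal Dt.unlock Dx.unlock.
congr (_ + _); rewrite mulrAC mulrC; congr (_ * _); exact: mulrC.
Qed.

Lemma DtauE f t x : Dtau f t x = t `^ p * Dt f t x. Proof. by []. Qed.

Lemma RotE i j f t x : Rot i j f t x = x 0 i * Dx j f t x - x 0 j * Dx i f t x.
Proof. by []. Qed.

Lemma ScalE f t x : Scal f t x = (1 - p)^-1 * (t * Dt f t x)
  + (x 0 0 * Dx 0 f t x + x 0 1 * Dx 1 f t x + x 0 2 * Dx 2 f t x).
Proof. by []. Qed.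

Lemma jet_Dtau f : Smooth f -> jet (Dtau f)
  (fun t x => p * t `^ p / t * Dt f t x + t `^ p * Dt (Dt f) t x)
  (fun i t x => t `^ p * Dx i (Dt f) t x).
Proof.
move=> sf; rewrite /Dtau; refine (jet_congr (_ : jet _ _ _) _ _); first by jet_tac.
- by move=> t x t0 /=; atomize; ring.
- by move=> i t x t0 /=; atomize; ring.
Qed.

Lemma jet_Rot j k f : Smooth f -> jet (Rot j k f)
  (fun t x => x 0 j * Dt (Dx k f) t x - x 0 k * Dt (Dx j f) t x)
  (fun i t x => (i == j)%:R * Dx k f t x + x 0 j * Dx i (Dx k f) t x
     - (i == k)%:R * Dx j f t x - x 0 k * Dx i (Dx j f) t x).
Proof.
move=> sf; rewrite /Rot; refine (jet_congr (_ : jet _ _ _) _ _); first by jet_tac.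
- by move=> t x t0 /=; atomize; ring.
- by move=> i t x t0 /=; atomize; ring.
Qed.

Lemma jet_Scal f : Smooth f -> jet (Scal f)
  (fun t x => (1 - p)^-1 * (Dt f t x + t * Dt (Dt f) t x)
    + (x 0 0 * Dt (Dx 0 f) t x + x 0 1 * Dt (Dx 1 f) t x + x 0 2 * Dt (Dx 2 f) t x))
  (fun i t x => (1 - p)^-1 * (t * Dx i (Dt f) t x)
    + ((i == 0)%:R * Dx 0 f t x + (i == 1)%:R * Dx 1 f t x + (i == 2)%:R * Dx 2 f t x)
    + (x 0 0 * Dx i (Dx 0 f) t x + x 0 1 * Dx i (Dx 1 f) t x
       + x 0 2 * Dx i (Dx 2 f) t x)).
Proof.
move=> sf; rewrite /Scal; refine (jet_congr (_ : jet _ _ _) _ _); first by jet_tac.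
- by move=> t x t0 /=; atomize; ring.
- by move=> i t x t0 /=; atomize; ring.
Qed.

(** The numbering carries meaning: letters 0 to 3 are the derivatives, so [g <= 3] marks a
    derivative, and the order is that in which [apply_mi] composes its factors, so that
    nondecreasing words are the monomials of the norms. *)
Definition gens : seq (field -> field) :=
  [:: Dtau; Dx 0; Dx 1; Dx 2; Rot 0 1; Rot 0 2; Rot 1 2; Scal].

Definition gen (i : 'I_8) : field -> field := nth id gens i.

Definition word (w : seq 'I_8) f : field := foldr gen f w.

Lemma smooth_gen i f : Smooth f -> Smooth (gen i f).
Proof.
move=> sf; rewrite /gen.
have s0 : Smooth (Dtau f) by have [] := jet_Dtau sf.
have s1 j k : Smooth (Rot j k f) by have [] := jet_Rot j k sf.
have s2 : Smooth (Scal f) by have [] := jet_Scal sf.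
have s3 j := smooth_Dx j sf.
case: i => [[|[|[|[|[|[|[|[|//]]]]]]]] hi] /=.
all: first [exact: s0|exact: s3|exact: s1|exact: s2].
Qed.

Lemma smooth_word w f : Smooth f -> Smooth (word w f).
Proof. by elim: w => //= i w IH /IH; exact: smooth_gen. Qed.

Lemma eq_pos_gen i f g : eq_pos f g -> eq_pos (gen i f) (gen i g).
Proof.
move=> E; rewrite /gen.
have E0 := eq_pos_dt E; have E1 j := eq_pos_dx j E.
case: i => [[|[|[|[|[|[|[|[|//]]]]]]]] hi] /=; try exact: E1;
  move=> t x t0; rewrite ?ScalE ?RotE ?DtauE//.
all: by rewrite ?E0// ?E1.
Qed.

(* [bracket a b = (e, d)] encodes [gen a, gen b] = e gen d. *)
Definition bracket (a b : nat) : R * nat :=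
  match a, b with
  | 0, 7 => ((1)%R, 0)
  | 1, 4 => ((1)%R, 2) | 2, 4 => ((-1)%R, 1)
  | 1, 5 => ((1)%R, 3) | 3, 5 => ((-1)%R, 1)
  | 2, 6 => ((1)%R, 3) | 3, 6 => ((-1)%R, 2)
  | 1, 7 => ((1)%R, 1) | 2, 7 => ((1)%R, 2) | 3, 7 => ((1)%R, 3)
  | 4, 5 => ((-1)%R, 6) | 4, 6 => ((1)%R, 5) | 5, 6 => ((-1)%R, 4)
  | _, _ => ((0)%R, 0)
  end%N.

Let gen_bracket_lt (a b : 'I_8) f : (a < b)%N -> Smooth f ->
  eq_pos (gen a (gen b f))
    (fun t x => gen b (gen a f) t x + (bracket a b).1 * nth id gens (bracket a b).2 f t x).
Proof.
move=> + sf.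
have [_ dt0 dx0] := jet_Dtau sf.
have [_ dt1 dx1] := jet_Rot 0 1 sf.
have [_ dt2 dx2] := jet_Rot 0 2 sf.
have [_ dt3 dx3] := jet_Rot 1 2 sf.
have [_ dt4 dx4] := jet_Scal sf.
rewrite /gen; case: a => [[|[|[|[|[|[|[|[|//]]]]]]]] ha];
  case: b => [[|[|[|[|[|[|[|[|//]]]]]]]] hb] //= _ t x t0;
  rewrite !(DtauE, RotE, ScalE).
all: rewrite ?(dt0 _ _ t0) ?(dx0 _ _ _ t0) ?(dt1 _ _ t0) ?(dx1 _ _ _ t0)
  ?(dt2 _ _ t0) ?(dx2 _ _ _ t0) ?(dt3 _ _ t0) ?(dx3 _ _ _ t0) ?(dt4 _ _ t0) ?(dx4 _ _ _ t0).
all: rewrite ?(@Dx_Dt R _ f sf t x t0) ?(@Dx_Dx R 1 0 f sf t x t0)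
  ?(@Dx_Dx R 2 0 f sf t x t0) ?(@Dx_Dx R 2 1 f sf t x t0) /=.
all: have tn : t != 0 by rewrite gt_eqF.
all: by atomize; field; rewrite ?p1 ?tn.
Qed.

Lemma word_cat u v f : word (u ++ v) f = word u (word v f).
Proof. by rewrite /word foldr_cat. Qed.

(** The two side conditions say that the derivatives form an ideal, and that a bracket with [Dtau]
    is a multiple of [Dtau]. The first lets a derivative be moved to the front of a word, the second
    keeps the errors of the wave operator in the form that the bulk controls. *)
Lemma gen_bracket (a b : 'I_8) : exists (e : R) (d : 'I_8),
  [/\ ((a <= 3) || (b <= 3) -> d <= 3)%N, (a == 0) || (b == 0) -> d = 0 &
  forall f, Smooth f -> eq_pos (gen a (gen b f))
    (fun t x => gen b (gen a f) t x + e * gen d f t x)].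
Proof.
wlog ab : a b / (a < b)%N => [H|].
  have [|ba|/val_inj ab] := ltngtP a b; first exact: H.
    have [e [d [hd hd0 E]]] := H b a ba; exists (- e), d; rewrite orbC (orbC (a == 0)).
    by split => // f sf t x t0; rewrite E// mulNr addrK.
  exists 0, 0; split => // f sf t x t0; rewrite ab mul0r addr0//.
have hb : ((bracket a b).2 < 8)%N.
  by move: ab; case: a => [[|[|[|[|[|[|[|[|//]]]]]]]] ha];
    case: b => [[|[|[|[|[|[|[|[|//]]]]]]]] hb].
exists (bracket a b).1, (Ordinal hb); split; last first.
- by move=> f sf; exact: gen_bracket_lt.
- by move=> h; apply/val_inj; move: ab h; case: a hb => [[|[|[|[|[|[|[|[|//]]]]]]]] ha] + + +;
    case: b => [[|[|[|[|[|[|[|[|//]]]]]]]] hb].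
by move: ab; case: a hb => [[|[|[|[|[|[|[|[|//]]]]]]]] ha] + + ;
    case: b => [[|[|[|[|[|[|[|[|//]]]]]]]] hb].
Qed.

Lemma genD i f g : Smooth f -> Smooth g -> eq_pos
  (gen i (fun t x => f t x + g t x)) (fun t x => gen i f t x + gen i g t x).
Proof.
move=> sf sg; have [_ d0 d1] := jetD (jet_smooth sf) (jet_smooth sg).
rewrite /gen; case: i => [[|[|[|[|[|[|[|[|//]]]]]]]] hi] /=; try exact: d1;
  move=> t x t0; rewrite !(DtauE, RotE, ScalE) ?(d0 _ _ t0) ?(d1 _ _ _ t0).
all: by atomize; ring.
Qed.

(** The generator [i] applied to the function $t^{-a}$. Decay is never lost: [Dtau] raises the
    exponent to $a+1-p$, scaling keeps it. *)
Definition gen_pow (i : 'I_8) (a t : R) : R :=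
  if i == 0 then - a * t `^ (- (a + (1 - p)))
  else if i == 7 then - a / (1 - p) * t `^ (- a) else 0.

Lemma genM_pow i (c a : R) f : Smooth f -> eq_pos
  (gen i (fun t x => c * t `^ (- a) * f t x))
  (fun t x => c * t `^ (- a) * gen i f t x + c * gen_pow i a t * f t x).
Proof.
move=> sf.
have [_ d0 d1] := jetM (jetM (jet_cst c) (jet_powR (- a))) (jet_smooth sf).
have E t : 0 < t -> t `^ (- (a + (1 - p))) = t `^ (- a) * t `^ p / t.
  move=> t0; rewrite opprD opprB addrA -[_ / t]/(_ * t^-1) -powR_inv1 ?ltW//.
  by rewrite !powRD ?(gt_eqF t0) ?implybT.
rewrite /gen /gen_pow; case: i => [[|[|[|[|[|[|[|[|//]]]]]]]] hi] /=;
  move=> t x t0; rewrite ?(DtauE, RotE, ScalE) ?(d0 _ _ t0) ?(d1 _ _ _ t0) ?E//=.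
all: have tn : t != 0 by rewrite gt_eqF.
all: move: (t `^ (- a)) (t `^ p) => *; atomize.
all: try by field; rewrite ?tn ?p1.
all: by ring.
Qed.

Definition Box f : field := fun t x =>
  - Dt (Dt f) t x - 3 * p / t * Dt f t x
  + (t `^ (2 * p))^-1 * (Dx 0 (Dx 0 f) t x + Dx 1 (Dx 1 f) t x + Dx 2 (Dx 2 f) t x).

Lemma boxE f : box p f = Box f.
Proof.
by apply/funext => t; apply/funext => x; rewrite /box /Box sum3E Dt.unlock Dx.unlock.
Qed.

(** Closed formulas for the derivatives of [g] are substituted under the second derivatives, which
    turns [Box] of a generator into an expression in derivatives of the original field. *)
Lemma Box_jet g (g0 g00 b0 b1 b2 : field) (g1 g01 a0 a1 a2 : 'I_3 -> field) :
  jet g g0 g1 -> jet g0 g00 g01 -> jet (g1 0) b0 a0 -> jet (g1 1) b1 a1 ->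
  jet (g1 2) b2 a2 ->
  eq_pos (Box g) (fun t x => - g00 t x - 3 * p / t * g0 t x
    + (t `^ p * t `^ p)^-1 * (a0 0 t x + a1 1 t x + a2 2 t x)).
Proof.
move=> [_ E0 E1] [_ E00 _] [_ _ F0] [_ _ F1] [_ _ F2] t x t0.
rewrite /Box (eq_pos_dt E0 _ t0) E00// E0// powR2p.
by rewrite !(eq_pos_dx _ (E1 _) _ t0) F0// F1// F2.
Qed.

(** The inverse of a power of [t] becomes a power with negative exponent, a shape that [jet_tac] can
    differentiate. *)
Let Box' f : field := fun t x =>
  - Dt (Dt f) t x + - (3 * p * (t^-1 * Dt f t x))
  + t `^ (- (2 * p)) * (Dx 0 (Dx 0 f) t x + Dx 1 (Dx 1 f) t x + Dx 2 (Dx 2 f) t x).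

Let Box'E f : eq_pos (Box' f) (Box f).
Proof. by move=> t x t0; rewrite /Box' /Box powRN !mulrA. Qed.

Lemma jet_Box f : Smooth f -> jet (Box f)
  (fun t x => - Dt (Dt (Dt f)) t x - 3 * p / t * Dt (Dt f) t x
     + 3 * p / (t * t) * Dt f t x
     + (t `^ p * t `^ p)^-1 * (Dt (Dx 0 (Dx 0 f)) t x + Dt (Dx 1 (Dx 1 f)) t x
       + Dt (Dx 2 (Dx 2 f)) t x)
     - 2 * p / t * (t `^ p * t `^ p)^-1 * (Dx 0 (Dx 0 f) t x + Dx 1 (Dx 1 f) t x
       + Dx 2 (Dx 2 f) t x))
  (fun i t x => - Dx i (Dt (Dt f)) t x - 3 * p / t * Dx i (Dt f) t x
     + (t `^ p * t `^ p)^-1 * (Dx i (Dx 0 (Dx 0 f)) t x + Dx i (Dx 1 (Dx 1 f)) t x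
       + Dx i (Dx 2 (Dx 2 f)) t x)).
Proof.
move=> sf; refine (jet_eq (@Box'E f) _ _ (_ : jet (Box' f) _ _)); last first.
- by rewrite /Box'; jet_tac.
- move=> i t x t0 /=; rewrite powRN powR2p.
  by move: (_^-1) => b; atomize; ring.
- move=> t x t0 /=; rewrite powRN powR2p.
  have tn : t != 0 by rewrite gt_eqF.
  by move: ((_ * _)^-1) => b; atomize; field.
Qed.

Lemma smooth_Box f : Smooth f -> Smooth (Box f).
Proof. by move=> /jet_Box[]. Qed.

(** In conformal time $t^{2p}\square=-\partial_\tau^2-2p\,t^{p-1}\partial_\tau+\Delta$. Spatial
    derivatives and rotations commute with it. It is homogeneous of degree $-2$ in $(\tau,x)$, and
    $S t^{2p}=\frac{2p}{1-p}t^{2p}$, so scaling gives $2+\frac{2p}{1-p}=\frac2{1-p}$. For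
    $\partial_\tau$, differentiating $t^{2p}$ gives [box_alpha], and differentiating the coefficient
    $2p\,t^{p-1}$ gives [box_beta]. *)
Definition box_alpha (i : 'I_8) (t : R) : R :=
  if i == 0 then 2 * p * t `^ (- (1 - p)) else if i == 7 then 2 / (1 - p) else 0.

Definition box_beta (i : 'I_8) (t : R) : R :=
  if i == 0 then - (2 * p * (1 - p)) * t `^ (- 2) else 0.

Lemma Box_gen i f : Smooth f -> eq_pos (Box (gen i f)) (fun t x =>
  gen i (Box f) t x + box_alpha i t * Box f t x + box_beta i t * Dtau f t x).
Proof.
move=> sf; have [_ B0 B1] := jet_Box sf.
have E1 t : 0 < t -> t `^ (- (1 - p)) = t `^ p / t.
  move=> t0; rewrite opprB -[_ / t]/(_ * t^-1) -powR_inv1 ?ltW//.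
  by rewrite powRD ?(gt_eqF t0) ?implybT.
have E2 t : 0 < t -> t `^ (- 2) = (t * t)^-1.
  by move=> t0; rewrite powRN powR_mulrn ?ltW// expr2.
have N1 k t x : 0 < t -> Dx k (Dt (Dt f)) t x = Dt (Dt (Dx k f)) t x.
  move=> t0; rewrite (Dx_Dt k (smooth_Dt sf) _ t0).
  by rewrite (eq_pos_dt (Dx_Dt k sf) _ t0).
have N2 k t x : 0 < t -> Dx k (Dx k (Dt f)) t x = Dt (Dx k (Dx k f)) t x.
  move=> t0; rewrite (eq_pos_dx k (Dx_Dt k sf) _ t0).
  by rewrite (Dx_Dt k (smooth_Dx k sf) _ t0).
have N3 k l t x : 0 < t -> Dx k (Dx l (Dx l f)) t x = Dx l (Dx l (Dx k f)) t x.
  move=> t0; rewrite (Dx_Dx k l (smooth_Dx l sf) _ t0).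
  by rewrite (eq_pos_dx l (Dx_Dx k l sf) _ t0).
rewrite /gen /box_alpha /box_beta; case: i => [[|[|[|[|[|[|[|[|//]]]]]]]] hi] /=;
  move=> t x t0; rewrite ?(DtauE, RotE, ScalE) ?(B0 _ _ t0) ?(B1 _ _ _ t0) ?E1// ?E2//.
all: have tn : t != 0 by rewrite gt_eqF.
all: have an : t `^ p != 0 by rewrite gt_eqF// powR_gt0.
1: erewrite (Box_jet (jet_Dtau sf)); [|jet_tac..|exact: t0].
2: erewrite (Box_jet (jet_smooth (smooth_Dx 0 sf))); [|jet_tac..|exact: t0].
3: erewrite (Box_jet (jet_smooth (smooth_Dx 1 sf))); [|jet_tac..|exact: t0].
4: erewrite (Box_jet (jet_smooth (smooth_Dx 2 sf))); [|jet_tac..|exact: t0].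
5: erewrite (Box_jet (jet_Rot 0 1 sf)); [|jet_tac..|exact: t0].
6: erewrite (Box_jet (jet_Rot 0 2 sf)); [|jet_tac..|exact: t0].
7: erewrite (Box_jet (jet_Rot 1 2 sf)); [|jet_tac..|exact: t0].
8: erewrite (Box_jet (jet_Scal sf)); [|jet_tac..|exact: t0].
all: rewrite /Box powR2p /=.
all: rewrite ?(N1 _ _ _ t0) ?(N2 _ _ _ t0) ?(N3 0 1 _ _ t0) ?(N3 0 2 _ _ t0)
  ?(N3 1 0 _ _ t0) ?(N3 1 2 _ _ t0) ?(N3 2 0 _ _ t0) ?(N3 2 1 _ _ t0).
all: rewrite ?(@Dx_Dt R _ f sf t x t0) ?(@Dx_Dx R 1 0 f sf t x t0)
  ?(@Dx_Dx R 2 0 f sf t x t0) ?(@Dx_Dx R 2 1 f sf t x t0).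
all: move: (t `^ p) an => b an; atomize; field.
all: by rewrite ?p1 ?tn ?an.
Qed.

End Generators.

(** * Words in the generators *)

Section Span.
Context {R : realType} (p : R).
Hypothesis p01 : 0 < p < 1.
Local Notation field := (@field R).
Local Notation gen := (gen p).
Local Notation word := (word p).
Local Notation Box := (Box p).
Implicit Types (f g : field) (t a c : R) (x : 'rV[R]_3) (v w : seq 'I_8).

Let p1 : 1 - p != 0. Proof. by case/andP: p01 => _ ?; rewrite subr_eq0 gt_eqF. Qed.
Let p0 : 0 < p. Proof. by case/andP: p01. Qed.
Let pl1 : p < 1. Proof. by case/andP: p01. Qed.

Definition tcomb (l : seq (R * R * seq 'I_8)) f : field :=
  fun t x => \sum_(q <- l) q.1.1 * t `^ (- q.1.2) * word q.2 f t x.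

(** The list is chosen before the field. This is the source of uniformity: every constant derived
    from it is independent of the solution. [P] records admissible pairs of a decay exponent and a
    word. *)
Definition tspan (P : R -> seq 'I_8 -> Prop) (T : field -> field) :=
  exists2 l, (forall q, q \in l -> P q.1.2 q.2) &
    forall f, Smooth f -> eq_pos (T f) (tcomb l f).

Lemma tspan0 P : tspan P (fun _ _ _ => 0).
Proof. by exists [::] => // f sf t x t0; rewrite /tcomb big_nil. Qed.

Lemma tspan_eq P (T T' : field -> field) :
  (forall f, Smooth f -> eq_pos (T f) (T' f)) -> tspan P T -> tspan P T'.
Proof. by move=> E [l Hl El]; exists l => // f sf t x t0; rewrite -E// El. Qed.

Lemma tspan_add P T T' : tspan P T -> tspan P T' ->
  tspan P (fun f t x => T f t x + T' f t x).
Proof.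
move=> [l Hl El] [l' Hl' El']; exists (l ++ l').
  by move=> q; rewrite mem_cat => /orP[/Hl|/Hl'].
by move=> f sf t x t0; rewrite El// El'// /tcomb big_cat.
Qed.

Lemma tspan_word (P : R -> seq 'I_8 -> Prop) c a v : P a v ->
  tspan P (fun f t x => c * t `^ (- a) * word v f t x).
Proof.
move=> Pav; exists [:: (c, a, v)]; first by move=> q; rewrite inE => /eqP ->.
by move=> f sf t x t0; rewrite /tcomb big_seq1.
Qed.

Lemma tspan_word0 (P : R -> seq 'I_8 -> Prop) v : P 0 v -> tspan P (word v).
Proof.
move=> H; apply: tspan_eq (tspan_word 1 H) => f sf t x t0.
by rewrite oppr0 powRr0 !mul1r.
Qed.

Lemma tspan_tcomb P l :
  (forall q, q \in l -> tspan P (fun f t x => q.1.1 * t `^ (- q.1.2) * word q.2 f t x)) ->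
  tspan P (tcomb l).
Proof.
elim: l => [|q l IH] H.
  by apply: tspan_eq (tspan0 P) => f sf t x t0; rewrite /tcomb big_nil.
apply: tspan_eq (tspan_add (H q _) (IH _)); last 2 first.
- by rewrite inE eqxx.
- by move=> q' hq'; apply: H; rewrite inE hq' orbT.
by move=> f sf t x t0; rewrite /tcomb big_cons.
Qed.

Lemma tspan_scale P (P' : R -> seq 'I_8 -> Prop) c b T :
  (forall a v, P a v -> P' (b + a) v) -> tspan P T ->
  tspan P' (fun f t x => c * t `^ (- b) * T f t x).
Proof.
move=> H [l Hl El].
exists [seq (c * q.1.1, b + q.1.2, q.2) | q <- l].
  by move=> q /mapP[q' /Hl hq' ->]; exact: H.
move=> f sf t x t0; rewrite El// /tcomb big_map mulr_sumr; apply: eq_bigr => q _ /=.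
rewrite opprD powRD ?(gt_eqF t0) ?implybT//; ring.
Qed.

Lemma tspan_cscale P c T : tspan P T -> tspan P (fun f t x => c * T f t x).
Proof.
move=> H; apply: tspan_eq (@tspan_scale P P c 0 T _ H).
  by move=> f sf t x t0; rewrite oppr0 powRr0 mulr1.
by move=> a v; rewrite add0r.
Qed.

Lemma tspan_subst P P' T :
  (forall a v, P a v -> tspan P' (fun f t x => t `^ (- a) * word v f t x)) ->
  tspan P T -> tspan P' T.
Proof.
move=> H [l Hl El]; apply: (@tspan_eq _ (tcomb l)).
  by move=> f sf t x t0; rewrite El.
apply: tspan_tcomb => q /Hl /H; move=> /(tspan_cscale q.1.1).
by apply: tspan_eq => f sf t x t0; rewrite mulrA.
Qed.

Lemma tspan_mono (P P' : R -> seq 'I_8 -> Prop) T :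
  (forall a v, P a v -> P' a v) -> tspan P T -> tspan P' T.
Proof. by move=> H [l Hl El]; exists l => // q /Hl /H. Qed.

Lemma smooth_tcomb l f : Smooth f -> Smooth (tcomb l f).
Proof.
move=> sf; elim: l => [|q l IH].
  have [s0 _ _] := @jet_cst R 0.
  by apply: smooth_eq_pos s0 => t x t0; rewrite /tcomb big_nil.
have [s1 _ _] := jetD (jetM (jetM (jet_cst q.1.1) (jet_powR (- q.1.2)))
  (jet_smooth (smooth_word p q.2 sf))) (jet_smooth IH).
by apply: smooth_eq_pos s1 => t x t0; rewrite /tcomb big_cons.
Qed.

Let tspan_gen_aux (P P' : R -> seq 'I_8 -> Prop) i T :
  (forall c a v, P a v ->
     tspan P' (fun f => gen i (fun t x => c * t `^ (- a) * word v f t x))) ->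
  tspan P T -> tspan P' (fun f => gen i (T f)).
Proof.
move=> H [l Hl El].
suff {El T} : tspan P' (fun f => gen i (tcomb l f)).
  by apply: tspan_eq => f sf t x t0; rewrite (eq_pos_gen p i (El f sf) _ t0).
elim: l Hl => [|q l IH] Hl.
  apply: tspan_eq (tspan0 P') => f sf t x t0.
  have [s0 _ _] := @jet_cst R 0.
  have := @genM_pow R p p01 i 0 0 _ s0 t x t0; rewrite /gen_pow !mul0r addr0 => E.
  have E2 : eq_pos (tcomb [::] f) (fun t _ => 0 * t `^ (- 0) * 0).
    by move=> s y _; rewrite /tcomb big_nil mul0r mul0r.
  by rewrite (eq_pos_gen p i E2 _ t0) E.
have Pq : P q.1.2 q.2 by apply: Hl; rewrite inE eqxx.
have {}IH : tspan P' (fun f => gen i (tcomb l f)).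
  by apply: IH => q' hq'; apply: Hl; rewrite inE hq' orbT.
apply: tspan_eq (tspan_add (H q.1.1 _ _ Pq) IH) => f sf t x t0 /=.
have s1 := smooth_word p q.2 sf.
have [s2 _ _] := jetM (jetM (jet_cst q.1.1) (jet_powR (- q.1.2))) (jet_smooth s1).
have E : eq_pos (tcomb (q :: l) f) (fun t x => q.1.1 * t `^ (- q.1.2) * word q.2 f t x
   + tcomb l f t x) by move=> s y _; rewrite /tcomb big_cons.
by rewrite (eq_pos_gen p i E _ t0) (genD p i s2 (smooth_tcomb l sf) _ t0).
Qed.

(** Leibniz rule: the generator lengthens the word, or it falls on the power of [t] and then only
    adds decay, [1 - p] or nothing. *)
Lemma tspan_gen (P P' : R -> seq 'I_8 -> Prop) i T :
  (forall a v, P a v -> P' a (i :: v)) ->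
  (forall a b v, P a v -> 0 <= b -> P' (a + b) v) -> tspan P T ->
  tspan P' (fun f => gen i (T f)).
Proof.
move=> H1 H2; apply: tspan_gen_aux => c a v Pav.
have [d [b [b0 Eb]]] : exists d b, 0 <= b /\ forall t, 0 < t ->
    gen_pow p i a t = d * t `^ (- (a + b)).
  rewrite /gen_pow; case: (i == 0).
    by exists (- a), (1 - p); split => //; rewrite subr_ge0 ltW.
  case: (i == 7); first by exists (- a / (1 - p)), 0; rewrite addr0.
  by exists 0, 0; split => // t _; rewrite mul0r.
apply: tspan_eq (tspan_add (tspan_word c (H1 _ _ Pav))
  (tspan_word (c * d) (H2 _ _ _ Pav b0))) => f sf t x t0 /=.
by rewrite (genM_pow p01 i _ _ (smooth_word p v sf) _ t0) Eb// !mulrA.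
Qed.

Lemma tspan_gen_cst (P P' : R -> seq 'I_8 -> Prop) i T :
  (forall a v, P a v -> a = 0) -> (forall a v, P a v -> tspan P' (word (i :: v))) ->
  tspan P T -> tspan P' (fun f => gen i (T f)).
Proof.
move=> H0 H; apply: tspan_gen_aux => c a v Pav; have := H _ _ Pav.
rewrite (H0 _ _ Pav) => /(tspan_cscale c); apply: tspan_eq => f sf t x t0 /=.
rewrite (genM_pow p01 i _ _ (smooth_word p v sf) _ t0) /gen_pow oppr0 !mul0r.
by rewrite !if_same mulr0 mul0r addr0 powRr0 mulr1.
Qed.

(* Transposing two letters of a word costs their bracket, hence a shorter word. *)
Definition short n (a : R) v := a = 0 /\ (size v < n)%N.

Let tspan_gen_short n i T : tspan (short n) T -> tspan (short n.+1) (fun f => gen i (T f)).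
Proof.
apply: tspan_gen_cst => [a v [] //|a v [_ hv]].
by apply: tspan_word0; split.
Qed.

Definition leI (i j : 'I_8) := (i <= j)%N.

Lemma leI_trans : transitive leI. Proof. by move=> ? ? ?; exact: leq_trans. Qed.

(** One pass of insertion sort: the new letter moves right past smaller letters, and each exchange
    leaves a bracket, that is, a word shorter by one letter. *)
Let insert u i : sorted leI u -> exists u', [/\ sorted leI u', perm_eq u' (i :: u) &
  tspan (short (size u).+1) (fun f t x => word (i :: u) f t x - word u' f t x)].
Proof.
elim: u i => [|j u IH] i su.
  exists [:: i]; split => //; apply: tspan_eq (tspan0 _) => f sf t x t0.
  by rewrite subrr.
have [ij|ji] := leqP i j.
  exists [:: i, j & u]; split => //; first by rewrite /= {1}/leI ij.
  by apply: tspan_eq (tspan0 _) => f sf t x t0; rewrite subrr.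
have su' : sorted leI u by move: su => /= /path_sorted.
have [u' [su'1 pu' Hu']] := IH i su'.
exists (j :: u'); split.
- rewrite /= path_sortedE; last exact: leI_trans.
  rewrite su'1 andbT (perm_all _ pu') /= {1}/leI (ltnW ji) /=.
  by move: su; rewrite /= path_sortedE; [case/andP|exact: leI_trans].
- rewrite -(perm_cons j) in pu'; apply: perm_trans pu' _.
  by apply/permP => P /=; rewrite addnCA.
have [e [d [_ _ Ed]]] := gen_bracket p01 i j.
have Hd : short (size (j :: u)).+1 0 (d :: u) by split.
apply: tspan_eq (tspan_add (tspan_word e Hd) (tspan_gen_short j Hu')) => f sf t x t0 /=.
have s1 := smooth_word p u sf.
rewrite (Ed _ s1 _ _ t0) oppr0 powRr0 mulr1.
have E : eq_pos (fun t x => gen i (word u f) t x - word u' f t x)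
   (fun t x => gen i (word u f) t x + -1 * t `^ (- 0) * word u' f t x).
  by move=> s y _; rewrite oppr0 powRr0 mulr1 mulN1r.
rewrite (eq_pos_gen p j E _ t0).
have s2 := smooth_word p u' sf.
have [s3 _ _] := jetM (jetM (jet_cst (-1)) (jet_powR (- 0))) (jet_smooth s2).
rewrite (genD p j (smooth_gen p i s1) s3 _ t0) (genM_pow p01 j _ _ s2 _ t0).
rewrite /gen_pow oppr0 !mul0r !if_same mulr0 mul0r addr0 powRr0 mulr1 mulN1r.
ring.
Qed.

Let sort_word w : exists w', [/\ sorted leI w', perm_eq w' w &
  tspan (short (size w)) (fun f t x => word w f t x - word w' f t x)].
Proof.
elim: w => [|i w [w' [sw' pw' Hw']]].
  exists [::]; split => //; apply: tspan_eq (tspan0 _) => f sf t x t0.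
  by rewrite subrr.
have [u' [su' pu' Hu']] := insert i sw'.
exists u'; split => //.
  by apply: perm_trans pu' _; rewrite perm_cons.
rewrite (perm_size pw') in Hu'.
apply: tspan_eq (tspan_add (tspan_gen_short i Hw') Hu') => f sf t x t0 /=.
have s1 := smooth_word p w sf; have s2 := smooth_word p w' sf.
have E : eq_pos (fun t x => word w f t x - word w' f t x)
   (fun t x => word w f t x + -1 * t `^ (- 0) * word w' f t x).
  by move=> s y _; rewrite oppr0 powRr0 mulr1 mulN1r.
have [s3 _ _] := jetM (jetM (jet_cst (-1)) (jet_powR (- 0))) (jet_smooth s2).
rewrite (eq_pos_gen p i E _ t0) (genD p i s1 s3 _ t0) (genM_pow p01 i _ _ s2 _ t0).
rewrite /gen_pow oppr0 !mul0r !if_same mulr0 mul0r addr0 powRr0 mulr1 mulN1r.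
ring.
Qed.

Definition canonical n (a : R) v := [/\ a = 0, sorted leI v & (size v <= n)%N].

(** The spanning half of the Poincare-Birkhoff-Witt theorem: sorting costs strictly shorter words,
    which are sorted in turn by induction on the length. *)
Lemma pbw n w : (size w <= n)%N -> tspan (canonical n) (word w).
Proof.
have [m] := ubnP (size w); elim: m w n => // m IH w n; rewrite ltnS => wm wn.
have [w' [sw' pw' Hw']] := sort_word w.
have C' : canonical n 0 w' by split => //; rewrite (perm_size pw').
have H2 : tspan (canonical n) (fun f t x => word w f t x - word w' f t x).
  apply: tspan_subst Hw' => a v [-> hv].
  apply: tspan_eq (IH v n (leq_trans hv wm) (leq_trans (ltnW hv) wn)).
  by move=> f sf t x t0; rewrite oppr0 powRr0 mul1r.
apply: tspan_eq (tspan_add (tspan_word0 C') H2) => f sf t x t0.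
by rewrite addrC subrK.
Qed.

Definition box_source n (a : R) v := 0 <= a /\ (size v <= n)%N.

(* The decay [t^(-a)] is what the bulk term of the energy estimate can absorb. *)
Definition box_error n (a : R) v :=
  1 + p <= a /\ exists2 v', v = 0 :: v' & (size v' < n)%N.

(** Induction on the word with [Box_gen]. The two operators separate what is controlled by the
    source from what must be absorbed by the bulk. *)
Lemma Box_word w : exists T1 T2, [/\ tspan (box_source (size w)) T1,
  tspan (box_error (size w)) T2 &
  forall f, Smooth f ->
    eq_pos (Box (word w f)) (fun t x => T1 (Box f) t x + T2 f t x)].
Proof.
elim: w => [|i w [T1 [T2 [H1 H2 E]]]].
  exists (fun f => f), (fun _ _ _ => 0); split.
  - by apply: (tspan_word0 (v := [::])); split.
  - exact: tspan0.
  - by move=> f sf t x t0; rewrite addr0.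
have G1 : tspan (box_source (size (i :: w))) (fun f => gen i (T1 f)).
  apply: tspan_gen H1 => [a v [a0 sv]|a b v [a0 sv] b0]; first by split.
  by split; [exact: addr_ge0|exact: leqW].
have G2 : tspan (box_error (size (i :: w))) (fun f => gen i (T2 f)).
  (* Right after the generator is applied it may stand in front of [Dtau]; the second alternative
     records those words. *)
  pose Q n a v := 1 + p <= a /\ (exists2 v', v = 0 :: v' & (size v' < n)%N) \/
    1 + p <= a /\ (exists2 v', v = [:: i, 0 & v'] & (size v' < n)%N).
  have : tspan (Q (size w)) (fun f => gen i (T2 f)).
    apply: tspan_gen H2 => [a v [a0 [v' -> sv]]|a b v [a0 sv] b0].
      by right; split => //; exists v'.
    by left; split => //; rewrite ler_wpDr.
  apply: tspan_subst => a v [[a0 [v' -> sv]]|[a0 [v' -> sv]]].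
    have H : box_error (size (i :: w)) a (0 :: v').
      by split => //; exists v' => //; exact: leqW.
    by apply: tspan_eq (tspan_word 1 H) => f sf t x t0; rewrite mul1r.
  (* Since [d] is 0, moving [Dtau] back to the front creates only words that again start with
     [Dtau]. *)
  have [e [d [_ hd Ed]]] := gen_bracket p01 i 0.
  rewrite hd ?eqxx ?orbT// in Ed.
  have Ha : box_error (size (i :: w)) a [:: 0, i & v'].
    by split => //; exists (i :: v').
  have Hb : box_error (size (i :: w)) a (0 :: v').
    by split => //; exists v' => //; exact: leqW.
  apply: tspan_eq (tspan_add (tspan_word 1 Ha) (tspan_word e Hb)) => f sf t x t0 /=.
  rewrite (Ed _ (smooth_word p v' sf) _ _ t0); ring.
have Hal : exists c b, 0 <= b /\ forall t, 0 < t -> box_alpha p i t = c * t `^ (- b).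
  rewrite /box_alpha; case: (i == 0).
    by exists (2 * p), (1 - p); split => //; rewrite subr_ge0 ltW.
  case: (i == 7); first by exists (2 / (1 - p)), 0; rewrite oppr0; split => // t; rewrite powRr0 mulr1.
  by exists 0, 0; split => // t; rewrite mul0r.
have Hbe : exists c, forall t, 0 < t -> box_beta p i t = c * t `^ (- 2).
  rewrite /box_beta; case: (i == 0); first by exists (- (2 * p * (1 - p))).
  by exists 0 => t; rewrite mul0r.
have [c [b [b0 Ea]]] := Hal; have [c' Eb] := Hbe.
have A1 : tspan (box_source (size (i :: w))) (fun f t x => c * t `^ (- b) * T1 f t x).
  apply: tspan_scale H1 => a v [a0 sv]; split; first exact: addr_ge0.
  exact: leqW.
have A2 : tspan (box_error (size (i :: w))) (fun f t x => c * t `^ (- b) * T2 f t x).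
  apply: tspan_scale H2 => a v [a0 [v' -> sv]]; split; first by rewrite ler_wpDl.
  by exists v' => //; exact: leqW.
(* The new error of [box_beta] decays like $t^{-2}$, which is enough because $p<1$ gives
   $2\ge1+p$. *)
have Hw : box_error (size (i :: w)) 2 (0 :: w).
  by split; [rewrite -[2]/(1 + 1 : R) lerD2l ltW|exists w].
exists (fun f t x => gen i (T1 f) t x + c * t `^ (- b) * T1 f t x),
  (fun f t x => gen i (T2 f) t x + c * t `^ (- b) * T2 f t x
     + c' * t `^ (- 2) * word (0 :: w) f t x); split.
- exact: tspan_add.
- by apply: tspan_add; [exact: tspan_add|exact: tspan_word].
move=> f sf t x t0 /=.
have s1 := smooth_word p w sf.
have sB := smooth_Box p sf.
rewrite (Box_gen p01 i s1 _ t0) Ea// Eb// (E _ sf _ _ t0).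
have S T P g : tspan P T -> Smooth g -> Smooth (T g).
  move=> [l _ El] sg; apply: smooth_eq_pos (smooth_tcomb l sg) => s y s0.
  by rewrite El.
rewrite (eq_pos_gen p i (E _ sf) _ t0).
rewrite (genD p i (S _ _ _ H1 sB) (S _ _ _ H2 sf) _ t0).
have -> : gen 0 (word w f) = Dtau p (word w f) by [].
ring.
Qed.

Lemma sorted_blocks (c : 'I_8 -> nat) s : sorted leI s ->
  sorted leI (flatten [seq nseq (c i) i | i <- s]).
Proof.
rewrite !(sorted_pairwise leI_trans).
elim: s => //= i s IH /andP[h /IH hs]; rewrite pairwise_cat hs andbT.
apply/andP; split.
  apply/allrelP => j k /nseqP[-> _] /flattenP[_ /mapP[l ls ->] /nseqP[-> _]].
  by move/allP: h; exact.
by elim: (c i) => //= n ->; rewrite andbT; apply/allP => j /nseqP[-> _]; rewrite /leI.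
Qed.

(** A sorted list is the only sorted permutation of itself, so a sorted word is recovered from its
    letter counts, which will be the exponents of a multi-index. *)
Lemma sorted_wordE w : sorted leI w ->
  w = flatten [seq nseq (count_mem i w) i | i <- enum 'I_8].
Proof.
move=> sw; apply: (sorted_eq leI_trans) => //.
- by move=> i j /anti_leq /val_inj.
- apply: sorted_blocks; have := iota_sorted 0 8; rewrite -val_enum_ord.
  by rewrite sorted_map; apply: sub_sorted => i j; rewrite /leI.
apply/allP => j _; apply/eqP; rewrite count_flatten -map_comp sumnE big_map big_enum /=.
under eq_bigr do rewrite count_nseq.
rewrite (bigD1 j) //= eqxx mul1n big1 ?addn0// => i /negPf.
by move=> ->; rewrite mul0n.
Qed.

(* These differ from [gen] at nonpositive times. *)
Definition defs_gens : seq (field -> field) :=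
  [:: dtau p; dx 0; dx 1; dx 2; rotation 0 1; rotation 0 2; rotation 1 2; scaling p].

Lemma defs_gensE (i : 'I_8) f g : eq_pos f g -> eq_pos (nth id defs_gens i f) (gen i g).
Proof.
move=> E t x t0; rewrite -(eq_pos_gen p i E _ t0).
case: i => [[|[|[|[|[|[|[|[|//]]]]]]]] hi]; rewrite /gen /=.
- by rewrite dtauE.
- by rewrite Dx.unlock.
- by rewrite Dx.unlock.
- by rewrite Dx.unlock.
- by rewrite rotationE.
- by rewrite rotationE.
- by rewrite rotationE.
- by rewrite scalingE.
Qed.

Lemma iter_defs_gens i n f g : eq_pos f g ->
  eq_pos (iter n (nth id defs_gens (i : 'I_8)) f) (foldr gen g (nseq n i)).
Proof. by move=> E; elim: n => //= n; exact: defs_gensE. Qed.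

Definition blocks (c : 'I_8 -> nat) : seq 'I_8 :=
  flatten [seq nseq (c i) i | i <- enum 'I_8].

Lemma blocksE (c : 'I_8 -> nat) : exists i0 i1 i2 i3 i4 i5 i6 i7 : 'I_8,
  [/\ [/\ i0 = 0%N :> nat, i1 = 1%N :> nat, i2 = 2%N :> nat & i3 = 3%N :> nat],
      [/\ i4 = 4%N :> nat, i5 = 5%N :> nat, i6 = 6%N :> nat & i7 = 7%N :> nat] &
  blocks c = nseq (c i0) i0 ++ nseq (c i1) i1 ++ nseq (c i2) i2 ++ nseq (c i3) i3
    ++ nseq (c i4) i4 ++ nseq (c i5) i5 ++ nseq (c i6) i6 ++ nseq (c i7) i7].
Proof.
have : map val (enum 'I_8) = iota 0 8 by rewrite val_enum_ord.
rewrite /blocks; case: (enum 'I_8) => // i0 [//|i1 [//|i2 [//|i3 [//|i4 [//|i5 [//|i6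
  [//|i7 [|//]]]]]]]] [e0 e1 e2 e3 e4 e5 e6 e7].
exists i0, i1, i2, i3, i4, i5, i6, i7; split => //.
by rewrite /= cats0.
Qed.

Lemma apply_mi_blocks n (a : multiindex n) (c : 'I_8 -> nat) f :
  [seq c i | i <- enum 'I_8] = map val a.1.1 ++ map val a.1.2 ++ [:: val a.2] ->
  eq_pos (apply_mi p a f) (word (blocks c) f).
Proof.
case: a => -[[a1 h1] [a2 h2]] a3 /=.
case: a1 h1 => [//|b0 [//|b1 [//|b2 [//|b3 [|//]]]]] h1.
case: a2 h2 => [//|b4 [//|b5 [//|b6 [|//]]]] h2 /= Ec.
rewrite /apply_mi /monomial /=.
rewrite /blocks; have Ev : map val (enum 'I_8) = iota 0 8 by rewrite val_enum_ord.
move: Ec Ev; case: (enum 'I_8) => // i0 [//|i1 [//|i2 [//|i3 [//|i4 [//|i5 [//|i6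
  [//|i7 [|//]]]]]]]] [<- <- <- <- <- <- <- <-] [e0 e1 e2 e3 e4 e5 e6 e7] /=.
rewrite cats0 !word_cat.
have H i m (G : field -> field) f' g' : (forall h, nth id defs_gens (i : 'I_8) h = G h) ->
    eq_pos f' g' -> eq_pos (iter m G f') (word (nseq m i) g').
  move=> EG E; have -> : iter m G f' = iter m (nth id defs_gens i) f'.
    by apply: eq_iter => h; rewrite EG.
  exact: iter_defs_gens.
do 8![apply: (H); first by move=> h; rewrite ?e0 ?e1 ?e2 ?e3 ?e4 ?e5 ?e6 ?e7].
by [].
Qed.

Lemma size_blocks (c : 'I_8 -> nat) : size (blocks c) = (\sum_(i < 8) c i)%N.
Proof.
rewrite /blocks size_flatten sumnE /shape -map_comp big_map big_enum /=.
by apply: eq_bigr => i _; rewrite size_nseq.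
Qed.

Lemma mi_sizeE n (a : multiindex n) :
  mi_size a = sumn (map val a.1.1 ++ map val a.1.2 ++ [:: val a.2]).
Proof.
rewrite /mi_size !sumn_cat /= addn0 addnA; congr (_ + _ + _)%N.
  by rewrite sumnE big_map big_tuple.
by rewrite sumnE big_map big_tuple.
Qed.

Lemma apply_mi_word n (a : multiindex n) :
  exists2 w, size w = mi_size a & forall f, eq_pos (apply_mi p a f) (word w f).
Proof.
pose s := map val a.1.1 ++ map val a.1.2 ++ [:: val a.2].
pose c (i : 'I_8) := nth 0%N s i.
have Ec : [seq c i | i <- enum 'I_8] = s.
  have ss : size s = 8 by rewrite /s !size_cat !size_map !size_tuple.
  apply: (@eq_from_nth _ 0%N); first by rewrite size_map size_enum_ord ss.
  move=> i; rewrite size_map size_enum_ord => hi.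
  rewrite (nth_map (Ordinal hi)) ?size_enum_ord// /c.
  by rewrite nth_enum_ord.
exists (blocks c); last by move=> f; exact: apply_mi_blocks.
rewrite size_blocks mi_sizeE -/s -Ec sumnE big_map big_enum//.
Qed.

Lemma sorted_word_mi n w : sorted leI w -> (size w <= n)%N ->
  exists2 a : multiindex n, (mi_size a <= n)%N &
    forall f, eq_pos (word w f) (apply_mi p a f).
Proof.
move=> sw wn; pose c i := count_mem i w.
have cn i : (c i < n.+1)%N by rewrite ltnS (leq_trans (count_size _ _)).
have [i0 [i1 [i2 [i3 [i4 [i5 [i6 [i7 [[e0 e1 e2 e3] [e4 e5 e6 e7] _]]]]]]]]] := blocksE c.
pose o i : 'I_n.+1 := Ordinal (cn i).
pose a : multiindex n := ([tuple o i0; o i1; o i2; o i3], [tuple o i4; o i5; o i6], o i7).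
have Ea : [seq c i | i <- enum 'I_8] = map val a.1.1 ++ map val a.1.2 ++ [:: val a.2].
  rewrite /= ; have -> : enum 'I_8 = [:: i0; i1; i2; i3; i4; i5; i6; i7].
    apply: (inj_map val_inj); rewrite val_enum_ord /=.
    by rewrite -[val i0]/(i0 : nat) e0 e1 e2 e3 e4 e5 e6 e7.
  by [].
have Ew := sorted_wordE sw.
exists a.
  rewrite mi_sizeE -Ea sumnE big_map big_enum /= -size_blocks.
  by rewrite /blocks /c -Ew.
move=> f t x t0; rewrite (apply_mi_blocks f Ea)//.
by rewrite /blocks /c -Ew.
Qed.

End Span.

(** * Integrals of nonnegative functions *)

Section Monotone.
Context d (T : measurableType d) (R : realType) (mu : {measure set T -> \bar R}).
Import HBNNSimple.

(** The integral of a nonnegative function is a supremum over the simple functions below it, so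
    comparison holds without any measurability. *)
Lemma le_integral_nonneg (D : set T) (f g : T -> \bar R) :
  (forall x, D x -> (0 <= f x)%E) -> (forall x, D x -> (f x <= g x)%E) ->
  (\int[mu]_(x in D) f x <= \int[mu]_(x in D) g x)%E.
Proof.
move=> f0 fg; have g0 x : D x -> (0 <= g x)%E by move=> Dx; apply: le_trans (f0 x Dx) (fg x Dx).
rewrite !ge0_integralE//; apply: le_ereal_sup => _ [h hf <-]; exists h => // x.
apply: le_trans (hf x) _; rewrite /patch; case: ifPn => // xD.
by apply: fg; rewrite inE in xD.
Qed.

Lemma le_integral_subset (A B : set T) (f : T -> \bar R) :
  (forall x, (0 <= f x)%E) -> A `<=` B ->
  (\int[mu]_(x in A) f x <= \int[mu]_(x in B) f x)%E.
Proof.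
move=> f0 AB; rewrite (integral_mkcond A) (integral_mkcond B).
apply: le_integral_nonneg => x _; first by rewrite /patch; case: ifP.
rewrite /patch; case: ifPn => xA; last by case: ifP.
by rewrite ifT// inE; apply: AB; rewrite inE in xA.
Qed.

(* Q and P play the role of the negative and positive parts of a function of
   integral zero. *)
Lemma le_integral_balanced (f g P Q : T -> \bar R) :
  measurable_fun setT f -> measurable_fun setT g -> measurable_fun setT P ->
  measurable_fun setT Q ->
  (forall x, (0 <= f x)%E) -> (forall x, (0 <= g x)%E) ->
  (forall x, (0 <= P x)%E) -> (forall x, (0 <= Q x)%E) ->
  (forall x, (f x + Q x <= g x + P x)%E) ->
  (\int[mu]_x P x = \int[mu]_x Q x)%E -> (\int[mu]_x P x < +oo)%E ->
  (\int[mu]_x f x <= \int[mu]_x g x)%E.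
Proof.
move=> mf mg mP mQ f0 g0 P0 Q0 H E F.
have : (\int[mu]_x (f x + Q x) <= \int[mu]_x (g x + P x))%E.
  by apply: le_integral_nonneg => x _ //; exact: adde_ge0.
rewrite !ge0_integralD// -E leeD2rE// ge0_fin_numE//.
exact: integral_ge0.
Qed.

End Monotone.

(** * Measurability and iterated integrals in three variables *)

Section Caratheodory.
Context d (T : measurableType d) (R : realType).

(** [r] is rounded down to the grid of step [1 / (n + 1)]. Each rounded function is measurable as a
    countable union over grid points, and continuity in [r] gives pointwise convergence. *)
Lemma measurable_fun_caratheodory (f : T * R -> R) :
  (forall x, continuous (fun r => f (x, r))) ->
  (forall r, measurable_fun setT (fun x => f (x, r))) ->
  measurable_fun setT f.
Proof.
move=> cf mf.
pose q n (r : R) : R := (Num.floor (n.+1%:R * r))%:~R / n.+1%:R.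
apply: (@measurable_fun_cvg _ _ _ setT (fun n z => f (z.1, q n z.2))).
- move=> n _ B mB; rewrite setTI.
  have -> : (fun z => f (z.1, q n z.2)) @^-1` B = \bigcup_(k : int)
     ((fst @^-1` ((fun x => f (x, k%:~R / n.+1%:R)) @^-1` B)) `&`
      (snd @^-1` ((fun r : R => n.+1%:R * r) @^-1` `[k%:~R, (k + 1)%:~R[))).
    apply/seteqP; split => -[x r] /=.
      move=> H; exists (Num.floor (n.+1%:R * r)) => //; split => //=.
      by rewrite in_itv /= floor_itv.
    move=> [k _ [H]] /=; rewrite in_itv /= => Hk.
    by rewrite /q (floor_def Hk).
  apply: countable_bigcupT_measurable; first exact: countableP.
  move=> k; apply: measurableI.
    rewrite -[X in measurable X]setTI; apply: measurable_fst => //.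
    by rewrite -[X in measurable X]setTI; exact: mf.
  rewrite -[X in measurable X]setTI; apply: measurable_snd => //.
  rewrite -[X in measurable X]setTI.
  by apply: mulrl_measurable => //; exact: measurable_itv.
- move=> [x r] _ /=.
  have cq : q^~ r @ \oo --> r.
    apply/cvgrPdist_le => e e0.
    have := @cvg_harmonic R => /cvgrPdist_le /(_ e e0); apply: filterS => n.
    rewrite sub0r normrN /= ger0_norm ?invr_ge0// => hn.
    apply: le_trans hn.
    have n0 : 0 < n.+1%:R :> R by [].
    have /andP[h1 h2] := floor_itv (n.+1%:R * r); rewrite intrD in h2.
    rewrite /q ger0_norm.
      rewrite lerBlDr -(ler_pM2l n0) mulrDr divff ?gt_eqF// mulrCA divff ?gt_eqF// mulr1.
      by rewrite addrC ltW.
    rewrite subr_ge0 -(ler_pM2l n0) mulrCA divff ?gt_eqF// mulr1//.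
  exact: (cvg_comp _ _ cq (cf x r)).
Qed.

End Caratheodory.

Section Tonelli3.
Context d1 d2 d3 (T1 : measurableType d1) (T2 : measurableType d2)
  (T3 : measurableType d3) (R : realType).
Variables (m1 : {sigma_finite_measure set T1 -> \bar R})
  (m2 : {sigma_finite_measure set T2 -> \bar R})
  (m3 : {sigma_finite_measure set T3 -> \bar R}).
Variable u : T1 * T2 * T3 -> \bar R.
Hypothesis mu0 : measurable_fun setT u.
Hypothesis u0 : forall y, (0 <= u y)%E.

Let H c : measurable_fun setT (fun x : T1 * T2 => u (x, c)).
Proof. exact: measurable_fun_pair1. Qed.

Let H0 c (x : T1 * T2) : (0 <= u (x, c))%E. Proof. by []. Qed.

(* The canonical sigma-finite structure of [m1 \x m2] is the one available for
   subprobabilities only, hence this alias. *)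
Let m12 : set (T1 * T2) -> \bar R := (m1 \x m2)%E.
HB.instance Definition _ := Measure.on m12.
HB.instance Definition _ := Measure_isSigmaFinite.Build _ _ _ m12
  (lebesgue_integral_fubini.product_measure_sigma_finite_subproof m1 m2).

Lemma tonelli3_321 : (\int[(m1 \x m2) \x m3]_y u y =
  \int[m3]_c \int[m2]_b \int[m1]_a u (a, b, c))%E.
Proof.
apply: etrans (@fubini_tonelli2 _ _ _ _ _ m12 m3 u mu0 u0) _.
by apply: eq_integral => c _; exact: (@fubini_tonelli2 _ _ _ _ _ m1 m2 (fun x => u (x, c)) (H c) (H0 c)).
Qed.

Lemma tonelli3_312 : (\int[(m1 \x m2) \x m3]_y u y =
  \int[m3]_c \int[m1]_a \int[m2]_b u (a, b, c))%E.
Proof.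
apply: etrans (@fubini_tonelli2 _ _ _ _ _ m12 m3 u mu0 u0) _.
by apply: eq_integral => c _; exact: (@fubini_tonelli1 _ _ _ _ _ m1 m2 (fun x => u (x, c)) (H c) (H0 c)).
Qed.

Lemma tonelli3_123 : (\int[(m1 \x m2) \x m3]_y u y =
  \int[m1]_a \int[m2]_b \int[m3]_c u (a, b, c))%E.
Proof.
apply: etrans (@fubini_tonelli1 _ _ _ _ _ m12 m3 u mu0 u0) _.
have mF : measurable_fun setT (fubini_F m3 u) := @measurable_fun_fubini_tonelli_F _ _ _ _ _ m3 u mu0 u0.
have F0 x : (0 <= fubini_F m3 u x)%E by apply: integral_ge0.
exact: (@fubini_tonelli1 _ _ _ _ _ m1 m2 _ mF F0).
Qed.
End Tonelli3.

Definition leb2 {R : realType} := (@lebesgue_measure R \x @lebesgue_measure R)%E.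

HB.instance Definition _ (R : realType) := Measure.on (@leb2 R).
HB.instance Definition _ (R : realType) := Measure_isSigmaFinite.Build _ _ _ (@leb2 R)
  (lebesgue_integral_fubini.product_measure_sigma_finite_subproof
    (@lebesgue_measure R) (@lebesgue_measure R)).
HB.instance Definition _ (R : realType) := Measure.on (@leb3 R).
HB.instance Definition _ (R : realType) := Measure_isSigmaFinite.Build _ _ _ (@leb3 R)
  (lebesgue_integral_fubini.product_measure_sigma_finite_subproof
    (@leb2 R) (@lebesgue_measure R)).

Section Lebesgue3.
Context (R : realType).
Local Notation mu := (@lebesgue_measure R).
Local Notation leb3 := (@leb3 R).
Implicit Types (U V : 'rV[R]_3 -> R) (x : 'rV[R]_3).

Lemma continuous_affine x (v : 'rV[R]_3) : continuous (fun r : R => x + r *: v).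
Proof. by move=> r; apply: (@continuous_line _ _ (fun r : R => r)); exact: cvg_id. Qed.

Lemma vec3E (a b c : R) : vec3 (a, b, c) =
  a *: delta_mx 0 0 + b *: delta_mx 0 1 + c *: delta_mx 0 2 :> 'rV[R]_3.
Proof.
apply/rowP => i; rewrite !mxE (tnth_nth 0) /=; move: i.
case => [[|[|[|//]]] hi] /=; rewrite ?mulr1 ?mulr0 ?add0r ?addr0//.
Qed.

(* The coordinate [al] is the one in direction [i]; the order of the other two is
   the one for which [tonelli_slice] holds. *)
Definition slice (i : 'I_3) (al be ga : R) : R * R * R :=
  match val i with
  | 0%N => (al, be, ga) | 1%N => (be, al, ga) | _ => (ga, be, al)
  end.

Lemma slice_line i be ga : exists z : 'rV[R]_3, forall al,
  vec3 (slice i al be ga) = z + al *: delta_mx 0 i.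
Proof.
have E j k : 'I_3 -> (val k = val j) -> (delta_mx 0 k = delta_mx 0 j :> 'rV[R]_3).
  by move=> _ /val_inj ->.
case: i => [[|[|[|//]]] hi]; rewrite /slice /=.
- exists (be *: delta_mx 0 1 + ga *: delta_mx 0 2) => al; rewrite vec3E -addrA addrC.
  by rewrite (E 0 (Ordinal hi) 0).
- exists (be *: delta_mx 0 0 + ga *: delta_mx 0 2) => al; rewrite vec3E addrAC.
  by rewrite (E 1 (Ordinal hi) 0).
- exists (ga *: delta_mx 0 0 + be *: delta_mx 0 1) => al; rewrite vec3E.
  by rewrite (E 2 (Ordinal hi) 0).
Qed.

(** Continuity is for the topology of row vectors, measurability for the product structure of three
    lines. The gap is closed by treating one coordinate at a time, each along an affine line. *)
Lemma measurable_fun_vec3 U : continuous U ->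
  measurable_fun setT (fun y : R * R * R => U (vec3 y)).
Proof.
move=> cU; apply: measurable_fun_caratheodory => [[a b]|c].
  have [z E] := slice_line 2 b a; rewrite /slice /= in E.
  under eq_fun do rewrite E.
  move=> r; apply: (@continuous_comp _ _ _ (fun r : R => z + r *: delta_mx 0 2) U r).
    exact: continuous_affine.
  exact: cU.
apply: measurable_fun_caratheodory => [a|b].
  have [z E] := slice_line 1 a c; rewrite /slice /= in E.
  under eq_fun do rewrite E.
  move=> r; apply: (@continuous_comp _ _ _ (fun r : R => z + r *: delta_mx 0 1) U r).
    exact: continuous_affine.
  exact: cU.
apply: continuous_measurable_fun.
have [z E] := slice_line 0 b c; rewrite /slice /= in E.
under eq_fun do rewrite E.
move=> r; apply: (@continuous_comp _ _ _ (fun r : R => z + r *: delta_mx 0 0) U r).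
  exact: continuous_affine.
exact: cU.
Qed.

Lemma measurable_fun_time_vec3 (F : R -> 'rV[R]_3 -> R) :
  (forall t, continuous (F t)) -> (forall x, continuous (F ^~ x)) ->
  measurable_fun setT (fun z : R * (R * R * R) => F z.1 (vec3 z.2)).
Proof.
move=> c1 c2.
have -> : (fun z : R * (R * R * R) => F z.1 (vec3 z.2)) =
   (fun z : (R * R * R) * R => F z.2 (vec3 z.1)) \o (fun z : R * (R * R * R) => (z.2, z.1)) by [].
apply: measurableT_comp; last exact: measurable_fun_pair.
apply: measurable_fun_caratheodory => [y|r] /=; first exact: c2.
exact: measurable_fun_vec3.
Qed.

Lemma tonelli_slice i (u : R * R * R -> \bar R) : measurable_fun setT u ->
  (forall y, (0 <= u y)%E) ->
  (\int[leb3]_y u y =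
   \int[mu]_ga \int[mu]_be \int[mu]_al u (slice i al be ga))%E.
Proof.
move=> mu0 u0; case: i => [[|[|[|//]]] hi]; rewrite /slice /=.
- exact: (@tonelli3_321 _ _ _ _ _ _ R mu mu mu u mu0 u0).
- exact: (@tonelli3_312 _ _ _ _ _ _ R mu mu mu u mu0 u0).
- exact: (@tonelli3_123 _ _ _ _ _ _ R mu mu mu u mu0 u0).
Qed.

End Lebesgue3.

(** * One-dimensional calculus *)

Section Calculus.
Context {R : realType}.
Local Notation mu := (@lebesgue_measure R).
Implicit Types (f g P Q : R -> R) (a b s : R).

Lemma within_continuous f a b : (forall s, a <= s <= b -> {for s, continuous f}) ->
  {within `[a, b], continuous f}.
Proof.
move=> cf; apply: continuous_in_subspaceT => s; rewrite inE /= in_itv /=; exact: cf.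
Qed.

Lemma integrable_segment f a b : (forall s, a <= s <= b -> {for s, continuous f}) ->
  mu.-integrable `[a, b] (EFin \o f).
Proof.
move=> cf; apply: (@continuous_compact_integrable R f `[a, b]).
  exact: segment_compact.
exact: within_continuous.
Qed.

Lemma measurable_segment f a b : (forall s, a <= s <= b -> {for s, continuous f}) ->
  measurable_fun `[a, b] (fun s => (f s)%:E).
Proof. by move=> cf; have /measurable_int := integrable_segment cf. Qed.

Lemma is_derive_continuous f s (d : R) : is_derive s 1 f d -> {for s, continuous f}.
Proof.
by case=> df _; apply: differentiable_continuous; apply/derivable1_diffP.
Qed.

Lemma ftc f (f' : R -> R) a b : a < b ->
  (forall s, a <= s <= b -> is_derive s 1 f (f' s)) ->
  (forall s, a <= s <= b -> {for s, continuous f'}) ->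
  (\int[mu]_(s in `[a, b]) (f' s)%:E = (f b - f a)%:E)%E.
Proof.
move=> ab df cf'; rewrite EFinB; apply: (@continuous_FTC2 R f' f a b) => //.
- exact: within_continuous.
- split.
  + by move=> s /itvP sab; have [] : is_derive s 1 f (f' s) by apply: df; rewrite !sab.
  + apply: cvg_at_right_filter; apply: is_derive_continuous (df a _).
    by rewrite lexx ltW.
  + apply: cvg_at_left_filter; apply: is_derive_continuous (df b _).
    by rewrite lexx ltW.
- move=> s /itvP sab; have [_ E] : is_derive s 1 f (f' s) by apply: df; rewrite !sab.
  by rewrite derive1E.
Qed.

(** Stated without subtraction of integrals, so that it can be integrated again over space. The
    continuity of [P] makes its integral finite; [Q] enters through comparison alone. *)
Lemma ftc_le f (f' : R -> R) P Q a b : a < b ->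
  (forall s, a <= s <= b -> is_derive s 1 f (f' s)) ->
  (forall s, a <= s <= b -> {for s, continuous f'}) ->
  (forall s, a <= s <= b -> {for s, continuous P}) ->
  (forall s, a <= s <= b -> 0 <= Q s) ->
  (forall s, a <= s <= b -> f' s <= P s - Q s) ->
  ((f b)%:E + \int[mu]_(s in `[a, b]) (Q s)%:E
   <= (f a)%:E + \int[mu]_(s in `[a, b]) (P s)%:E)%E.
Proof.
move=> ab df cf' cP Q0 H.
have E := ftc ab df cf'.
have iP := integrable_segment cP.
have if' := integrable_segment cf'.
have E2 := @integralB_EFin _ _ _ mu `[a, b] P f' (measurable_itv _) iP if'.
have le1 : (\int[mu]_(s in `[a, b]) (Q s)%:E <=
    \int[mu]_(s in `[a, b]) ((P s)%:E - (f' s)%:E))%E.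
  apply: le_integral_nonneg => s /=; rewrite in_itv /= => sab; rewrite ?lee_fin//.
    exact: Q0.
  by have := H s sab; lra.
rewrite E2 E in le1.
have fP := @integrable_fin_num _ _ _ mu `[a, b] (measurable_itv _) (EFin \o P) iP.
rewrite -(fineK fP); rewrite -(fineK fP) -EFinB in le1.
apply: le_trans (leeD2l _ le1) _.
by rewrite -!EFinD lee_fin; lra.
Qed.

(** Squaring makes the positive part continuously differentiable: at the kink the difference
    quotient is at most [|h|] in absolute value. This is why cut-offs appear as squares of positive
    parts. *)
Lemma is_derive_pos_sqr f s (d : R) : is_derive s 1 f d ->
  is_derive s 1 (fun r => Num.max 0 (f r) ^+ 2) (2 * Num.max 0 (f s) * d).
Proof.
move=> df.
suff D (u : R) : is_derive u 1 (fun r : R => Num.max 0 r ^+ 2) (2 * Num.max 0 u).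
  exact: (@is_derive1_comp R (fun r : R => Num.max 0 r ^+ 2) f s _ d (D (f s)) df).
have [u0|u0|->] := ltgtP u 0.
- rewrite mulr0.
  have E : \forall z \near u, cst 0 z = Num.max 0 z ^+ 2 :> R.
    near=> z; rewrite /= max_l ?expr0n//.
    by apply: ltW; near: z; exact: lt_nbhsl.
  exact: near_eq_is_derive (is_derive_cst 0 u 1).
- have E : \forall z \near u, z ^+ 2 = Num.max 0 z ^+ 2 :> R.
    near=> z; rewrite /= max_r//.
    by apply: ltW; near: z; exact: lt_nbhsr.
  have H : is_derive u 1 (fun z : R => z ^+ 2) (2 * u).
    have := is_deriveX 2 (is_derive_id u (1 : R)) => -[D1 D2]; split => //.
    by rewrite D2 /= expr1 -mulr_natr [_ *: _]mulr1 mulrC.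
  exact: near_eq_is_derive H.
- rewrite mulr0.
  have cv : (fun h : R => h^-1 *: ((fun r : R => Num.max 0 r ^+ 2) (h *: 1 + 0)
      - Num.max 0 0 ^+ 2)) @ 0^' --> (0 : R).
    apply/cvgrPdist_le => e e0; near=> h.
    have h0 : h != 0 by near: h; exact: nbhs_dnbhs_neq.
    rewrite [h *: 1]mulr1 addr0 maxxx expr0n subr0 sub0r normrN.
    have H : `|h| <= e.
      near: h; apply: nbhs_dnbhs.
      have := @nbhsx_ballx _ _ (0 : R) e e0; apply: filterS => z.
      by rewrite -ball_normE /ball_ /= sub0r normrN => /ltW.
    rewrite (normrM h^-1) normfV ler_pdivrMl ?normr_gt0//.
    rewrite normrX expr2; apply: ler_pM => //.
      by case: (leP 0 h) => // _; rewrite normr0.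
    by apply: le_trans _ H; case: (leP 0 h) => // _; rewrite normr0.
  split; first by apply/cvg_ex; exists 0.
  exact: cvg_lim cv.
Unshelve. all: by end_near. Qed.

End Calculus.

(** * Integrals over space *)

Section SpaceIntegral.
Context {R : realType}.
Local Notation mu := (@lebesgue_measure R).
Local Notation leb3 := (@leb3 R).
Implicit Types (U V : 'rV[R]_3 -> R) (x : 'rV[R]_3).

Definition I3 U : \bar R := (\int[leb3]_y (U (vec3 y))%:E)%E.

Lemma measurable_vec3 U : continuous U ->
  measurable_fun setT (fun y : R * R * R => (U (vec3 y))%:E).
Proof. by move=> cU; apply/measurable_EFinP; exact: measurable_fun_vec3. Qed.

Lemma eq_I3 U V : (forall x, U x = V x) -> I3 U = I3 V.
Proof. by move=> E; apply: eq_integral => y _; rewrite E. Qed.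

Lemma I3_ge0 U : (forall x, 0 <= U x) -> (0 <= I3 U)%E.
Proof. by move=> U0; apply: integral_ge0 => y _; rewrite lee_fin. Qed.

Lemma le_I3 U V : (forall x, 0 <= U x) -> (forall x, U x <= V x) -> (I3 U <= I3 V)%E.
Proof. by move=> U0 UV; apply: le_integral_nonneg => y _; rewrite lee_fin. Qed.

Lemma I3D U V : continuous U -> continuous V -> (forall x, 0 <= U x) ->
  (forall x, 0 <= V x) -> I3 (fun x => U x + V x) = (I3 U + I3 V)%E.
Proof.
move=> cU cV U0 V0; rewrite /I3; under eq_integral do rewrite EFinD.
by rewrite ge0_integralD//; try exact: measurable_vec3; move=> y _; rewrite lee_fin.
Qed.

Lemma I3Z (c : R) U : 0 <= c -> continuous U -> (forall x, 0 <= U x) ->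
  I3 (fun x => c * U x) = (c%:E * I3 U)%E.
Proof.
move=> c0 cU U0; rewrite /I3; under eq_integral do rewrite EFinM.
by rewrite ge0_integralZl_EFin//; try exact: measurable_vec3; move=> y _; rewrite lee_fin.
Qed.

Lemma I3_slice i U : continuous U -> (forall x, 0 <= U x) ->
  I3 U = (\int[mu]_ga \int[mu]_be \int[mu]_al (U (vec3 (slice i al be ga)))%:E)%E.
Proof.
move=> cU U0; rewrite /I3 (tonelli_slice i (u := fun y => (U (vec3 y))%:E))//.
  exact: measurable_vec3.
by move=> y; rewrite lee_fin.
Qed.

(** Fatou's lemma. It removes the cone cut-off in the limit and needs no integrability of the
    limit. *)
Lemma I3_limit (W : nat -> 'rV[R]_3 -> R) U (B : \bar R) :
  (forall n, continuous (W n)) -> (forall n x, 0 <= W n x) ->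
  (forall x, (fun n => W n x) @ \oo --> U x) ->
  (forall n, (I3 (W n) <= B)%E) -> (I3 U <= B)%E.
Proof.
move=> cW W0 cvW WB.
have H := @fatou _ _ R leb3 setT measurableT (fun n y => (W n (vec3 y))%:E)
  (fun n => measurable_vec3 (cW n)) _.
apply: (@le_trans _ _ (limn_einf (fun n => I3 (W n)))).
  apply: le_trans _ (H _); last by move=> n y _; rewrite lee_fin.
  rewrite le_eqVlt; apply/orP; left; apply/eqP; apply: eq_integral => y _.
  have C : (fun n => (W n (vec3 y))%:E) @ \oo --> (U (vec3 y))%:E.
    by apply: cvg_EFin; [exact: nearW|exact: cvW].
  apply/esym; rewrite is_cvg_limn_einfE; first exact: cvg_lim C.
  by apply/cvg_ex; eexists; exact: C.
rewrite limn_einf_lim; apply: lime_le; first exact: is_cvg_einfs.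
apply: nearW => n; apply: le_trans (WB n); apply: ereal_inf_lbound.
by exists n => //=.
Qed.

Lemma I3_bounded U (B L : R) : 0 <= B -> 0 <= L ->
  (forall x, 0 <= U x <= B) -> (forall x, U x != 0 -> forall j, `|x 0 j| <= L) ->
  (I3 U <= (B * (2 * L) ^+ 3)%:E)%E.
Proof.
move=> B0 L0 UB UL.
pose I : set (g_sigma_algebraType (R.-ocitv.-measurable)) := `[- L, L]%classic.
have mI : measurable I by exact: measurable_itv.
have lI : mu I = (2 * L)%:E.
  rewrite lebesgue_measure_itv /= lte_fin.
  have [h|h] := ltP (- L) L; first by rewrite -EFinB; congr EFin; ring.
  by congr EFin; lra.
pose D := (I `*` I) `*` I.
have mD : measurable D by do 2 apply: measurableX => //.
apply: (@le_trans _ _ (\int[leb3]_y (B%:E * (\1_D y)%:E))%E).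
  apply: le_integral_nonneg => y _; first by have /andP[] := UB (vec3 y).
  rewrite -EFinM lee_fin indicE; have [yD|yD] := boolP (y \in D); rewrite ?mulr1.
    by have /andP[] := UB (vec3 y).
  rewrite mulr0; have [->//|/UL h] := eqVneq (U (vec3 y)) 0.
  case/negP: yD; rewrite inE /D /I /=; rewrite !in_itv /= -!ler_norml.
  have := h 0; have := h 1; have := h 2; rewrite !mxE.
  by rewrite !(tnth_nth 0) /= => -> -> ->.
rewrite ge0_integralZl_EFin//; last by apply/measurable_EFinP; exact: measurable_indic.
rewrite integral_indic// setIT.
have E : leb3 D = ((2 * L) ^+ 3)%:E.
  have E1 : leb3 D = ((mu \x mu)%E (I `*` I) * mu I)%E.
    exact: (@product_measure1E _ _ _ _ R (mu \x mu)%E mu _ _ (measurableX mI mI) mI).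
  have E2 : (mu \x mu)%E (I `*` I) = (mu I * mu I)%E.
    exact: (@product_measure1E _ _ _ _ R mu mu _ _ mI mI).
  by rewrite E1 E2 !lI -!EFinM exprSr expr2.
by rewrite EFinM -E; exact: lexx.
Qed.

End SpaceIntegral.

Section Continuity.
Context {R : realType}.
Local Notation field := (@field R).
Implicit Types (f g F G : field) (t a : R) (x : 'rV[R]_3).

Definition Cont F := forall t x, 0 < t -> {for (t, x), continuous (uncurry_field F)}.

Lemma Cont_smooth F : Smooth F -> Cont F.
Proof. by rewrite SmoothE => sF t x t0; have [] := sF [::] (t, x) t0. Qed.

Lemma ContD F G : Cont F -> Cont G -> Cont (fun t x => F t x + G t x).
Proof. by move=> cF cG t x t0; apply: (cvgD (cF t x t0) (cG t x t0)). Qed.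

Lemma ContM F G : Cont F -> Cont G -> Cont (fun t x => F t x * G t x).
Proof. by move=> cF cG t x t0; apply: (cvgM (cF t x t0) (cG t x t0)). Qed.

Lemma ContN F : Cont F -> Cont (fun t x => - F t x).
Proof. by move=> cF t x t0; apply: (cvgN (cF t x t0)). Qed.

Lemma Cont_comp (h : R -> R) F : continuous h -> Cont F -> Cont (fun t x => h (F t x)).
Proof.
move=> ch cF t x t0; apply: (@continuous_comp _ _ _ (uncurry_field F) h); first exact: cF.
exact: ch.
Qed.

Lemma Cont_cst (c : R) : Cont (fun _ _ => c).
Proof. by move=> t x t0; exact: cvg_cst. Qed.

Lemma ContX n F : Cont F -> Cont (fun t x => F t x ^+ n).
Proof. by apply: (@Cont_comp (fun r => r ^+ n)); exact: exprn_continuous. Qed.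

Lemma continuous_max (b : R) : continuous (Num.max b).
Proof. by move=> r; apply: (@continuous_max _ _ (cst b) id); [exact: cvg_cst|exact: cvg_id]. Qed.

Lemma Cont_max (b : R) F : Cont F -> Cont (fun t x => Num.max b (F t x)).
Proof. apply: (@Cont_comp (Num.max b)); exact: continuous_max. Qed.

Lemma Cont_powR a : Cont (fun t _ => t `^ a).
Proof. by apply: Cont_smooth; case: (@jet_powR R a). Qed.

Lemma Cont_coord j : Cont (fun _ x => x 0 j).
Proof. by apply: Cont_smooth; case: (@jet_coord R j). Qed.

Lemma Cont_space F t : Cont F -> 0 < t -> continuous (F t).
Proof.
move=> cF t0 x; apply: (@continuous_comp _ _ _ (fun x : 'rV[R]_3 => (t, x)) (uncurry_field F)).
  exact: (@cvg_pair _ _ _ (nbhs x) (nbhs t) (nbhs x) _ _ _ (cst t) id (cvg_cst t) cvg_id).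
exact: cF.
Qed.

Lemma Cont_time F t x : Cont F -> 0 < t -> {for t, continuous (F ^~ x)}.
Proof.
move=> cF t0; apply: (@continuous_comp _ _ _ (fun t : R => (t, x)) (uncurry_field F)).
  exact: (@cvg_pair _ _ _ (nbhs t) (nbhs t) (nbhs x) _ _ _ id (cst x) cvg_id (cvg_cst x)).
exact: cF.
Qed.

Lemma Cont_bounded F a (b L : R) : 0 < a -> Cont F -> exists2 B : R, 0 <= B &
  forall t x, a <= t <= b -> (forall j, `|x 0 j| <= L) -> `|F t x| <= B.
Proof.
move=> a0 cF.
pose K : set (R * 'rV[R]_3) :=
  setX `[a, b]%classic [set v : 'rV[R]_3 | forall i, `[- L, L]%classic (v 0 i)].
have cK : compact K.
  apply: compact_setX; first exact: segment_compact.
  by apply: (@rV_compact R 3 (fun _ => `[- L, L]%classic)) => i; exact: segment_compact.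
have wK : {within K, continuous (uncurry_field F)}.
  apply: continuous_in_subspaceT => -[t x]; rewrite inE => -[] /=; rewrite in_itv /= => /andP[at' _] _.
  by apply: cF; apply: lt_le_trans at'.
have /compact_bounded := continuous_compact wK cK.
move=> [M [Mr HM]]; exists (`|M| + 1); first by rewrite addr_ge0.
move=> t x tab xL; apply: HM.
  by apply: le_lt_trans (ler_norm M) _; rewrite ltrDl.
exists (t, x) => //; split => /=; first by rewrite in_itv.
by move=> i; rewrite /= in_itv /= -ler_norml.
Qed.

Lemma is_derive_slice f t x i (s : R) : Smooth f -> 0 < t ->
  is_derive s 1 (fun r => f t (x + r *: delta_mx 0 i))
    (Dx i f t (x + s *: delta_mx 0 i)).
Proof.
rewrite SmoothE => sf t0.
have D := smooth_on_derivable sf (t0 : [set z : R * 'rV[R]_3 | 0 < z.1] (t, x + s *: delta_mx 0 i)).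
have H := @is_derive_line R (R * 'rV[R]_3)%type (uncurry_field f) (t, x) (0, delta_mx 0 i) s.
rewrite DxE.
have E r : (t, x) + r *: (0, delta_mx 0 i) = (t, x + r *: delta_mx 0 i) :> R * 'rV[R]_3.
  by congr pair; rewrite /= scaler0 addr0.
rewrite E in H; have := H (D _).
rewrite (_ : (fun r : R => _) = fun r => f t (x + r *: delta_mx 0 i))//.
by apply/funext => r; rewrite E.
Qed.

Lemma is_derive_time f t x : Smooth f -> 0 < t ->
  is_derive t 1 (f ^~ x) (Dt f t x).
Proof.
rewrite SmoothE => sf t0.
have D := smooth_on_derivable sf (t0 : [set z : R * 'rV[R]_3 | 0 < z.1] (t, x)).
have H := @is_derive_line R (R * 'rV[R]_3)%type (uncurry_field f) (0, x) (1, 0) t.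
rewrite DtE.
have E r : (0, x) + r *: (1, 0) = (r, x) :> R * 'rV[R]_3.
  by congr pair; rewrite /= ?scaler0 ?addr0// add0r [_ *: _]mulr1.
rewrite E in H; have := H (D _).
rewrite (_ : (fun r : R => _) = f ^~ x)//.
by apply/funext => r; rewrite E.
Qed.

End Continuity.

(** * Divergences with compact support *)

Section Balance.
Context {R : realType}.
Local Notation field := (@field R).
Local Notation mu := (@lebesgue_measure R).
Implicit Types (f g F G Q Y : field) (t a : R) (x : 'rV[R]_3).

Definition pos (r : R) := Num.max 0 r.

Lemma pos_ge0 r : 0 <= pos r. Proof. by rewrite /pos le_max lexx. Qed.

Lemma posB r : r = pos r - pos (- r).
Proof. by rewrite /pos; case: (leP 0 r); case: (leP 0 (- r)); lra. Qed.

(* The i-th derivative of [(Q_+)^2 Y]. *)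
Definition cut_div i Q Y : field := fun t x =>
  2 * pos (Q t x) * Dx i Q t x * Y t x + pos (Q t x) ^+ 2 * Dx i Y t x.

Lemma Cont_pos F : Cont F -> Cont (fun t x => pos (F t x)).
Proof. exact: Cont_max. Qed.

Lemma Cont_cut_div i Q Y : Smooth Q -> Smooth Y -> Cont (cut_div i Q Y).
Proof.
move=> sQ sY; have cQ := Cont_pos (Cont_smooth sQ).
apply: ContD; last by apply: ContM; [exact: ContX|exact/Cont_smooth/smooth_Dx].
apply: ContM; last exact: Cont_smooth.
by apply: ContM; [apply: ContM => //; exact: Cont_cst|exact/Cont_smooth/smooth_Dx].
Qed.

Lemma cut_div_supp i Q Y (L : R) t x :
  (forall x, 0 < Q t x -> forall j, `|x 0 j| <= L) ->
  cut_div i Q Y t x != 0 -> forall j, `|x 0 j| <= L.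
Proof.
move=> QL; have [/QL//|Q0] := ltP 0 (Q t x).
by rewrite /cut_div /pos (max_l Q0) mulr0 !mul0r expr0n/= mul0r addr0 eqxx.
Qed.

(** The integral of [h'] vanishes; writing this as an equality of positive and negative parts keeps
    it within nonnegative integrals. The two inequalities are [ftc_le] for [h] and for [- h]. *)
Lemma integral_balance (h h' : R -> R) (L : R) :
  (forall s : R, is_derive s 1 h (h' s)) -> continuous h' ->
  (forall s, L <= `|s| -> h s = 0 /\ h' s = 0) ->
  (\int[mu]_s (pos (h' s))%:E = \int[mu]_s (pos (- h' s))%:E)%E.
Proof.
move=> dh ch' supp.
pose M : R := `|L| + 1.
have LM : L < M by apply: le_lt_trans (ler_norm L) _; rewrite ltrDl.
have M0 : 0 < M by rewrite /M ltr_wpDl.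
have red (u : R -> R) : u 0 = 0 ->
    (\int[mu]_s (u (h' s))%:E = \int[mu]_(s in `[(- M)%R, M]) (u (h' s))%:E)%E.
  move=> u0; rewrite [RHS]integral_mkcond; apply: eq_integral => s _.
  rewrite /patch; case: ifPn => // /negP; rewrite inE /= in_itv /= -ler_norml => sM.
  have [|_ ->] := supp s; last by rewrite u0.
  by apply: le_trans (ltW LM) _; rewrite ltW// ltNge; apply/negP.
rewrite (red pos)/pos ?maxxx// (red (fun r => pos (- r)))/pos ?oppr0 ?maxxx//.
have hM : h M = 0.
  by have [] := supp M; [rewrite ger0_norm ltW|].
have hNM : h (- M) = 0.
  by have [] := supp (- M); [rewrite normrN ger0_norm ltW|].
have cp : continuous (fun s => pos (h' s)).
  by move=> s; apply: (@continuous_comp _ _ _ h' pos); [exact: ch'|exact: continuous_max].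
have cn : continuous (fun s => pos (- h' s)).
  by move=> s; apply: (@continuous_comp _ _ _ (fun s => - h' s) pos);
    [apply: cvgN; exact: ch'|exact: continuous_max].
have MM : - M < M by lra.
apply/eqP; rewrite eq_le; apply/andP; split.
- have := @ftc_le R (fun s => - h s) (fun s => - h' s) (fun s => pos (- h' s))
    (fun s => pos (h' s)) (- M) M MM.
  rewrite hM hNM oppr0 !add0e; apply => s _ //.
  + by apply: cvgN; exact: ch'.
  + exact: cn.
  + exact: pos_ge0.
  + by rewrite [X in X <= _](posB (- h' s)) opprK.
- have := @ftc_le R h h' (fun s => pos (h' s)) (fun s => pos (- h' s)) (- M) M MM.
  rewrite hM hNM !add0e; apply => s _ //.
  + exact: ch'.
  + exact: cp.
  + exact: pos_ge0.
  + by rewrite {1}(posB (h' s)).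
Qed.

Lemma cut_div_balance i Q Y (L : R) t : 0 < t -> Smooth Q -> Smooth Y ->
  (forall x, 0 < Q t x -> forall j, `|x 0 j| <= L) ->
  I3 (fun x => pos (cut_div i Q Y t x)) = I3 (fun x => pos (- cut_div i Q Y t x)).
Proof.
move=> t0 sQ sY QL.
have cD := @Cont_cut_div i Q Y sQ sY.
rewrite !(@I3_slice _ i); first last.
- by move=> x; exact: pos_ge0.
- exact: Cont_space (Cont_pos cD) t0.
- by move=> x; exact: pos_ge0.
- exact: Cont_space (Cont_pos (ContN cD)) t0.
apply: eq_integral => ga _; apply: eq_integral => be _.
have [z Ez] := slice_line i be ga.
under eq_integral do rewrite Ez.
under [RHS]eq_integral do rewrite Ez.
have cl : continuous (fun s : R => z + s *: delta_mx 0 i) := @continuous_affine R z _.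
apply: (@integral_balance (fun s => pos (Q t (z + s *: delta_mx 0 i)) ^+ 2 * Y t (z + s *: delta_mx 0 i)) _
  (`|L| + `|z 0 i| + 1)).
- move=> s.
  have dQ := is_derive_pos_sqr (is_derive_slice z i s sQ t0).
  have dY := is_derive_slice z i s sY t0.
  have := is_deriveM dQ dY => -[D1 D2]; split => //; rewrite D2.
  rewrite /cut_div /pos; move: (Dx i Q _ _) (Dx i Y _ _) (Num.max _ _) => u v w.
  by rewrite /GRing.scale /=; ring.
- move=> s; apply: (@continuous_comp _ _ _ (fun s : R => z + s *: delta_mx 0 i) (cut_div i Q Y t)).
    exact: cl.
  exact: Cont_space cD t0 _.
- move=> s sL; set x := _ + _.
  have Q0 : Q t x <= 0.
    rewrite leNgt; apply/negP => /QL /(_ i); rewrite /x !mxE !eqxx mulr1 => H.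
    have : `|s| <= `|z 0 i + s| + `|z 0 i|.
      by have := ler_normB (z 0 i + s) (z 0 i); rewrite [_ + s - _]addrAC subrr add0r.
    by have := ler_norm L; lra.
  by rewrite /cut_div /pos (max_l Q0) mulr0 !mul0r expr0n/= !mul0r addr0.
Qed.

Lemma cut_div_finite i Q Y (L : R) t : 0 < t -> 0 <= L -> Smooth Q -> Smooth Y ->
  (forall x, 0 < Q t x -> forall j, `|x 0 j| <= L) ->
  (I3 (fun x => pos (cut_div i Q Y t x)) < +oo)%E.
Proof.
move=> t0 L0 sQ sY QL.
have [B B0 HB] := Cont_bounded t L t0 (@Cont_cut_div i Q Y sQ sY).
apply: le_lt_trans (I3_bounded B0 L0 _ _) (ltry _) => x.
  rewrite pos_ge0 /=; have [h|h] := leP 0 (cut_div i Q Y t x); last first.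
    by rewrite /pos (max_l (ltW h)).
  rewrite /pos max_r//; have [->//|H] := eqVneq (cut_div i Q Y t x) 0.
  apply: le_trans (ler_norm _) _; apply: HB; first by rewrite lexx.
  exact: cut_div_supp H.
rewrite /pos; have [h|h] := leP 0 (cut_div i Q Y t x); last by rewrite eqxx.
exact: cut_div_supp.
Qed.

End Balance.

(** * Integrals over space-time *)

Section TimeIntegral.
Context {R : realType}.
Local Notation field := (@field R).
Local Notation mu := (@lebesgue_measure R).
Local Notation leb3 := (@leb3 R).
Implicit Types (F G : field) (a b t : R) (x : 'rV[R]_3).

Definition IT a b F : \bar R := (\int[mu]_(s in `[a, b]) I3 (F s))%E.

Lemma tonelli_time F a b : 0 < a <= b -> Cont F -> (forall t x, 0 < t -> 0 <= F t x) ->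
  [/\ measurable_fun `[a, b] (fun s => I3 (F s)),
   measurable_fun setT (fun y => (\int[mu]_(s in `[a, b]) (F s (vec3 y))%:E)%E) &
   IT a b F = (\int[leb3]_y \int[mu]_(s in `[a, b]) (F s (vec3 y))%:E)%E].
Proof.
move=> /andP[a0 ab] cF F0.
(* Fields are continuous at positive times only. Clamping time to [[a, b]] gives a globally
   continuous integrand, unchanged on the interval of integration. *)
pose cl (s : R) : R := Num.max a (Num.min b s).
have cl0 s : 0 < cl s by rewrite /cl lt_max a0.
have clE s : a <= s <= b -> cl s = s by case/andP=> h1 h2; rewrite /cl min_r// max_r.
have ccl : continuous cl.
  move=> s; apply: (@continuous_comp _ _ _ (Num.min b) (Num.max a)); last exact: continuous_max.
  by apply: (@continuous_min _ _ (cst b) id); [exact: cvg_cst|exact: cvg_id].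
pose g0 (z : R * (R * R * R)) : \bar R := (F (cl z.1) (vec3 z.2))%:E.
have mg0 : measurable_fun setT g0.
  apply/measurable_EFinP.
  apply: (@measurable_fun_time_vec3 R (fun s => F (cl s))).
    by move=> s; exact: Cont_space cF (cl0 s).
  move=> x s; apply: (@continuous_comp _ _ _ cl (F ^~ x)); first exact: ccl.
  exact: Cont_time cF (cl0 s).
pose I : set (g_sigma_algebraType (R.-ocitv.-measurable)) := `[a, b]%classic.
have mI : measurable I by exact: measurable_itv.
pose g (z : R * (R * R * R)) : \bar R := (g0 z * (\1_I z.1)%:E)%E.
have mg : measurable_fun setT g.
  apply: emeasurable_funM => //; apply/measurable_EFinP.
  by apply: (@measurableT_comp _ _ _ _ _ _ (\1_I : R -> R)); [exact: measurable_indic|exact: measurable_fst].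
have g_ge0 z : (0 <= g z)%E by rewrite mule_ge0// lee_fin F0.
have inner y : (\int[mu]_(s in I) (F s (vec3 y))%:E = \int[mu]_s g (s, y))%E.
  rewrite integral_mkcond; apply: eq_integral => s _; rewrite /patch /g /g0 indicE.
  case: ifPn => h; last by rewrite mule0.
  by rewrite mule1 /= clE//; move: h; rewrite inE /I /= in_itv.
have outer s : ((\1_I s)%:E * I3 (F (cl s)) = \int[leb3]_y g (s, y))%E.
  rewrite /g /g0 /= /I3 indicE; case: (s \in I) => /=.
    by rewrite mul1e; apply: eq_integral => y _; rewrite mule1.
  by rewrite mul0e; under eq_integral do rewrite mule0; rewrite integral0.
have mG := @measurable_fun_fubini_tonelli_G _ _ _ _ _ mu g mg g_ge0.
have mF := @measurable_fun_fubini_tonelli_F _ _ _ _ _ leb3 g mg g_ge0.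
have T1 := @fubini_tonelli1 _ _ _ _ _ mu leb3 g mg g_ge0.
have T2 := @fubini_tonelli2 _ _ _ _ _ mu leb3 g mg g_ge0.
rewrite /fubini_F /fubini_G in mG mF T1 T2.
split.
- apply: (@eq_measurable_fun _ _ _ _ I (fun s => \int[leb3]_y g (s, y))%E).
    move=> s sI; rewrite -outer indicE sI mul1e clE//.
    by move: sI; rewrite inE /I /= in_itv.
  exact: measurable_funTS.
- by under eq_fun do rewrite inner.
- under [RHS]eq_integral do rewrite inner.
  rewrite -T2 T1 /IT integral_mkcond; apply: eq_integral => s _.
  rewrite /patch -outer indicE; case: ifPn => h; last by rewrite mul0e.
  by rewrite mul1e clE//; move: h; rewrite inE /I /= in_itv.
Qed.

Lemma segment_gt0 a b s : 0 < a -> `[a, b]%classic s -> 0 < s.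
Proof. by move=> a0; rewrite /= in_itv /= => /andP[/(lt_le_trans a0)]. Qed.

Lemma IT_ge0 a b F : 0 < a -> (forall t x, 0 < t -> 0 <= F t x) -> (0 <= IT a b F)%E.
Proof.
move=> a0 F0; apply: integral_ge0 => s /(segment_gt0 a0) s0.
by apply: I3_ge0 => x; exact: F0.
Qed.

Lemma le_IT a b F G : 0 < a -> (forall t x, 0 < t -> 0 <= F t x) ->
  (forall t x, a <= t <= b -> F t x <= G t x) -> (IT a b F <= IT a b G)%E.
Proof.
move=> a0 F0 FG; apply: le_integral_nonneg => s sab; have s0 := segment_gt0 a0 sab.
  by apply: I3_ge0 => x; exact: F0.
move: sab; rewrite /= in_itv /= => sab.
by apply: le_I3 => x; [exact: F0|exact: FG].
Qed.

Lemma eq_IT a b F G : (forall t x, a <= t <= b -> F t x = G t x) -> IT a b F = IT a b G.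
Proof.
move=> E; apply: eq_integral => s; rewrite inE /= in_itv /= => sab.
by apply: eq_I3 => x; exact: E.
Qed.

Lemma ITD a b F G : 0 < a <= b -> Cont F -> Cont G -> (forall t x, 0 < t -> 0 <= F t x) ->
  (forall t x, 0 < t -> 0 <= G t x) ->
  IT a b (fun t x => F t x + G t x) = (IT a b F + IT a b G)%E.
Proof.
move=> ab cF cG F0 G0; have [a0 _] := andP ab.
have [mF _ _] := tonelli_time ab cF F0; have [mG _ _] := tonelli_time ab cG G0.
rewrite /IT -(@ge0_integralD _ _ R mu `[a, b] (measurable_itv _))//; last 2 first.
- by move=> s /(segment_gt0 a0) s0; apply: I3_ge0 => x; exact: F0.
- by move=> s /(segment_gt0 a0) s0; apply: I3_ge0 => x; exact: G0.
apply: eq_integral => s; rewrite inE /= in_itv /= => /andP[sa _].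
have s0 : 0 < s by exact: lt_le_trans sa.
by rewrite I3D//; try exact: Cont_space; move=> x; [exact: F0|exact: G0].
Qed.

Lemma ITZ a b (c : R) F : 0 < a <= b -> 0 <= c -> Cont F -> (forall t x, 0 < t -> 0 <= F t x) ->
  IT a b (fun t x => c * F t x) = (c%:E * IT a b F)%E.
Proof.
move=> ab c0 cF F0; have [a0 _] := andP ab.
have [mF _ _] := tonelli_time ab cF F0.
rewrite /IT -(@ge0_integralZl_EFin _ _ R mu `[a, b] (measurable_itv _))//; last first.
  by move=> s /(segment_gt0 a0) s0; apply: I3_ge0 => x; exact: F0.
apply: eq_integral => s; rewrite inE /= in_itv /= => /andP[sa _].
have s0 : 0 < s by exact: lt_le_trans sa.
by rewrite I3Z//; try exact: Cont_space; move=> x; exact: F0.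
Qed.

End TimeIntegral.

Lemma Cont_time_id {R : realType} : @Cont R (fun t _ => t).
Proof. by apply: Cont_smooth; case: (@jet_id R). Qed.

Lemma Cont_time_inv {R : realType} : @Cont R (fun t _ => t^-1).
Proof. by apply: Cont_smooth; case: (@jet_inv R). Qed.

Ltac cont_tac :=
  cbv beta; lazymatch goal with
  | |- Cont (fun t x => (@?A t x + @?B t x)%R) => apply: (@ContD _ A B); cont_tac
  | |- Cont (fun t x => (@?A t x * @?B t x)%R) => apply: (@ContM _ A B); cont_tac
  | |- Cont (fun t x => (@?A t x ^+ ?n)%R) => apply: (@ContX _ n A); cont_tac
  | |- Cont (fun t x => (- @?A t x)%R) => apply: (@ContN _ A); cont_tac
  | |- Cont (fun t x => pos (@?A t x)) => apply: (@Cont_pos _ A); cont_tac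
  | |- Cont (fun t x => t) => exact: Cont_time_id
  | |- Cont (fun t x => (t)^-1%R) => exact: Cont_time_inv
  | |- Cont (fun t x => powR t ?a) => exact: Cont_powR
  | |- Cont (fun t x => fun_of_matrix x _ ?j) => exact: Cont_coord
  | |- Cont (fun t x => Dt ?f t x) => apply: Cont_smooth; smooth_tac
  | |- Cont (fun t x => Dx ?i ?f t x) => apply: Cont_smooth; smooth_tac
  | |- _ => first [assumption | apply: Cont_smooth; assumption | exact: Cont_cst]
  end.

Section Balanced.
Context d (T : measurableType d) (R : realType) (mu : {measure set T -> \bar R}).

Lemma le_integral_balanced2 (f1 f2 g1 g2 P Q : T -> \bar R) :
  measurable_fun setT f1 -> measurable_fun setT f2 -> measurable_fun setT g1 ->
  measurable_fun setT g2 -> measurable_fun setT P -> measurable_fun setT Q ->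
  (forall x, (0 <= f1 x)%E) -> (forall x, (0 <= f2 x)%E) ->
  (forall x, (0 <= g1 x)%E) -> (forall x, (0 <= g2 x)%E) ->
  (forall x, (0 <= P x)%E) -> (forall x, (0 <= Q x)%E) ->
  (forall x, (f1 x + f2 x + Q x <= g1 x + g2 x + P x)%E) ->
  (\int[mu]_x P x = \int[mu]_x Q x)%E -> (\int[mu]_x P x < +oo)%E ->
  (\int[mu]_x f1 x + \int[mu]_x f2 x <= \int[mu]_x g1 x + \int[mu]_x g2 x)%E.
Proof.
move=> mf1 mf2 mg1 mg2 mP mQ f10 f20 g10 g20 P0 Q0 H E F.
rewrite -!ge0_integralD//.
by apply: le_integral_balanced H E F => //;
  try exact: emeasurable_funD; move=> x; exact: adde_ge0.
Qed.

End Balanced.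

Section IntegratedRate.
Context {R : realType}.
Local Notation field := (@field R).
Local Notation mu := (@lebesgue_measure R).
Local Notation leb3 := (@leb3 R).
Implicit Types (f F G Q : field) (t a b : R) (x : 'rV[R]_3).

Lemma integral_cst_segment (c : R) a b : a <= b ->
  (\int[mu]_(s in `[a, b]) c%:E)%E = (c * (b - a))%:E.
Proof.
move=> ab; rewrite integral_cst//= lebesgue_measure_itv /= lte_fin.
have [_|ba] := ltP a b; first by rewrite -EFinB -EFinM.
by rewrite (_ : b - a = 0) ?mulr0 ?mule0//; lra.
Qed.

Lemma measurable_field f t : Cont f -> 0 < t ->
  measurable_fun setT (fun y : R * R * R => (f t (vec3 y))%:E).
Proof. by move=> cf t0; apply: measurable_vec3; exact: Cont_space. Qed.

(** Differentiation under the integral is avoided: the inequality is integrated in time at each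
    fixed point, then over space. Tonelli turns the divergence terms back into space integrals at
    fixed times, where their positive and negative parts balance. *)
Lemma integrated_rate f (f' : field) F G Q (Y : 'I_3 -> field) (L a b : R) : 0 < a < b ->
  0 <= L -> Cont f -> Cont f' -> Cont F -> Cont G -> Smooth Q -> (forall i, Smooth (Y i)) ->
  (forall t x, 0 < t -> [/\ 0 <= f t x, 0 <= F t x & 0 <= G t x]) ->
  (forall t x, a <= t <= b -> 0 < Q t x -> forall j, `|x 0 j| <= L) ->
  (forall t x, a <= t <= b -> is_derive t 1 (f ^~ x) (f' t x)) ->
  (forall t x, a <= t <= b -> f' t x + F t x <= cut_div 0 Q (Y 0) t x
      + cut_div 1 Q (Y 1) t x + cut_div 2 Q (Y 2) t x + G t x) ->
  (I3 (f b) + IT a b F <= I3 (f a) + IT a b G)%E.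
Proof.
move=> /andP[a0 ab] L0 cf cf' cF cG sQ sY nn supp df H.
have b0 : 0 < b by exact: lt_trans ab.
have aab : 0 < a <= b by rewrite a0 ltW.
have pos_s s : a <= s <= b -> 0 < s by move=> /andP[/(lt_le_trans a0)].
pose D i := cut_div i Q (Y i).
have cD i : Cont (D i) by apply: Cont_cut_div.
pose P : field := fun t x => pos (D 0 t x) + pos (D 1 t x) + pos (D 2 t x).
pose N : field := fun t x => pos (- D 0 t x) + pos (- D 1 t x) + pos (- D 2 t x).
have cP : Cont P by apply: ContD; [apply: ContD|]; exact: Cont_pos.
have cN : Cont N by apply: ContD; [apply: ContD|]; apply: Cont_pos; exact: ContN.
have P0 t x : 0 <= P t x by rewrite /P !addr_ge0 ?pos_ge0.
have N0 t x : 0 <= N t x by rewrite /N !addr_ge0 ?pos_ge0.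
have F0 t x : 0 < t -> 0 <= F t x by case/(nn t x).
have G0 t x : 0 < t -> 0 <= G t x by case/(nn t x).
have f0 t x : 0 < t -> 0 <= f t x by case/(nn t x).
have [mF1 mF2 mF3] := tonelli_time aab cF F0.
have [mG1 mG2 mG3] := tonelli_time aab cG G0.
have [mP1 mP2 mP3] := tonelli_time aab cP (fun t x _ => P0 t x).
have [mN1 mN2 mN3] := tonelli_time aab cN (fun t x _ => N0 t x).
have I0 (K : field) y : (forall t x, 0 < t -> 0 <= K t x) ->
    (0 <= \int[mu]_(s in `[a, b]) (K s (vec3 y))%:E)%E.
  by move=> K0; apply: integral_ge0 => s /(segment_gt0 a0) s0; rewrite lee_fin K0.
have split_int (K K' : field) y : Cont K -> Cont K' -> (forall t x, 0 < t -> 0 <= K t x) ->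
    (forall t x, 0 < t -> 0 <= K' t x) ->
    (\int[mu]_(s in `[a, b]) (K s (vec3 y) + K' s (vec3 y))%:E =
    \int[mu]_(s in `[a, b]) (K s (vec3 y))%:E + \int[mu]_(s in `[a, b]) (K' s (vec3 y))%:E)%E.
  move=> cK cK' K0 K0'; under eq_integral do rewrite EFinD.
  rewrite (@ge0_integralD _ _ R mu `[a, b] (measurable_itv _))//.
  - by move=> s /(segment_gt0 a0) s0; rewrite lee_fin K0.
  - by apply: measurable_segment => s /pos_s s0; exact: Cont_time.
  - by move=> s /(segment_gt0 a0) s0; rewrite lee_fin K0'.
  - by apply: measurable_segment => s /pos_s s0; exact: Cont_time.
have balance : IT a b P = IT a b N.
  apply: eq_integral => t; rewrite inE => tab; have t0 := segment_gt0 a0 tab.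
  move: tab; rewrite /= in_itv /= => tab.
  have E i := cut_div_balance i t0 sQ (sY i) (supp t ^~ tab).
  have cp i : continuous (fun x => pos (D i t x)) := Cont_space (Cont_pos (cD i)) t0.
  have cn i : continuous (fun x => pos (- D i t x)) := Cont_space (Cont_pos (ContN (cD i))) t0.
  have cp2 := Cont_space (ContD (Cont_pos (cD 0)) (Cont_pos (cD 1))) t0.
  have cn2 := Cont_space (ContD (Cont_pos (ContN (cD 0))) (Cont_pos (ContN (cD 1)))) t0.
  by rewrite /P /N !I3D ?E//;
    first [exact: cp2|exact: cn2|exact: cp|exact: cn|move=> x; rewrite ?addr_ge0 ?pos_ge0].
have finite : (IT a b P < +oo)%E.
  have [B B0 HB] := Cont_bounded b L a0 cP.
  apply: (@le_lt_trans _ _ (\int[mu]_(s in `[a, b]) (B * (2 * L) ^+ 3)%:E)%E).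
    apply: le_integral_nonneg => s sab; first by apply: I3_ge0.
    move: sab; rewrite /= in_itv /= => sab; have s0 := pos_s _ sab.
    have PL x : P s x != 0 -> forall j, `|x 0 j| <= L.
      have [|Q0 P0'] := ltP 0 (Q s x); first by move=> /(supp _ _ sab).
      have D0 i : D i s x = 0.
        have q0 : pos (Q s x) = 0 by rewrite /pos max_l.
        by rewrite /D /cut_div q0 mulr0 !mul0r expr0n/= mul0r addr0.
      by move: P0'; rewrite /P !D0 /pos maxxx !addr0 eqxx.
    apply: (I3_bounded B0 L0 _ PL) => x; rewrite P0 andTb.
    have [->|/PL h] := eqVneq (P s x) 0; first exact: B0.
    exact: le_trans (ler_norm _) (HB _ _ sab h).
  by rewrite (integral_cst_segment _ (ltW ab)); exact: ltry.
rewrite mF3 mG3.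
apply: (@le_integral_balanced2 _ _ R leb3 (fun y => (f b (vec3 y))%:E)
  (fun y => \int[mu]_(s in `[a, b]) (F s (vec3 y))%:E)%E (fun y => (f a (vec3 y))%:E)
  (fun y => \int[mu]_(s in `[a, b]) (G s (vec3 y))%:E)%E
  (fun y => \int[mu]_(s in `[a, b]) (P s (vec3 y))%:E)%E
  (fun y => \int[mu]_(s in `[a, b]) (N s (vec3 y))%:E)%E).
- exact: (measurable_field cf b0).
- exact: mF2.
- exact: (measurable_field cf a0).
- exact: mG2.
- exact: mP2.
- exact: mN2.
- by move=> y; rewrite lee_fin f0.
- by move=> y; apply: I0.
- by move=> y; rewrite lee_fin f0.
- by move=> y; apply: I0.
- by move=> y; apply: I0.
- by move=> y; apply: I0.
- move=> y; rewrite -[leLHS]addeA -[leRHS]addeA.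
  rewrite -(split_int F N y cF cN F0 (fun t x _ => N0 t x)).
  rewrite -(split_int G P y cG cP G0 (fun t x _ => P0 t x)).
  apply: (@ftc_le R (fun s => f s (vec3 y)) (fun s => f' s (vec3 y))
    (fun s => G s (vec3 y) + P s (vec3 y)) (fun s => F s (vec3 y) + N s (vec3 y)) a b ab).
  + by move=> s /pos_s s0; exact: Cont_time.
  + by move=> s /pos_s s0; exact: (@Cont_time _ (fun t x => G t x + P t x) s (vec3 y) (ContD cG cP) s0).
  + by move=> s /pos_s s0; rewrite addr_ge0 ?F0.
  + move=> s sab; have := H s (vec3 y) sab.
    by rewrite (posB (cut_div 0 _ _ _ _)) (posB (cut_div 1 _ _ _ _)) (posB (cut_div 2 _ _ _ _)) /P /N /D; lra.
- by rewrite -mP3 -mN3.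
- by rewrite -mP3.
Qed.

End IntegratedRate.

(** * The energy estimate *)

Section Energy.
Context {R : realType} (p : R).
Hypothesis p01 : 0 < p < 1.
Local Notation field := (@field R).
Local Notation mu := (@lebesgue_measure R).
Local Notation leb3 := (@leb3 R).
Local Notation Dtau := (Dtau p).
Local Notation Box := (Box p).
Implicit Types (f g psi : field) (s t a b rho : R) (x : 'rV[R]_3).

Let p0 : 0 < p. Proof. by case/andP: p01. Qed.
Let pl1 : 0 < 1 - p. Proof. by case/andP: p01 => _ ?; rewrite subr_gt0. Qed.

(* [(rho - tau)^2 - r^2], positive in the backward cone with vertex at conformal time [rho]. *)
Definition cone rho : field := fun t x =>
  (rho - t `^ (1 - p) * (1 - p)^-1) * (rho - t `^ (1 - p) * (1 - p)^-1)
  - (x 0 0 * x 0 0 + x 0 1 * x 0 1 + x 0 2 * x 0 2).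

(** Twice the energy density of the statement, with products instead of squares so that [jet_tac]
    applies. *)
Definition edens psi : field := fun t x =>
  t `^ p * Dt psi t x * (t `^ p * Dt psi t x)
  + (Dx 0 psi t x * Dx 0 psi t x + Dx 1 psi t x * Dx 1 psi t x
     + Dx 2 psi t x * Dx 2 psi t x).

Definition flux psi (i : 'I_3) : field := fun t x => 2 * (Dt psi t x * Dx i psi t x).

Lemma jet_cone rho : jet (cone rho)
  (fun t x => - 2 * (rho - t `^ (1 - p) * (1 - p)^-1) * (t `^ (1 - p) / t))
  (fun i t x => - 2 * x 0 i).
Proof.
rewrite /cone; refine (jet_congr (_ : jet _ _ _) _ _); first by jet_tac.
- move=> t x t0 /=; move: (t `^ (1 - p)) => u.
  have h := gt_eqF pl1; field.
  by rewrite h (gt_eqF t0).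
- by apply: ord3P => t x t0 /=; atomize; ring.
Qed.

Lemma smooth_edens psi : Smooth psi -> Smooth (edens psi).
Proof. by move=> sf; refine (let: And3 s _ _ := (_ : jet (edens psi) _ _) in s); rewrite /edens; jet_tac. Qed.

Lemma Dt_edens psi : Smooth psi -> eq_pos (Dt (edens psi))
  (fun t x => 2 * p / t * (t `^ p * Dt psi t x) ^+ 2
    + 2 * (t `^ p) ^+ 2 * Dt psi t x * Dt (Dt psi) t x
    + 2 * (Dx 0 psi t x * Dt (Dx 0 psi) t x + Dx 1 psi t x * Dt (Dx 1 psi) t x
     + Dx 2 psi t x * Dt (Dx 2 psi) t x)).
Proof.
move=> sf; refine (let: And3 _ s _ := (_ : jet (edens psi) _ _) in _).
  by rewrite /edens; jet_tac.
move=> t x t0; rewrite s//; move: {s} (t `^ p) => u; atomize => *.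
by field; rewrite gt_eqF.
Qed.

Lemma jet_flux psi i : Smooth psi -> jet (flux psi i)
  (fun t x => 2 * (Dt psi t x * Dt (Dx i psi) t x + Dx i psi t x * Dt (Dt psi) t x))
  (fun j t x => 2 * (Dt psi t x * Dx j (Dx i psi) t x + Dx i psi t x * Dt (Dx j psi) t x)).
Proof.
move=> sf; rewrite /flux; refine (jet_congr (_ : jet _ _ _) _ _); first by jet_tac.
- by move=> t x t0 /=; atomize; ring.
- by move=> j t x t0 /=; rewrite (Dx_Dt j sf)//; atomize; ring.
Qed.

(** The lateral boundary of the cone is characteristic: with [d] for $\rho-\tau$, [A] for $t^p$ and
    [sig] for $t^{-p}$, the flux through it is nonnegative by Cauchy-Schwarz, because $|x|\le d$
    where the cut-off is positive. *)
Lemma cone_flux_bound (d A sig q a b0 b1 b2 x0 x1 x2 : R) : 0 <= d -> 0 < A -> 0 <= q ->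
  sig * A = 1 -> (q = 0 \/ x0 * x0 + x1 * x1 + x2 * x2 <= d * d) ->
  0 <= q * (d * sig * (A * a * (A * a) + (b0 * b0 + b1 * b1 + b2 * b2))
    - 2 * a * (x0 * b0 + x1 * b1 + x2 * b2)).
Proof.
move=> d0 A0 q0 sA [->|H]; first by rewrite mul0r.
apply: mulr_ge0 => //; rewrite -(pmulr_rge0 _ A0).
set B := b0 * b0 + _ + _; set D := x0 * b0 + _ + _.
have -> : A * (d * sig * (A * a * (A * a) + B) - 2 * a * D) =
   d * ((A * a) * (A * a) + B) - 2 * (A * a) * D.
  rewrite (_ : A * _ = (sig * A) * d * (A * a * (A * a) + B) - 2 * (A * a) * D); first by rewrite sA; ring.
  by ring.
move: (A * a) => u.
have B0 : 0 <= B by rewrite /B; nra.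
have CS : D * D <= d * d * B.
  apply: (@le_trans _ _ ((x0 * x0 + x1 * x1 + x2 * x2) * B)); last exact: ler_wpM2r.
  rewrite -subr_ge0 /B /D.
  have -> : (x0 * x0 + x1 * x1 + x2 * x2) * (b0 * b0 + b1 * b1 + b2 * b2) -
     (x0 * b0 + x1 * b1 + x2 * b2) * (x0 * b0 + x1 * b1 + x2 * b2) =
     (x0 * b1 - x1 * b0) ^+ 2 + (x0 * b2 - x2 * b0) ^+ 2 + (x1 * b2 - x2 * b1) ^+ 2 by ring.
  by rewrite !addr_ge0 ?sqr_ge0.
have [d00|dn] := eqVneq d 0.
  have D0 : D = 0.
    by apply/eqP; rewrite -sqrf_eq0 eq_le sqr_ge0 andbT expr2; rewrite d00 !mul0r in CS.
  by rewrite d00 D0 mul0r mulr0 subr0.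
have dp : 0 < d by rewrite lt_def dn.
rewrite -(pmulr_rge0 _ dp); have := sqr_ge0 (d * u - D); nra.
Qed.

(** The weight contributes $2p/t$ and the friction $-6p/t$, leaving $-4p/t$ times the kinetic term.
    Half is moved to the left as bulk; the other half completes the square with the source [G], at
    the price of the factor $(2p)^{-1}$. *)
Lemma wave_bulk_bound (t A a a' e G : R) : 0 < t -> 0 < A ->
  G = - a' - 3 * p / t * a + (A * A)^-1 * e ->
  2 * p / t * (A * a) ^+ 2 + 2 * A ^+ 2 * a * a' + 2 * p * ((A * a) ^+ 2 / t) <=
  2 * a * e + (2 * p)^-1 * (t * (A * G) ^+ 2).
Proof.
move=> t0 A0 GE; rewrite -subr_ge0.
have -> : 2 * a * e + (2 * p)^-1 * (t * (A * G) ^+ 2) -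
  (2 * p / t * (A * a) ^+ 2 + 2 * A ^+ 2 * a * a' + 2 * p * ((A * a) ^+ 2 / t)) =
  (2 * p * t)^-1 * (A * (t * G + 2 * p * a)) ^+ 2.
  have -> : a' = - G - 3 * p / t * a + (A * A)^-1 * e by rewrite GE; ring.
  by field; rewrite (gt_eqF t0) (gt_eqF A0) (gt_eqF p0).
by rewrite mulr_ge0 ?sqr_ge0// invr_ge0 !mulr_ge0// ltW.
Qed.

Definition weight rho : field := fun t x => pos (cone rho t x) ^+ 2.

Lemma smooth_cone rho : Smooth (cone rho). Proof. by case: (jet_cone rho). Qed.

Lemma weight_ge0 rho t x : 0 <= weight rho t x. Proof. exact: sqr_ge0. Qed.

Lemma Cont_weight rho : Cont (weight rho).
Proof. exact/ContX/Cont_pos/Cont_smooth/smooth_cone. Qed.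

Lemma energy_rate psi rho t x : Smooth psi -> 0 < t -> tau p t <= rho ->
  2 * pos (cone rho t x) * Dt (cone rho) t x * edens psi t x
    + weight rho t x * Dt (edens psi) t x
    + 2 * p * (weight rho t x * ((t `^ p * Dt psi t x) ^+ 2 / t))
  <= cut_div 0 (cone rho) (flux psi 0) t x + cut_div 1 (cone rho) (flux psi 1) t x
     + cut_div 2 (cone rho) (flux psi 2) t x
     + (2 * p)^-1 * (weight rho t x * (t * (t `^ p * Box psi t x) ^+ 2)).
Proof.
move=> sf t0 trho.
have [_ cT cX] := jet_cone rho.
rewrite cT// Dt_edens// /cut_div !cX//.
have [_ _ f0] := jet_flux 0 sf; have [_ _ f1] := jet_flux 1 sf; have [_ _ f2] := jet_flux 2 sf.
rewrite f0// f1// f2//.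
have GE : Box psi t x = - Dt (Dt psi) t x - 3 * p / t * Dt psi t x
   + (t `^ p * t `^ p)^-1 * (Dx 0 (Dx 0 psi) t x + Dx 1 (Dx 1 psi) t x + Dx 2 (Dx 2 psi) t x).
  by rewrite /Box powR2p.
have A0 : 0 < t `^ p by exact: powR_gt0.
have H2 := wave_bulk_bound t0 A0 GE.
pose d := rho - t `^ (1 - p) * (1 - p)^-1.
have d0 : 0 <= d by rewrite subr_ge0.
have sA : t `^ (1 - p) / t * t `^ p = 1.
  by rewrite mulrAC -powRD ?(gt_eqF t0) ?implybT// subrK powRr1 ?ltW// mulfV// gt_eqF.
have Hq : pos (cone rho t x) = 0 \/ x 0 0 * x 0 0 + x 0 1 * x 0 1 + x 0 2 * x 0 2 <= d * d.
  rewrite /pos; have [h|h] := leP 0 (cone rho t x); last by left.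
  by right; move: h; rewrite /cone subr_ge0.
have H1 := cone_flux_bound (Dt psi t x) (Dx 0 psi t x) (Dx 1 psi t x) (Dx 2 psi t x)
  d0 A0 (pos_ge0 _) sA Hq.
have H3 := ler_wpM2l (weight_ge0 rho t x) H2.
rewrite /edens /flux /weight -/d in H1 H3 *.
move: (pos _) H1 H3 => q.
move: (Box _ _ _) (t `^ (1 - p) / t) (t `^ p) => G sig A.
rewrite -subr_ge0 => H1; rewrite -subr_ge0 => H3; rewrite -subr_ge0.
(* One factor 2 comes from differentiating the square of the positive part, the other from the
   derivative of [cone] itself. *)
have H := addr_ge0 (mulr_ge0 (ler0n R 4) H1) H3.
apply: (le_trans H); rewrite le_eqVlt; apply/orP; left; apply/eqP.
move: (d) => D; clear; atomize => *; ring.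
Qed.

Definition bulk rho psi : field := fun t x =>
  2 * p * (weight rho t x * ((t `^ p * Dt psi t x) ^+ 2 * t^-1)).

Definition source rho psi : field := fun t x =>
  (2 * p)^-1 * (weight rho t x * (t * (t `^ p * Box psi t x) ^+ 2)).

Definition wedens rho psi : field := fun t x => weight rho t x * edens psi t x.

Lemma edens_ge0 psi t x : 0 <= edens psi t x.
Proof. by rewrite /edens !addr_ge0// -expr2 sqr_ge0. Qed.

Lemma Cont_bulk rho psi : Smooth psi -> Cont (bulk rho psi).
Proof. move=> sf; have cw := @Cont_weight rho; rewrite /bulk.
cont_tac.
Qed.

Lemma Cont_source rho psi : Smooth psi -> Cont (source rho psi).
Proof.
move=> sf; have cw := @Cont_weight rho; have sB := smooth_Box p sf.
by rewrite /source; cont_tac.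
Qed.

Lemma Cont_wedens rho psi : Smooth psi -> Cont (wedens rho psi).
Proof.
by move=> sf; apply: (ContM (@Cont_weight rho)); exact/Cont_smooth/smooth_edens.
Qed.

Lemma wedens_ge0 rho psi t x : 0 <= wedens rho psi t x.
Proof. by rewrite mulr_ge0 ?weight_ge0 ?edens_ge0. Qed.

Lemma bulk_ge0 rho psi t x : 0 < t -> 0 <= bulk rho psi t x.
Proof.
move=> t0; apply: mulr_ge0; first by rewrite mulr_ge0// ltW.
apply: mulr_ge0; first exact: weight_ge0.
by rewrite mulr_ge0 ?sqr_ge0// invr_ge0 ltW.
Qed.

Lemma source_ge0 rho psi t x : 0 < t -> 0 <= source rho psi t x.
Proof.
move=> t0; apply: mulr_ge0; first by rewrite invr_ge0 mulr_ge0// ltW.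
apply: mulr_ge0; first exact: weight_ge0.
by rewrite mulr_ge0 ?sqr_ge0// ltW.
Qed.

Lemma tau_ge0 t : 0 <= tau p t.
Proof. by rewrite divr_ge0 ?powR_ge0// ltW. Qed.

Lemma le_tau s t : 0 < s <= t -> tau p s <= tau p t.
Proof.
move=> /andP[s0 st]; rewrite ler_pM2r ?invr_gt0//.
have t0 := lt_le_trans s0 st.
by apply: ge0_ler_powR; [exact: ltW|rewrite nnegrE ltW|rewrite nnegrE ltW|].
Qed.

Lemma cone_supp rho t x : tau p t <= rho -> 0 < cone rho t x -> forall j, `|x 0 j| <= rho.
Proof.
move=> tr; rewrite /cone subr_gt0 -expr2 => H.
have t0 := tau_ge0 t; have r0 : 0 <= rho by exact: le_trans tr.
have H' : x 0 0 * x 0 0 + x 0 1 * x 0 1 + x 0 2 * x 0 2 <= rho ^+ 2.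
  apply: le_trans (ltW H) _; rewrite ler_sqr ?nnegrE// ?subr_ge0//.
  by rewrite lerBlDr lerDl.
have K a : a * a <= rho ^+ 2 -> `|a| <= rho.
  by rewrite -expr2 -(real_normK (num_real a)) ler_sqr ?nnegrE.
by apply: ord3P; apply: K; move: H'; move: (x 0 0) (x 0 1) (x 0 2) => a b c; nra.
Qed.

Lemma energy_weighted psi rho t0 T : Smooth psi -> 0 < t0 < T -> tau p T <= rho ->
  (I3 (wedens rho psi T) + IT t0 T (bulk rho psi)
   <= I3 (wedens rho psi t0) + IT t0 T (source rho psi))%E.
Proof.
move=> sf t0T tr; have [t00 tT] := andP t0T.
have sE := smooth_edens sf; have sC := smooth_cone rho.
have r0 : 0 <= rho by apply: le_trans tr; exact: tau_ge0.
have H t : t0 <= t <= T -> 0 < t /\ tau p t <= rho.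
  move=> /andP[h1 h2]; have t1 := lt_le_trans t00 h1; split; first exact: t1.
  by apply: le_trans tr; apply: le_tau; rewrite t1.
have cE : Cont (fun t x => 2 * pos (cone rho t x) * Dt (cone rho) t x * edens psi t x
    + weight rho t x * Dt (edens psi) t x).
  apply: ContD; last by apply: (ContM (@Cont_weight rho)); exact/Cont_smooth/smooth_Dt.
  by cont_tac.
apply: (@integrated_rate R (wedens rho psi) _ (bulk rho psi) (source rho psi) (cone rho)
    (flux psi) rho t0 T t0T r0 (@Cont_wedens rho psi sf) cE (@Cont_bulk rho psi sf)
    (@Cont_source rho psi sf) sC).
- by move=> i; have [] := jet_flux i sf.
- by move=> t x t1; rewrite wedens_ge0 bulk_ge0// source_ge0.
- by move=> t x /H[_ h]; exact: cone_supp.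
- move=> t x /H[t1 _].
  have dQ := is_derive_pos_sqr (is_derive_time x sC t1).
  have := is_deriveM dQ (is_derive_time x sE t1) => -[D1 D2]; split => //; rewrite D2.
  rewrite /weight /pos; move: (Dt (cone _) _ _) (Dt (edens _) _ _) (Num.max _ _) (edens _ _ _) => u v w z.
  by rewrite /GRing.scale /=; ring.
- by move=> t x /H[t1 tr']; exact: energy_rate.
Qed.

End Energy.

Lemma sqr_sum_le {R : realFieldType} (I : Type) (l : seq I) (X : I -> R) :
  (\sum_(q <- l) X q) ^+ 2 <= (size l)%:R * \sum_(q <- l) X q ^+ 2.
Proof.
elim: l => [|q l IH]; first by rewrite !big_nil expr0n mul0r.
rewrite !big_cons /=; move: IH; set S := \sum_(_ <- l) _; set Q := \sum_(_ <- l) _.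
move=> IH; have n0 : 0 <= (size l)%:R :> R by [].
have Q0 : 0 <= Q by apply: sumr_ge0 => ? _; exact: sqr_ge0.
have [l0|ln] := eqVneq (size l) 0%N.
  have S0 : S = 0 by rewrite /S; move/size0nil: l0 => ->; rewrite big_nil.
  by rewrite l0 S0 addr0 mul1r; lra.
have n1 : 1 <= (size l)%:R :> R by rewrite ler1n lt0n.
rewrite -natr1; move: n0 n1 IH => /[swap]; set n : R := (size l)%:R => n1 n0 IH.
have n0' : 0 < n by lra.
have H : 2 * (X q * S) <= n * X q ^+ 2 + n^-1 * S ^+ 2.
  have := mulr_ge0 (ltW n0') (sqr_ge0 (X q - n^-1 * S)).
  have -> : n * (X q - n^-1 * S) ^+ 2 = n * X q ^+ 2 + n^-1 * S ^+ 2 - 2 * (X q * S).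
    by field; rewrite gt_eqF.
  by rewrite subr_ge0.
have H2 : n^-1 * S ^+ 2 <= Q by rewrite ler_pdivrMl.
by rewrite sqrrD; lra.
Qed.

(** There are finitely many words of bounded length over eight letters, and the property is monotone
    in the constant, so constants found word by word may be added up. *)
Lemma bounded_words {R : realDomainType} n (Q : seq 'I_8 -> R -> Prop) :
  (forall v, (size v <= n)%N -> exists2 C, 0 <= C & Q v C) ->
  (forall v C C', Q v C -> C <= C' -> Q v C') ->
  exists2 C, 0 <= C & forall v, (size v <= n)%N -> Q v C.
Proof.
elim: n Q => [|n IH] Q H mono.
  have [C C0 HC] := H [::] isT; exists C => // v.
  by rewrite leqn0 => /nilP ->.
have [C C0 HC] := H [::] isT.
have K (i : 'I_8) : exists C, 0 <= C /\ forall v, (size v <= n)%N -> Q (i :: v) C.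
  have [C' C'0 HC'] := IH (fun v => Q (i :: v)) (fun v hv => H (i :: v) hv)
    (fun v => mono (i :: v)).
  by exists C'.
have [c hc] := fin_all_exists K.
exists (C + \sum_i c i).
  by rewrite addr_ge0// sumr_ge0// => i _; case: (hc i).
case=> [|i v] hv.
  by apply: mono HC _; rewrite lerDl sumr_ge0// => i _; case: (hc i).
apply: (mono _ _ _ ((hc i).2 v hv)).
rewrite (bigD1 i)//= addrCA lerDl addr_ge0// sumr_ge0// => j _.
by case: (hc j).
Qed.

Lemma lee_scale {R : realType} (c b : R) (X : \bar R) : 0 <= c -> (X <= b%:E)%E ->
  (c%:E * X <= (c * b)%:E)%E.
Proof.
by move=> c0 Xb; rewrite EFinM; apply: (@lee_wpmul2l _ c%:E); rewrite ?lee_fin.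
Qed.

(** * Energy bounds for all words *)

Section Functionals.
Context {R : realType} (p t0 : R).
Hypothesis p01 : 0 < p < 1.
Hypothesis t00 : 0 < t0.
Local Notation field := (@field R).
Local Notation word := (word p).
Local Notation tspan := (tspan p).
Implicit Types (f F G : field) (t a b T e : R) (x : 'rV[R]_3) (v : seq 'I_8).

Definition ge0_field F := forall t x, 0 < t -> 0 <= F t x.

(** An interface shared by the integral over a slice and the integral over a time slab, so that
    expansions into words are estimated once for both. *)
Definition pos_functional T (N : field -> \bar R) := [/\
  forall F G, Cont F -> Cont G -> ge0_field F -> ge0_field G ->
    N (fun t x => F t x + G t x) = (N F + N G)%E,
  forall c F, 0 <= c -> Cont F -> ge0_field F -> N (fun t x => c * F t x) = (c%:E * N F)%E &
  forall F G, ge0_field F -> (forall t x, t0 <= t <= T -> F t x <= G t x) -> (N F <= N G)%E].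

Lemma pos_functional_IT T : t0 <= T -> pos_functional T (IT t0 T).
Proof.
move=> tT; have tt : 0 < t0 <= T by rewrite t00.
split; first by move=> F G cF cG F0 G0; exact: ITD.
  by move=> c F c0 cF F0; exact: ITZ.
by move=> F G F0 FG; exact: le_IT.
Qed.

Lemma pos_functional_I3 T : t0 <= T -> pos_functional T (fun F => I3 (F T)).
Proof.
move=> tT; have T0 : 0 < T by exact: lt_le_trans tT.
split.
- move=> F G cF cG F0 G0; apply: I3D; try exact: Cont_space.
    by move=> x; exact: F0.
  by move=> x; exact: G0.
- move=> c F c0 cF F0; apply: I3Z => //; first exact: Cont_space.
  by move=> x; exact: F0.
- by move=> F G F0 FG; apply: le_I3 => x; [exact: F0|apply: FG; rewrite tT lexx].
Qed.

Lemma functional_sum T N (I : eqType) (l : seq I) (F : I -> field) (b : I -> R) :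
  pos_functional T N -> (forall q, Cont (F q)) -> (forall q, ge0_field (F q)) ->
  (forall q, q \in l -> (N (F q) <= (b q)%:E)%E) ->
  (N (fun t x => (\sum_(q <- l) F q t x)%R) <= (\sum_(q <- l) b q)%:E)%E.
Proof.
move=> [ND NZ NL] cF F0; elim: l => [|q l IH] H.
  have -> : (fun t x => \sum_(q <- [::]) F q t x) = (fun t x => 0 * 0) :> field.
    by apply/funext => t; apply/funext => x; rewrite big_nil mul0r.
  have -> := NZ 0 (fun _ _ => 0) (lexx 0) (@Cont_cst R 0) (fun _ _ _ => lexx 0).
  by rewrite big_nil mul0e.
have cS : Cont (fun t x => \sum_(q <- l) F q t x).
  elim: (l) => [|r s IHs].
    rewrite (_ : (fun t x => _) = (fun _ _ => 0))//; first exact: Cont_cst.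
    by apply/funext => t; apply/funext => x; rewrite big_nil.
  rewrite (_ : (fun t x => _) = (fun t x => F r t x + \sum_(q <- s) F q t x)); first exact: ContD.
  by apply/funext => t; apply/funext => x; rewrite big_cons.
have -> : (fun t x => \sum_(q <- q :: l) F q t x) =
    (fun t x => F q t x + \sum_(q <- l) F q t x) :> field.
  by apply/funext => t; apply/funext => x; rewrite big_cons.
rewrite ND//; last by move=> t x t1; apply: sumr_ge0 => r _; exact: F0.
rewrite big_cons EFinD; apply: leeD; first by apply: H; rewrite inE eqxx.
by apply: IH => r hr; apply: H; rewrite inE hr orbT.
Qed.

Lemma powR_le_start t a : t0 <= t -> a <= 0 -> t `^ a <= t0 `^ a.
Proof.
move=> tt a0; rewrite -(opprK a) !(powRN _ (- a)).
have t1 := lt_le_trans t00 tt.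
rewrite lef_pV2 ?posrE ?powR_gt0//; apply: ge0_ler_powR; rewrite ?nnegrE ?oppr_ge0//.
  exact: ltW.
exact: ltW.
Qed.

(** Cauchy-Schwarz on the finite list. The common decay $t^{-e}$ is kept for later use, and the
    excess $t^{e-a}$ is bounded by its value at [t0] because $a\ge e$; this is one way in which
    constants depend on [t0]. *)
Lemma quad_tspan e (P : R -> seq 'I_8 -> Prop) (T' : field -> field) : tspan P T' -> (forall a v, P a v -> e <= a) ->
  exists2 K : R, 0 <= K & forall T N (om : field) f (b : R), pos_functional T N ->
    Smooth f -> Cont om -> ge0_field om -> 0 <= b ->
    (forall a v, P a v -> (N (fun t x => (om t x * (t `^ (- e) * word v f t x) ^+ 2)%R) <= b%:E)%E) ->
    (N (fun t x => (om t x * T' f t x ^+ 2)%R) <= (K * b)%:E)%E.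
Proof.
move=> [l Hl El] He.
pose c (q : R * R * seq 'I_8) : R := (size l)%:R * (q.1.1 * t0 `^ (e - q.1.2)) ^+ 2.
have c0 q : 0 <= c q by rewrite mulr_ge0// sqr_ge0.
exists (\sum_(q <- l) c q); first by apply: sumr_ge0 => q _.
move=> T N om f b PN sf com om0 b0 H.
have [ND NZ NL] := PN.
pose F (q : R * R * seq 'I_8) : field := fun t x => om t x * (t `^ (- e) * word q.2 f t x) ^+ 2.
have cF q : Cont (F q).
  have sw : Smooth (word q.2 f) by exact: smooth_word.
  by rewrite /F; cont_tac.
have F0 q : ge0_field (F q) by move=> t x t1; rewrite mulr_ge0 ?sqr_ge0 ?om0.
apply: (@le_trans _ _ (N (fun t x => \sum_(q <- l) c q * F q t x))).
  apply: NL; first by move=> t x t1; rewrite mulr_ge0 ?sqr_ge0 ?om0.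
  move=> t x /andP[t1 _]; have t2 := lt_le_trans t00 t1.
  rewrite El// /tcomb.
  apply: (le_trans (ler_wpM2l (om0 t x t2) (sqr_sum_le _ _))).
  rewrite mulrCA mulr_sumr mulr_sumr big_seq [leRHS]big_seq; apply: ler_sum => q ql.
  have E : t `^ (- q.1.2) = t `^ (e - q.1.2) * t `^ (- e).
    by rewrite -powRD ?(gt_eqF t2) ?implybT//; congr (_ `^ _); ring.
  have S := powR_le_start t1 (_ : e - q.1.2 <= 0).
  rewrite E /c /F -[leRHS]mulrA; apply: ler_wpM2l => //.
  rewrite [leRHS]mulrCA; apply: ler_wpM2l; first exact: om0.
  rewrite (_ : q.1.1 * _ * _ = q.1.1 * t `^ (e - q.1.2) * (t `^ (- e) * word q.2 f t x)); last by ring.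
  rewrite [leLHS]exprMn; apply: ler_wpM2r; first exact: sqr_ge0.
  rewrite !exprMn; apply: ler_wpM2l; first exact: sqr_ge0.
  rewrite ler_sqr ?nnegrE ?powR_ge0//; apply: S.
  by rewrite subr_le0; apply: He (Hl _ ql).
rewrite mulr_suml; apply: (functional_sum PN (b := fun q => c q * b)) => q.
- by apply: (@ContM _ (fun _ _ => c q)); [exact: Cont_cst|exact: cF].
- by move=> t x t1; rewrite mulr_ge0 ?F0.
- move=> ql; rewrite (NZ _ _ (c0 q) (cF q) (F0 q)) lee_scale//.
  exact: H (Hl _ ql).
Qed.

Lemma smooth_tspan (P : R -> seq 'I_8 -> Prop) (T' : field -> field) f :
  tspan P T' -> Smooth f -> Smooth (T' f).
Proof.
move=> [l _ E] sf; apply: (@smooth_eq_pos _ (tcomb p l f)); last exact: smooth_tcomb.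
by move=> t x t1; rewrite E.
Qed.

(* The norms on the right of the estimate, for all words in the generators. *)
Definition controlled n f T (m : R) := [/\ Smooth f, t0 < T, 0 <= m &
  [/\ forall v, (size v <= n)%N -> (I3 (edens p (word v f) t0) <= m%:E)%E,
  forall v, (size v <= n)%N ->
    (IT t0 T (fun t x => (t * (t `^ p * word v (Box p f) t x) ^+ 2)%R) <= m%:E)%E &
  forall v, (size v <= n - 3)%N ->
    (I3 (fun x => ((T `^ (p + 1) * word v (Box p f) T x) ^+ 2)%R) <= m%:E)%E]].

Lemma weight_le rho t x : tau p t <= rho -> weight p rho t x <= rho ^+ 4.
Proof.
move=> tr; have t_ge0 := tau_ge0 p01 t.
rewrite /weight (_ : rho ^+ 4 = (rho ^+ 2) ^+ 2); last by rewrite -exprM.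
rewrite ler_sqr ?nnegrE ?sqr_ge0 ?pos_ge0// /pos ge_max sqr_ge0 /= /cone -expr2.
rewrite lerBlDr; apply: (@le_trans _ _ (rho ^+ 2)).
  by rewrite ler_sqr ?nnegrE ?subr_ge0 ?(le_trans t_ge0)// lerBlDr lerDl.
by rewrite lerDl !addr_ge0// -expr2 sqr_ge0.
Qed.

(** Induction on the length, with the same [rho] throughout: an error word is [Dtau] of a shorter
    word, so its weighted norm is the bulk term already bounded for that shorter word. *)
Lemma weighted_energy_word n v : (size v <= n)%N -> exists2 C : R, 0 <= C &
  forall f T m rho, controlled n f T m -> tau p T <= rho ->
    (I3 (wedens p rho (word v f) T) + IT t0 T (bulk p rho (word v f)) <= (C * rho ^+ 4 * m)%:E)%E.
Proof.
have [j] := ubnP (size v); elim: j v => // j IH v; rewrite ltnS => vj vn.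
have [T1 [T2 [HT1 HT2 E]]] := Box_word p01 v.
have [K1 K10 HK1] := quad_tspan HT1 (fun a u (h : box_source (size v) a u) => h.1).
have [K2 K20 HK2] := quad_tspan HT2 (fun a u (h : box_error p (size v) a u) => h.1).
have [C C0 HC] : exists2 C, 0 <= C & forall u, (size u <= (size v).-1)%N ->
    (size u < size v)%N -> forall f T m rho, controlled n f T m -> tau p T <= rho ->
    (IT t0 T (bulk p rho (word u f)) <= (C * rho ^+ 4 * m)%:E)%E.
  apply: (bounded_words (Q := fun u C => (size u < size v)%N ->
      forall f T m rho, controlled n f T m -> tau p T <= rho ->
    (IT t0 T (bulk p rho (word u f)) <= (C * rho ^+ 4 * m)%:E)%E)).
    move=> u hu; have [uv|] := ltnP (size u) (size v); last by exists 0.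
    have [C C0 HC] := IH u (leq_trans uv vj) (leq_trans (ltnW uv) vn).
    exists C => // _ f T m rho cf tr; apply: le_trans _ (HC f T m rho cf tr).
    by rewrite leeDr// I3_ge0// => x; exact: wedens_ge0.
  move=> u C C' H CC' uv f T m rho cf tr; apply: le_trans (H uv f T m rho cf tr) _.
  have [_ _ m0 _] := cf; rewrite lee_fin ler_wpM2r// ler_wpM2r// exprn_ge0//.
  exact: le_trans (tau_ge0 p01 T) tr.
have pp : 0 < p by case/andP: p01.
pose c3 := t0 `^ (2 * p - 2 * (1 + p) + 2).
exists (1 + p^-1 * (K1 + K2 * ((2 * p)^-1 * C))).
  rewrite addr_ge0// mulr_ge0 ?invr_ge0 ?(ltW pp)// addr_ge0// !mulr_ge0// invr_ge0.
  by rewrite mulr_ge0// ltW.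
move=> f T m rho cf tr.
have [sf tT m0 [H1 H2 _]] := cf.
have r0 : 0 <= rho by exact: le_trans (tau_ge0 p01 T) tr.
have r4 : 0 <= rho ^+ 4 by exact: exprn_ge0.
have sv : Smooth (word v f) by exact: smooth_word.
have sB : Smooth (Box p f) by exact: smooth_Box.
have PN := pos_functional_IT (ltW tT); have [ND NZ NL] := PN.
have tle t : t0 <= t <= T -> tau p t <= rho.
  move=> /andP[h1 h2]; apply: le_trans tr; apply: le_tau => //.
  by rewrite (lt_le_trans t00 h1).
apply: (le_trans (energy_weighted p01 sv _ tr)); first by rewrite t00.
rewrite mulrDl mul1r mulrDl EFinD; apply: leeD.
  have h0 : tau p t0 <= rho by apply: tle; rewrite lexx ltW.
  apply: (@le_trans _ _ (I3 (fun x => rho ^+ 4 * edens p (word v f) t0 x))).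
    apply: le_I3 => x; first exact: wedens_ge0.
    by apply: ler_wpM2r; [exact: edens_ge0|exact: weight_le].
  rewrite I3Z//; last by move=> x; exact: edens_ge0.
    by apply: lee_scale => //; exact: (H1 v vn).
  exact: Cont_space (Cont_smooth (smooth_edens p sv)) t00.
pose om : field := fun t x => weight p rho t x * (t * (t `^ p) ^+ 2).
have cw := @Cont_weight R p p01 rho.
have com : Cont om by rewrite /om; cont_tac.
have om0 : ge0_field om.
  by move=> t x t1; rewrite mulr_ge0 ?weight_ge0// mulr_ge0 ?sqr_ge0// ltW.
have b1 : (IT t0 T (fun t x => om t x * T1 (Box p f) t x ^+ 2)%R <= (K1 * (rho ^+ 4 * m))%:E)%E.
  apply: (HK1 T _ om (Box p f) _ PN sB com om0); first exact: mulr_ge0.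
  move=> a u [_ su].
  apply: (@le_trans _ _ (IT t0 T (fun t x => rho ^+ 4 * (t * (t `^ p * word u (Box p f) t x) ^+ 2)))).
    apply: NL; first by move=> t x t1; rewrite mulr_ge0 ?sqr_ge0 ?om0.
    move=> t x /[dup] tt /andP[h1 _]; have h2 := lt_le_trans t00 h1.
    rewrite oppr0 powRr0 mul1r /om -mulrA -mulrA -exprMn.
    apply: ler_wpM2r; first by rewrite mulr_ge0 ?sqr_ge0// ltW.
    exact/weight_le/tle.
  have su' : Smooth (word u (Box p f)) by exact: smooth_word.
  rewrite NZ//.
  - by apply: lee_scale => //; apply: H2; exact: leq_trans vn.
  - by cont_tac.
  - by move=> t x t1; rewrite mulr_ge0 ?sqr_ge0// ltW.
have b2 : (IT t0 T (fun t x => om t x * T2 f t x ^+ 2)%R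
    <= (K2 * ((2 * p)^-1 * C * rho ^+ 4 * m))%:E)%E.
  apply: (HK2 T _ om f _ PN sf com om0).
    by rewrite !mulr_ge0// invr_ge0 mulr_ge0// ltW.
  move=> a u' [_ [u -> su]].
  have su' : Smooth (word u f) by exact: smooth_word.
  apply: (@le_trans _ _ (IT t0 T (fun t x => (2 * p)^-1 * bulk p rho (word u f) t x))).
    apply: NL; first by move=> t x t1; rewrite mulr_ge0 ?sqr_ge0 ?om0.
    move=> t x /andP[h1 _]; have h2 := lt_le_trans t00 h1.
    rewrite /om /bulk [leRHS]mulrA mulVf ?mul1r ?gt_eqF ?mulr_gt0//.
    rewrite -[leLHS]mulrA; apply: ler_wpM2l; first exact: weight_ge0.
    apply: (@le_trans _ _ (t * (t `^ p) ^+ 2 * (t `^ (- (1 + p))) ^+ 2 * (t `^ p * Dt (word u f) t x) ^+ 2)).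
      by rewrite exprMn !mulrA.
    (* The exponents $1+2p-2(1+p)$ add up to $-1$: the decay of the errors is exactly what turns the
       source weight into the bulk weight. *)
    suff -> : t * (t `^ p) ^+ 2 * (t `^ (- (1 + p))) ^+ 2 = t^-1 by rewrite mulrC.
    rewrite -[X in X * _ * _](powRr1 (ltW h2)) -!powR_mulrn ?powR_ge0// -!powRrM.
    rewrite -!powRD ?(gt_eqF h2) ?implybT//.
    by rewrite -powR_inv1 ?ltW//; congr (_ `^ _); ring.
  rewrite NZ; last 3 first.
  - by rewrite invr_ge0 mulr_ge0// ltW.
  - exact: Cont_bulk.
  - by move=> t x t1; exact: bulk_ge0.
  rewrite (_ : (2 * p)^-1 * C * _ * _ = (2 * p)^-1 * (C * rho ^+ 4 * m)); last by rewrite !mulrA.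
  apply: lee_scale; first by rewrite invr_ge0 mulr_ge0// ltW.
  by apply: HC => //; rewrite -ltnS prednK//; exact: leq_trans su.
(* $(X+Y)^2\le 2(X^2+Y^2)$ doubles the factor $(2p)^{-1}$ of the source to $p^{-1}$. *)
apply: (@le_trans _ _ (IT t0 T (fun t x => p^-1 * (om t x * T1 (Box p f) t x ^+ 2
    + om t x * T2 f t x ^+ 2)))).
  apply: NL; first by move=> t x t1; exact: source_ge0.
  move=> t x /andP[h1 _]; have h2 := lt_le_trans t00 h1.
  rewrite /source E// /om.
  move: (T1 _ _ _) (T2 _ _ _) (t `^ p) (weight_ge0 p rho t x) => X Y u.
  move: (weight _ _ _ _) => w w0; rewrite -subr_ge0.
  have -> : p^-1 * (w * (t * u ^+ 2) * X ^+ 2 + w * (t * u ^+ 2) * Y ^+ 2) -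
    (2 * p)^-1 * (w * (t * (u * (X + Y)) ^+ 2)) =
    (2 * p)^-1 * (w * (t * (u * (X - Y)) ^+ 2)) by field; rewrite gt_eqF.
  apply: mulr_ge0; first by rewrite invr_ge0 mulr_ge0// ltW.
  by apply: mulr_ge0 => //; apply: mulr_ge0; [exact: ltW|exact: sqr_ge0].
have sT1 := smooth_tspan HT1 sB; have sT2 := smooth_tspan HT2 sf.
have s1 : Cont (fun t x => om t x * T1 (Box p f) t x ^+ 2) by cont_tac.
have s2 : Cont (fun t x => om t x * T2 f t x ^+ 2) by cont_tac.
have -> := NZ p^-1 (fun t x => om t x * T1 (Box p f) t x ^+ 2 + om t x * T2 f t x ^+ 2)
  _ (ContD s1 s2) _; last 2 first.
- by rewrite invr_ge0 ltW.
- by move=> t x t1; apply: addr_ge0; apply: mulr_ge0; rewrite ?om0 ?sqr_ge0.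
rewrite ND//; last 2 first.
- by move=> t x t1; rewrite mulr_ge0 ?om0 ?sqr_ge0.
- by move=> t x t1; rewrite mulr_ge0 ?om0 ?sqr_ge0.
rewrite -(mulrA p^-1) -(mulrA p^-1); apply: lee_scale; first by rewrite invr_ge0 ltW.
apply: le_trans (leeD b1 b2) _; rewrite -EFinD lee_fin.
rewrite le_eqVlt; apply/orP; left; apply/eqP; ring.
Qed.

Lemma posM (c a : R) : 0 <= c -> pos (c * a) = c * pos a.
Proof. by move=> c0; rewrite /pos maxr_pMr// mulr0. Qed.

(** In the variable $h=1/(n+1)$ the quotient is a function [g] continuous at 0 with [g 0 = 1], since
    both $\tau$ and $|x|$ are negligible against [rho]. *)
Lemma weight_limit T (x : 'rV[R]_3) : let rho n := n.+1%:R * (tau p T + 1) in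
  (fun n => weight p (rho n) T x / rho n ^+ 4) @ \oo --> (1 : R).
Proof.
move=> rho; pose r : R := tau p T + 1.
have r0 : 0 < r by rewrite /r ltr_wpDl// tau_ge0.
pose N2 := x 0 0 * x 0 0 + x 0 1 * x 0 1 + x 0 2 * x 0 2.
have ch : (fun n : nat => n.+1%:R^-1 : R) @ \oo --> (0 : R) by exact: cvg_harmonic.
pose g (h : R) : R := pos ((1 - h * (tau p T / r)) ^+ 2 - h ^+ 2 * (N2 / r ^+ 2)) ^+ 2.
have cg : {for (0 : R), continuous g}.
  apply: (@continuous_comp _ _ _ (fun h : R => pos ((1 - h * (tau p T / r)) ^+ 2 - h ^+ 2 * (N2 / r ^+ 2))) (fun u : R => u ^+ 2)); last exact: exprn_continuous.
  apply: (@continuous_comp _ _ _ (fun h : R => (1 - h * (tau p T / r)) ^+ 2 - h ^+ 2 * (N2 / r ^+ 2)) pos); last exact: continuous_max.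
  apply: cvgB.
    apply: (@continuous_comp _ _ _ (fun h : R => 1 - h * (tau p T / r)) (fun u : R => u ^+ 2)); last exact: exprn_continuous.
    by apply: cvgB; [exact: cvg_cst|apply: cvgM; [exact: cvg_id|exact: cvg_cst]].
  by apply: cvgM; [exact: exprn_continuous|exact: cvg_cst].
have E : (fun n => weight p (rho n) T x / rho n ^+ 4) = g \o (fun n : nat => n.+1%:R^-1 : R).
  apply/funext => n /=; rewrite /weight /cone /g -[T `^ _ * _]/(tau p T) -/N2.
  have rn0 : 0 < rho n by rewrite mulr_gt0.
  have n0 : n.+1%:R != 0 :> R by [].
  have rn2 : 0 < rho n ^+ 2 by rewrite exprn_gt0.
  rewrite (_ : rho n ^+ 4 = (rho n ^+ 2) ^+ 2); last by rewrite -exprM.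
  rewrite -expr_div_n; congr (_ ^+ 2).
  rewrite mulrC -posM; last by rewrite invr_ge0 ltW.
  congr pos; rewrite /rho -/r.
  move: (n.+1%:R : R) n0 => k k0.
  by field; rewrite k0 gt_eqF.
have g0 : g 0 = 1.
  by rewrite /g !mul0r expr0n /= mul0r !subr0 expr1n /pos max_r// expr1n.
by rewrite E; have := cvg_comp _ _ ch cg; rewrite g0.
Qed.

(** The cone bound grows like $\rho^4$, the size of the weight. Dividing by $\rho^4$ and letting
    [rho] tend to infinity, Fatou's lemma gives the unweighted energy. *)
Lemma energy_word n : exists2 C : R, 0 <= C & forall v f T m, (size v <= n)%N ->
  controlled n f T m -> (I3 (edens p (word v f) T) <= (C * m)%:E)%E.
Proof.
have [C C0 HC] : exists2 C : R, 0 <= C & forall v, (size v <= n)%N -> forall f T m rho,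
    controlled n f T m -> tau p T <= rho ->
    (I3 (wedens p rho (word v f) T) <= (C * rho ^+ 4 * m)%:E)%E.
  apply: bounded_words => [v vn|v C C' H CC' f T m rho cf tr].
    have [C C0 HC] := weighted_energy_word vn; exists C => // f T m rho cf tr.
    apply: le_trans _ (HC f T m rho cf tr).
    by rewrite leeDl// IT_ge0// => t x; exact: bulk_ge0.
  apply: le_trans (H f T m rho cf tr) _.
  have [_ _ m0 _] := cf; rewrite lee_fin ler_wpM2r// ler_wpM2r// exprn_ge0//.
  exact: le_trans (tau_ge0 p01 T) tr.
exists C => // v f T m vn cf.
have [sf tT m0 _] := cf.
have T0 : 0 < T := lt_trans t00 tT.
pose rho (n : nat) : R := n.+1%:R * (tau p T + 1).
have tT0 := tau_ge0 p01 T.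
have rn0 j : 0 < rho j by rewrite mulr_gt0// ltr_wpDl.
have tr j : tau p T <= rho j.
  apply: (@le_trans _ _ (1 * (tau p T + 1))); first by rewrite mul1r lerDl.
  by rewrite ler_wpM2r ?addr_ge0// ler1n.
have sv : Smooth (word v f) by exact: smooth_word.
apply: (@I3_limit R (fun j x => (rho j ^+ 4)^-1 * wedens p (rho j) (word v f) T x)).
- move=> j; apply: (Cont_space (F := fun t x => (rho j ^+ 4)^-1 * wedens p (rho j) (word v f) t x) _ T0).
  by apply: (@ContM _ (fun _ _ => (rho j ^+ 4)^-1)); [exact: Cont_cst|exact: Cont_wedens].
- by move=> j x; rewrite mulr_ge0 ?wedens_ge0// invr_ge0 exprn_ge0// ltW.
- move=> x; rewrite -[X in _ --> X]mul1r.
  have -> : (fun j => (rho j ^+ 4)^-1 * wedens p (rho j) (word v f) T x) =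
     (fun j => weight p (rho j) T x / rho j ^+ 4 * edens p (word v f) T x).
    by apply/funext => j; rewrite /wedens mulrA (mulrC _^-1).
  by apply: cvgM; [exact: weight_limit|exact: cvg_cst].
- move=> j; rewrite I3Z ?invr_ge0 ?exprn_ge0 ?(ltW (rn0 j))//; last first.
  + by move=> x; exact: wedens_ge0.
  + by apply: Cont_space T0; exact: Cont_wedens.
  have H := lee_scale (_ : 0 <= (rho j ^+ 4)^-1) (HC v vn f T m (rho j) cf (tr j)).
  apply: le_trans (H _) _; first by rewrite invr_ge0 exprn_ge0// ltW.
  rewrite lee_fin le_eqVlt; apply/orP; left; apply/eqP; field; exact: lt0r_neq0.
Qed.

End Functionals.

(** * Second derivatives in the interior *)

Section Elliptic.
Context {R : realType}.
Local Notation field := (@field R).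
Local Notation leb3 := (@leb3 R).
Implicit Types (f h F G Q : field) (t a b rho : R) (x : 'rV[R]_3) (U V : 'rV[R]_3 -> R).

Lemma integrated_div U V Q (Y : 'I_3 -> field) (L t : R) : 0 < t -> 0 <= L ->
  continuous U -> continuous V -> (forall x, 0 <= U x) -> (forall x, 0 <= V x) ->
  Smooth Q -> (forall i, Smooth (Y i)) ->
  (forall x, 0 < Q t x -> forall j, `|x 0 j| <= L) ->
  (forall x, U x <= cut_div 0 Q (Y 0) t x + cut_div 1 Q (Y 1) t x
      + cut_div 2 Q (Y 2) t x + V x) ->
  (I3 U <= I3 V)%E.
Proof.
move=> t0 L0 cU cV U0 V0 sQ sY supp H.
pose D i := cut_div i Q (Y i).
have cD i : Cont (D i) by apply: Cont_cut_div.
have cp i : continuous (fun x => pos (D i t x)) := Cont_space (Cont_pos (cD i)) t0.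
have cn i : continuous (fun x => pos (- D i t x)) := Cont_space (Cont_pos (ContN (cD i))) t0.
have cp2 := Cont_space (ContD (Cont_pos (cD 0)) (Cont_pos (cD 1))) t0.
have cn2 := Cont_space (ContD (Cont_pos (ContN (cD 0))) (Cont_pos (ContN (cD 1)))) t0.
pose P x := pos (D 0 t x) + pos (D 1 t x) + pos (D 2 t x).
pose N x := pos (- D 0 t x) + pos (- D 1 t x) + pos (- D 2 t x).
have cP : continuous P by move=> x; exact: (cvgD (cp2 x) (cp 2 x)).
have cN : continuous N by move=> x; exact: (cvgD (cn2 x) (cn 2 x)).
have P0 x : 0 <= P x by rewrite /P !addr_ge0 ?pos_ge0.
have N0 x : 0 <= N x by rewrite /N !addr_ge0 ?pos_ge0.
have E i := cut_div_balance i t0 sQ (sY i) supp.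
have F i := cut_div_finite i t0 L0 sQ (sY i) supp.
have EP : I3 P = (I3 (fun x => (pos (D 0 t x))%R) + I3 (fun x => (pos (D 1 t x))%R) + I3 (fun x => (pos (D 2 t x))%R))%E.
  by rewrite /P !I3D//;
    first [exact: cp2|exact: cp|move=> x; rewrite ?addr_ge0 ?pos_ge0].
have EN : I3 N = (I3 (fun x => (pos (- D 0 t x))%R) + I3 (fun x => (pos (- D 1 t x))%R) + I3 (fun x => (pos (- D 2 t x))%R))%E.
  by rewrite /N !I3D//;
    first [exact: cn2|exact: cn|move=> x; rewrite ?addr_ge0 ?pos_ge0].
apply: (@le_integral_balanced _ _ R leb3 (fun y => (U (vec3 y))%:E) (fun y => (V (vec3 y))%:E)
  (fun y => (P (vec3 y))%:E) (fun y => (N (vec3 y))%:E) (measurable_vec3 cU)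
  (measurable_vec3 cV) (measurable_vec3 cP) (measurable_vec3 cN)).
- by move=> y; rewrite lee_fin.
- by move=> y; rewrite lee_fin.
- by move=> y; rewrite lee_fin.
- by move=> y; rewrite lee_fin.
- move=> y; rewrite -!EFinD lee_fin; have := H (vec3 y).
  by rewrite (posB (cut_div 0 _ _ _ _)) (posB (cut_div 1 _ _ _ _)) (posB (cut_div 2 _ _ _ _)) /P /N /D; lra.
- by rewrite -/(I3 P) -/(I3 N) EP EN !E.
- by rewrite -/(I3 P) EP; apply: lte_add_pinfty; [apply: lte_add_pinfty|]; exact: F.
Qed.

Definition ballf rho : field := fun t x =>
  rho * rho - (x 0 0 * x 0 0 + x 0 1 * x 0 1 + x 0 2 * x 0 2).

Lemma jet_ballf rho : jet (ballf rho) (fun _ _ => 0) (fun i t x => - 2 * x 0 i).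
Proof.
rewrite /ballf; refine (jet_congr (_ : jet _ _ _) _ _); first by jet_tac.
- by move=> t x t0 /=; atomize; ring.
- by apply: ord3P => t x t0 /=; atomize; ring.
Qed.

Definition lap h : field := fun t x =>
  Dx 0 (Dx 0 h) t x + Dx 1 (Dx 1 h) t x + Dx 2 (Dx 2 h) t x.

Definition grad2 h : field := fun t x =>
  Dx 0 h t x ^+ 2 + Dx 1 h t x ^+ 2 + Dx 2 h t x ^+ 2.

Definition hess2 h : field := fun t x =>
  grad2 (Dx 0 h) t x + grad2 (Dx 1 h) t x + grad2 (Dx 2 h) t x.

Lemma grad2_ge0 h t x : 0 <= grad2 h t x.
Proof. by rewrite /grad2 !addr_ge0 ?sqr_ge0. Qed.

Lemma hess2_ge0 h t x : 0 <= hess2 h t x.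
Proof. by apply: addr_ge0; [apply: addr_ge0|]; exact: grad2_ge0. Qed.

(* Its divergence is [hess2 h - lap h ^+ 2]. *)
Definition hess_flux h (j : 'I_3) : field := fun t x =>
  Dx 0 h t x * Dx 0 (Dx j h) t x + Dx 1 h t x * Dx 1 (Dx j h) t x
  + Dx 2 h t x * Dx 2 (Dx j h) t x
  - Dx j h t x * (Dx 0 (Dx 0 h) t x + Dx 1 (Dx 1 h) t x + Dx 2 (Dx 2 h) t x).

Lemma smooth_lap h : Smooth h -> Smooth (lap h).
Proof. by move=> sf; refine (let: And3 s _ _ := (_ : jet (lap h) _ _) in s); rewrite /lap; jet_tac. Qed.

Lemma Dx_hess_flux h j : Smooth h -> Smooth (hess_flux h j) /\
  eq_pos (Dx j (hess_flux h j)) (fun t x =>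
  (Dx j (Dx 0 h) t x * Dx 0 (Dx j h) t x + Dx j (Dx 1 h) t x * Dx 1 (Dx j h) t x
    + Dx j (Dx 2 h) t x * Dx 2 (Dx j h) t x - Dx j (Dx j h) t x * lap h t x)
  + (Dx 0 h t x * Dx 0 (Dx j (Dx j h)) t x + Dx 1 h t x * Dx 1 (Dx j (Dx j h)) t x
    + Dx 2 h t x * Dx 2 (Dx j (Dx j h)) t x)
  - Dx j h t x * (Dx j (Dx 0 (Dx 0 h)) t x + Dx j (Dx 1 (Dx 1 h)) t x + Dx j (Dx 2 (Dx 2 h)) t x)).
Proof.
move=> sf; refine (let: And3 s _ s2 := (_ : jet (hess_flux h j) _ _) in _).
  by rewrite /hess_flux; jet_tac.
split => // t x t0; rewrite s2//= /lap.
have sj : Smooth (Dx j h) by exact: smooth_Dx.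
rewrite (Dx_Dx j 0 sj)// (Dx_Dx j 1 sj)// (Dx_Dx j 2 sj)//.
by move: {s s2} (Dx j) => dj; atomize; ring.
Qed.

(** The difference of the two sides is the exact sum of the nonnegative terms [H1] to [H4]. [H2]
    completes squares between Hessian entries and the gradient of the cut-off, which uses up half of
    the Hessian; [H4] is Lagrange's remainder in Cauchy-Schwarz. *)
Lemma hessian_bound (q r2 x0 x1 x2 h0 h1 h2 a00 a11 a22 a01 a02 a12 : R) :
  x0 * x0 + x1 * x1 + x2 * x2 <= r2 ->
  let L := a00 + a11 + a22 in
  2^-1 * (q ^+ 2 * (a00 ^+ 2 + a11 ^+ 2 + a22 ^+ 2 + 2 * a01 ^+ 2 + 2 * a02 ^+ 2 + 2 * a12 ^+ 2)) <=
  (q ^+ 2 * (a00 ^+ 2 + a11 ^+ 2 + a22 ^+ 2 + 2 * a01 ^+ 2 + 2 * a02 ^+ 2 + 2 * a12 ^+ 2)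
   - q ^+ 2 * L ^+ 2
   - 4 * q * (x0 * (h0 * a00 + h1 * a01 + h2 * a02 - h0 * L)
     + x1 * (h0 * a01 + h1 * a11 + h2 * a12 - h1 * L)
     + x2 * (h0 * a02 + h1 * a12 + h2 * a22 - h2 * L)))
  + (2 * (q ^+ 2 * L ^+ 2) + 12 * r2 * (h0 ^+ 2 + h1 ^+ 2 + h2 ^+ 2)).
Proof.
move=> r2x /=; set L := a00 + a11 + a22; rewrite -subr_ge0.
pose g := h0 ^+ 2 + h1 ^+ 2 + h2 ^+ 2.
have g0 : 0 <= g by rewrite !addr_ge0 ?sqr_ge0.
have H1 : 0 <= 12 * (r2 - (x0 * x0 + x1 * x1 + x2 * x2)) * g.
  by rewrite !mulr_ge0// subr_ge0.
have H2 : 0 <= 2^-1 * ((q * a00 - 4 * x0 * h0) ^+ 2 + (q * a11 - 4 * x1 * h1) ^+ 2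
   + (q * a22 - 4 * x2 * h2) ^+ 2 + (q * a01 - 4 * x0 * h1) ^+ 2 + (q * a01 - 4 * x1 * h0) ^+ 2
   + (q * a02 - 4 * x0 * h2) ^+ 2 + (q * a02 - 4 * x2 * h0) ^+ 2
   + (q * a12 - 4 * x1 * h2) ^+ 2 + (q * a12 - 4 * x2 * h1) ^+ 2).
  by rewrite mulr_ge0 ?invr_ge0// !addr_ge0 ?sqr_ge0.
have H3 : 0 <= (q * L + 2 * (x0 * h0 + x1 * h1 + x2 * h2)) ^+ 2 by exact: sqr_ge0.
have H4 : 0 <= 4 * ((x0 * h1 - x1 * h0) ^+ 2 + (x0 * h2 - x2 * h0) ^+ 2 + (x1 * h2 - x2 * h1) ^+ 2).
  by rewrite mulr_ge0// !addr_ge0 ?sqr_ge0.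
apply: (le_trans (addr_ge0 (addr_ge0 H1 H2) (addr_ge0 H3 H4))).
by rewrite le_eqVlt; apply/orP; left; apply/eqP; rewrite /g /L; field.
Qed.

Lemma elliptic_pointwise h rho t x : Smooth h -> 0 < t ->
  2^-1 * (pos (ballf rho t x) ^+ 2 * hess2 h t x) <=
  cut_div 0 (ballf rho) (hess_flux h 0) t x + cut_div 1 (ballf rho) (hess_flux h 1) t x
  + cut_div 2 (ballf rho) (hess_flux h 2) t x
  + (2 * (pos (ballf rho t x) ^+ 2 * lap h t x ^+ 2) + 12 * (rho * rho) * grad2 h t x).
Proof.
move=> sf t0.
have [_ _ cX] := jet_ballf rho.
have g0 : 0 <= 12 * (rho * rho) * grad2 h t x.
  by rewrite mulr_ge0 ?grad2_ge0// mulr_ge0// -expr2 sqr_ge0.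
have [Q0|Q0] := ltP 0 (ballf rho t x); last first.
  by rewrite /cut_div /pos (max_l Q0) expr0n /= !(mulr0, mul0r, addr0, add0r).
rewrite /cut_div !cX//.
have [_ E0] := Dx_hess_flux 0 sf; have [_ E1] := Dx_hess_flux 1 sf.
have [_ E2] := Dx_hess_flux 2 sf; rewrite E0// E1// E2// {E0 E1 E2}.
rewrite /hess_flux /hess2 /grad2 /lap.
rewrite (Dx_Dx 1 0 sf)// (Dx_Dx 2 0 sf)// (Dx_Dx 2 1 sf)//.
have r2 : x 0 0 * x 0 0 + x 0 1 * x 0 1 + x 0 2 * x 0 2 <= rho * rho.
  by move: Q0; rewrite /ballf subr_gt0 => /ltW.
have := hessian_bound (pos (ballf rho t x)) (Dx 0 h t x) (Dx 1 h t x) (Dx 2 h t x)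
  (Dx 0 (Dx 0 h) t x) (Dx 1 (Dx 1 h) t x) (Dx 2 (Dx 2 h) t x) (Dx 0 (Dx 1 h) t x)
  (Dx 0 (Dx 2 h) t x) (Dx 1 (Dx 2 h) t x) r2.
move: {Q0 g0 cX r2} (pos _) (rho * rho) => q r.
cbv zeta; atomize => H.
apply: le_trans (le_trans H _).
  by rewrite le_eqVlt; apply/orP; left; apply/eqP; ring.
by rewrite le_eqVlt; apply/orP; left; apply/eqP; ring.
Qed.

Lemma ballf_supp rho t x : 0 <= rho -> 0 < ballf rho t x -> forall j, `|x 0 j| <= rho.
Proof.
move=> r0; rewrite /ballf subr_gt0 -expr2 => H.
have K a : a * a <= rho ^+ 2 -> `|a| <= rho.
  by rewrite -expr2 -(real_normK (num_real a)) ler_sqr ?nnegrE.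
by apply: ord3P; apply: K; move: H; move: (x 0 0) (x 0 1) (x 0 2) => a b c; nra.
Qed.

(** Two integrations by parts exchange the Hessian for the Laplacian, the flux being [hess_flux];
    the terms where the cut-off is differentiated cost only first derivatives. *)
Lemma elliptic h rho t : Smooth h -> 0 < t -> 0 <= rho ->
  (I3 (fun x => (2^-1 * (pos (ballf rho t x) ^+ 2 * hess2 h t x))%R) <=
   I3 (fun x => (2 * (pos (ballf rho t x) ^+ 2 * lap h t x ^+ 2)
      + 12 * (rho * rho) * grad2 h t x)%R))%E.
Proof.
move=> sf t0 r0; have sb : Smooth (ballf rho) by case: (jet_ballf rho).
have sl := smooth_lap sf.
apply: (@integrated_div _ _ (ballf rho) (hess_flux h) rho t t0 r0).
- apply: (Cont_space (F := fun t x => 2^-1 * (pos (ballf rho t x) ^+ 2 * hess2 h t x)) _ t0).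
  by rewrite /hess2 /grad2; cont_tac.
- apply: (Cont_space (F := fun t x => 2 * (pos (ballf rho t x) ^+ 2 * lap h t x ^+ 2)
      + 12 * (rho * rho) * grad2 h t x) _ t0).
  by rewrite /grad2; cont_tac.
- by move=> x; rewrite mulr_ge0 ?invr_ge0// mulr_ge0 ?sqr_ge0 ?hess2_ge0.
- move=> x; apply: addr_ge0; apply: mulr_ge0 => //; rewrite ?grad2_ge0//.
    by rewrite mulr_ge0 ?sqr_ge0.
  by rewrite mulr_ge0// -expr2 sqr_ge0.
- exact: sb.
- by move=> i; have [] := Dx_hess_flux i sf.
- by move=> x; exact: ballf_supp.
- by move=> x; exact: elliptic_pointwise.
Qed.

End Elliptic.

(** * The Klainerman-Sideris identity *)

Section Conformal.
Context {R : realType} (p : R).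
Hypothesis p01 : 0 < p < 1.
Local Notation field := (@field R).
Local Notation Dtau := (Dtau p).
Local Notation Scal := (Scal p).
Local Notation Box := (Box p).
Implicit Types (f h : field) (t a b : R) (x : 'rV[R]_3).

Let p1 : 1 - p != 0. Proof. by case/andP: p01 => _ ?; rewrite subr_eq0 gt_eqF. Qed.

Lemma tau_gt0 t : 0 < t -> 0 < tau p t.
Proof. by move=> t0; case/andP: p01 => _ ?; rewrite divr_gt0 ?powR_gt0// subr_gt0. Qed.

(** Add three identities: $\sum\Omega_{ij}^2=r^2\Delta-(r\partial_r)^2-r\partial_r$;
    $\tau\partial_\tau S-r\partial_rS=\tau^2\partial_\tau^2+\tau\partial_\tau-(r\partial_r)^2$; and
    $\Delta=t^{2p}\square+\partial_\tau^2+\frac{2p}{(1-p)\tau}\partial_\tau$. For the verification,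
    [t] is eliminated in favour of $\tau$ and $t^p$. *)
Lemma Klainerman_Sideris f t x : Smooth f -> 0 < t ->
  (tau p t ^+ 2 - (x 0 0 * x 0 0 + x 0 1 * x 0 1 + x 0 2 * x 0 2)) * lap f t x =
  tau p t * Dtau (Scal f) t x + (2 * p / (1 - p) - 1) * (tau p t * Dtau f t x)
  - (x 0 0 * Dx 0 (Scal f) t x + x 0 1 * Dx 1 (Scal f) t x + x 0 2 * Dx 2 (Scal f) t x)
  - (x 0 0 * Dx 0 f t x + x 0 1 * Dx 1 f t x + x 0 2 * Dx 2 f t x)
  - (Rot 0 1 (Rot 0 1 f) t x + Rot 0 2 (Rot 0 2 f) t x + Rot 1 2 (Rot 1 2 f) t x)
  + tau p t * (tau p t * (t `^ p) ^+ 2 * Box f t x).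
Proof.
move=> sf t0.
have tA := tau_powR p t0.
have A0 : t `^ p != 0 by rewrite gt_eqF// powR_gt0.
have T0 : tau p t != 0 by rewrite gt_eqF// tau_gt0.
have tE : t = tau p t * t `^ p * (1 - p) by rewrite tA; field.
have [_ S0 S1] := jet_Scal p sf.
rewrite (RotE 0 1 (Rot 0 1 f)) (RotE 0 2 (Rot 0 2 f)) (RotE 1 2 (Rot 1 2 f)).
have [_ _ r01] := jet_Rot 0 1 sf; have [_ _ r02] := jet_Rot 0 2 sf.
have [_ _ r12] := jet_Rot 1 2 sf.
rewrite !r01// !r02// !r12// !S1// (DtauE p (Scal f)) S0// DtauE {r01 r02 r12 S0 S1}.
rewrite /Box powR2p /lap.
rewrite (Dx_Dx 1 0 sf)// (Dx_Dx 2 0 sf)// (Dx_Dx 2 1 sf)//.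
rewrite (Dx_Dt 0 sf)// (Dx_Dt 1 sf)// (Dx_Dt 2 sf)//.
rewrite /= ?mul0r ?mul1r ?add0r ?addr0.
have E1 : (1 - p)^-1 * t = tau p t * t `^ p by rewrite {1}tE; field.
have E2 : 3 * p / t = 3 * p / (tau p t * t `^ p * (1 - p)) by rewrite -tE.
rewrite E2 {E2}.
move: (tau p t) (t `^ p) {tA} A0 T0 tE E1 => T A A0 T0 tE E1.
atomize; rewrite tE; field.
by rewrite p1 A0 T0.
Qed.

(* [|Omega g| <= r |grad g|] and [|x . grad g| <= r |grad g|] *)
Lemma rot_sqr_le (x0 x1 x2 a b c : R) (r2 : R) : x0 * x0 + x1 * x1 + x2 * x2 <= r2 ->
  [/\ (x0 * a + x1 * b + x2 * c) ^+ 2 <= r2 * (a ^+ 2 + b ^+ 2 + c ^+ 2),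
   (x0 * b - x1 * a) ^+ 2 <= r2 * (a ^+ 2 + b ^+ 2 + c ^+ 2),
   (x0 * c - x2 * a) ^+ 2 <= r2 * (a ^+ 2 + b ^+ 2 + c ^+ 2) &
   (x1 * c - x2 * b) ^+ 2 <= r2 * (a ^+ 2 + b ^+ 2 + c ^+ 2)].
Proof.
move=> h; have g0 : 0 <= a ^+ 2 + b ^+ 2 + c ^+ 2 by rewrite !addr_ge0 ?sqr_ge0.
have H := ler_wpM2r g0 h.
have E : (x0 * x0 + x1 * x1 + x2 * x2) * (a ^+ 2 + b ^+ 2 + c ^+ 2) =
  (x0 * a + x1 * b + x2 * c) ^+ 2 + (x0 * b - x1 * a) ^+ 2 + (x0 * c - x2 * a) ^+ 2
  + (x1 * c - x2 * b) ^+ 2 by ring.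
rewrite E in H.
have s1 := sqr_ge0 (x0 * a + x1 * b + x2 * c); have s2 := sqr_ge0 (x0 * b - x1 * a).
have s3 := sqr_ge0 (x0 * c - x2 * a); have s4 := sqr_ge0 (x1 * c - x2 * b).
by split; lra.
Qed.

Lemma sqr_sum8 (a b c d e f g h : R) : (a + b - c - d - (e + f + g) + h) ^+ 2 <=
  8 * (a ^+ 2 + b ^+ 2 + c ^+ 2 + d ^+ 2 + e ^+ 2 + f ^+ 2 + g ^+ 2 + h ^+ 2).
Proof.
have := sqr_sum_le [:: a; b; - c; - d; - e; - f; - g; h] id.
rewrite !big_cons !big_nil /= !sqrrN !addr0.
set l := (X in X ^+ 2 <= _ -> _); set r := (X in _ -> X ^+ 2 <= _).
by have -> : l = r; [rewrite /l /r; ring|lra].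
Qed.

(* The sum of energy densities controlling [tau * Lap f] where [r <= tau / 2]. *)
Definition KS_density f : field := fun t x =>
  edens p (Scal f) t x + edens p f t x + edens p (Rot 0 1 f) t x
  + edens p (Rot 0 2 f) t x + edens p (Rot 1 2 f) t x
  + (tau p t * (t `^ p) ^+ 2 * Box f t x) ^+ 2.

Lemma lap_bound f t x : Smooth f -> 0 < t ->
  pos (ballf (tau p t / 2) t x) ^+ 2 * lap f t x ^+ 2 <=
  (1 + (2 * p / (1 - p) - 1) ^+ 2) * tau p t ^+ 2 * KS_density f t x.
Proof.
move=> sf t0.
have T0 := tau_gt0 t0.
have KS := Klainerman_Sideris x sf t0.
have e0 g : 0 <= edens p g t x by exact: edens_ge0.
set b := 2 * p / (1 - p) - 1 in KS *.
have D0 : 0 <= KS_density f t x by rewrite /KS_density !addr_ge0 ?sqr_ge0.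
have [Q0|Q0] := ltP 0 (ballf (tau p t / 2) t x); last first.
  rewrite {1}/pos (max_l Q0) expr0n mul0r mulr_ge0// mulr_ge0 ?sqr_ge0//.
  by rewrite addr_ge0 ?sqr_ge0.
rewrite {1}/pos (max_r (ltW Q0)).
set T := tau p t in T0 KS Q0 *.
have r2 : x 0 0 * x 0 0 + x 0 1 * x 0 1 + x 0 2 * x 0 2 <= T ^+ 2 / 4.
  by move: Q0; rewrite /ballf subr_gt0 => /ltW; rewrite -/T; lra.
have r2' : x 0 0 * x 0 0 + x 0 1 * x 0 1 + x 0 2 * x 0 2 <= T ^+ 2.
  by apply: le_trans r2 _; have := sqr_ge0 T; lra.
have Q1 : ballf (T / 2) t x <= T ^+ 2 / 4.
  rewrite /ballf lerBlDr (_ : T / 2 * (T / 2) = T ^+ 2 / 4); last by field.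
  by rewrite lerDl !addr_ge0// -expr2 sqr_ge0.
have Q1' : ballf (T / 2) t x ^+ 2 <= (T ^+ 2 / 4) ^+ 2.
  by rewrite ler_sqr ?nnegrE ?divr_ge0 ?sqr_ge0// ltW.
have [B1 _ _ _] := rot_sqr_le (Dx 0 (Scal f) t x) (Dx 1 (Scal f) t x) (Dx 2 (Scal f) t x) r2'.
have [B2 _ _ _] := rot_sqr_le (Dx 0 f t x) (Dx 1 f t x) (Dx 2 f t x) r2'.
have [_ B3 _ _] := rot_sqr_le (Dx 0 (Rot 0 1 f) t x) (Dx 1 (Rot 0 1 f) t x) (Dx 2 (Rot 0 1 f) t x) r2'.
have [_ _ B4 _] := rot_sqr_le (Dx 0 (Rot 0 2 f) t x) (Dx 1 (Rot 0 2 f) t x) (Dx 2 (Rot 0 2 f) t x) r2'.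
have [_ _ _ B5] := rot_sqr_le (Dx 0 (Rot 1 2 f) t x) (Dx 1 (Rot 1 2 f) t x) (Dx 2 (Rot 1 2 f) t x) r2'.
rewrite -!RotE in B3 B4 B5; rewrite -!/(grad2 _ t x) in B1 B2 B3 B4 B5.
have eE g : edens p g t x = Dtau g t x ^+ 2 + grad2 g t x.
  by rewrite /edens /grad2 DtauE !expr2.
have gg g := grad2_ge0 g t x.
have X := sqr_sum8 (T * Dtau (Scal f) t x) (b * (T * Dtau f t x))
  (x 0 0 * Dx 0 (Scal f) t x + x 0 1 * Dx 1 (Scal f) t x + x 0 2 * Dx 2 (Scal f) t x)
  (x 0 0 * Dx 0 f t x + x 0 1 * Dx 1 f t x + x 0 2 * Dx 2 f t x)
  (Rot 0 1 (Rot 0 1 f) t x) (Rot 0 2 (Rot 0 2 f) t x) (Rot 1 2 (Rot 1 2 f) t x)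
  (T * (T * t `^ p ^+ 2 * Box f t x)).
rewrite -KS in X.
have HX : ((T ^+ 2 - (x 0 0 * x 0 0 + x 0 1 * x 0 1 + x 0 2 * x 0 2)) * lap f t x) ^+ 2
   <= 8 * ((1 + b ^+ 2) * T ^+ 2 * KS_density f t x).
  apply: (le_trans X); apply: ler_wpM2l => //.
  have M (u v : R) : (u * v) ^+ 2 = u ^+ 2 * v ^+ 2 by exact: exprMn.
  rewrite !(M T) (M b) (M T).
  apply: (@le_trans _ _ (T ^+ 2 * (Dtau (Scal f) t x ^+ 2 + b ^+ 2 * Dtau f t x ^+ 2
    + grad2 (Scal f) t x + grad2 f t x + grad2 (Rot 0 1 f) t x + grad2 (Rot 0 2 f) t x
    + grad2 (Rot 1 2 f) t x + (T * t `^ p ^+ 2 * Box f t x) ^+ 2))).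
    by move: B1 B2 B3 B4 B5; rewrite !mulrDr (mulrCA (T ^+ 2)); lra.
  rewrite (mulrC (1 + b ^+ 2)) -[leRHS]mulrA; apply: ler_wpM2l; first exact: sqr_ge0.
  rewrite mulrDl mul1r.
  have : b ^+ 2 * Dtau f t x ^+ 2 <= b ^+ 2 * KS_density f t x.
    apply: ler_wpM2l; first exact: sqr_ge0.
    rewrite /KS_density -/T; have := e0 (Scal f); have := e0 (Rot 0 1 f).
    have := e0 (Rot 0 2 f); have := e0 (Rot 1 2 f).
    have := eE f; have := gg f.
    by have := sqr_ge0 (T * t `^ p ^+ 2 * Box f t x); lra.
  rewrite {2}/KS_density !eE -/T.
  have := gg (Rot 0 1 f); have := gg (Rot 0 2 f); have := gg (Rot 1 2 f).
  have := sqr_ge0 (Dtau f t x); have := sqr_ge0 (Dtau (Rot 0 1 f) t x).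
  have := sqr_ge0 (Dtau (Rot 0 2 f) t x); have := sqr_ge0 (Dtau (Rot 1 2 f) t x).
  lra.
have HD : (3 / 4 * T ^+ 2) ^+ 2 * lap f t x ^+ 2 <=
   8 * ((1 + b ^+ 2) * T ^+ 2 * KS_density f t x).
  apply: le_trans HX; rewrite [leRHS]exprMn; apply: ler_wpM2r; first exact: sqr_ge0.
  have T2 := sqr_ge0 T.
  have h1 : 0 <= 3 / 4 * T ^+ 2 by lra.
  have h2 : 3 / 4 * T ^+ 2 <= T ^+ 2 - (x 0 0 * x 0 0 + x 0 1 * x 0 1 + x 0 2 * x 0 2) by lra.
  by rewrite ler_sqr ?nnegrE ?(le_trans h1).
apply: (@le_trans _ _ ((T ^+ 2 / 4) ^+ 2 * lap f t x ^+ 2)).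
  by apply: ler_wpM2r; first exact: sqr_ge0.
(* The cut-off is at most $\tau^2/4$ and $\tau^2-r^2$ at least $3\tau^2/4$; the squared ratio $1/9$
   compensates the factor 8 from the sum of eight terms. *)
have -> : (T ^+ 2 / 4) ^+ 2 * lap f t x ^+ 2 = 9^-1 * ((3 / 4 * T ^+ 2) ^+ 2 * lap f t x ^+ 2) by field.
move: HD; set y := _ * KS_density f t x; set z := (3 / 4 * _) ^+ 2 * _ => HD.
have y0 : 0 <= y by rewrite /y mulr_ge0// mulr_ge0 ?sqr_ge0// addr_ge0 ?sqr_ge0.
by lra.
Qed.

End Conformal.

(** * Weighted second derivatives in the mean *)

Section InteriorSecond.
Context {R : realType} (p t0 : R).
Hypothesis p01 : 0 < p < 1.
Hypothesis t00 : 0 < t0.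
Local Notation field := (@field R).
Local Notation word := (word p).
Local Notation controlled := (controlled p t0).
Implicit Types (f h : field) (t a b T m : R) (x : 'rV[R]_3) (v w : seq 'I_8).

Lemma derivative_word n : exists2 C : R, 0 <= C & forall (g : 'I_8) v f T m, (g <= 3)%N ->
  (size v <= n)%N -> controlled n f T m ->
  (I3 (fun x => word (g :: v) f T x ^+ 2)%R <= (C * m)%:E)%E.
Proof.
have [C C0 HC] := energy_word p01 t00 n.
exists C => // g v f T m g3 vn cf; apply: le_trans (HC v f T m vn cf).
apply: le_I3 => x; first exact: sqr_ge0.
rewrite /edens /= /gen; case: g g3 => [[|[|[|[|//]]]] hg] _ /=; rewrite -!expr2 ?DtauE;
  [have := sqr_ge0 (Dx 0 (word v f) T x); have := sqr_ge0 (Dx 1 (word v f) T x); have := sqr_ge0 (Dx 2 (word v f) T x)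
  |have := sqr_ge0 (T `^ p * Dt (word v f) T x); have := sqr_ge0 (Dx 1 (word v f) T x); have := sqr_ge0 (Dx 2 (word v f) T x)
  |have := sqr_ge0 (T `^ p * Dt (word v f) T x); have := sqr_ge0 (Dx 0 (word v f) T x); have := sqr_ge0 (Dx 2 (word v f) T x)
  |have := sqr_ge0 (T `^ p * Dt (word v f) T x); have := sqr_ge0 (Dx 0 (word v f) T x); have := sqr_ge0 (Dx 1 (word v f) T x)];
  lra.
Qed.

(** On one slice the factor $T^{p+1}$ cancels the decay $T^{-(1+p)}$ of the commutation errors,
    which are then derivatives of words, bounded by the energy. *)
Lemma Box_word_slice n v : (3 <= n)%N -> (size v <= n - 3)%N -> exists2 C : R, 0 <= C &
  forall f T m, controlled n f T m ->
  (I3 (fun x => (T `^ (p + 1) * Box p (word v f) T x) ^+ 2)%R <= (C * m)%:E)%E.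
Proof.
move=> n3 vn.
have [T1 [T2 [HT1 HT2 E]]] := Box_word p01 v.
have [K1 K10 HK1] := quad_tspan t00 HT1 (fun a u (h : box_source (size v) a u) => h.1).
have [K2 K20 HK2] := quad_tspan t00 HT2 (fun a u (h : box_error p (size v) a u) => h.1).
have [C C0 HC] := derivative_word n.
exists (2 * (K1 + K2 * C)); first by rewrite mulr_ge0// addr_ge0// mulr_ge0.
move=> f T m cf; have [sf tT m0 [H1 H2 H3]] := cf.
have T0 : 0 < T := lt_trans t00 tT.
have sB : Smooth (Box p f) by exact: smooth_Box.
have PN := pos_functional_I3 t00 (ltW tT); have [ND NZ NL] := PN.
pose om : field := fun t x => (t `^ (p + 1)) ^+ 2.
have com : Cont om by rewrite /om; cont_tac.
have om0 : ge0_field om by move=> t x t1; exact: sqr_ge0.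
have b1 : (I3 (fun x => om T x * T1 (Box p f) T x ^+ 2)%R <= (K1 * m)%:E)%E.
  apply: (HK1 T _ om (Box p f) _ PN sB com om0 m0) => a u [_ su].
  apply: le_trans _ (H3 u (leq_trans su vn)); apply: le_I3 => x.
    by rewrite mulr_ge0 ?sqr_ge0.
  by rewrite oppr0 powRr0 mul1r /om exprMn.
have b2 : (I3 (fun x => om T x * T2 f T x ^+ 2)%R <= (K2 * (C * m))%:E)%E.
  apply: (HK2 T _ om f _ PN sf com om0); first exact: mulr_ge0.
  move=> a u' [_ [u -> su]].
  have un : (size u <= n)%N by rewrite (leq_trans (ltnW su))// (leq_trans vn)// leq_subr.
  apply: le_trans _ (HC 0 u f T m isT un cf); apply: le_I3 => x.
    by rewrite mulr_ge0 ?sqr_ge0.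
  rewrite /om -exprMn mulrA -powRD ?(gt_eqF T0) ?implybT//.
  by rewrite (_ : p + 1 - (1 + p) = 0) ?powRr0 ?mul1r//; ring.
have sT1 := smooth_tspan HT1 sB; have sT2 := smooth_tspan HT2 sf.
have s1 : Cont (fun t x => om t x * T1 (Box p f) t x ^+ 2) by cont_tac.
have s2 : Cont (fun t x => om t x * T2 f t x ^+ 2) by cont_tac.
apply: (@le_trans _ _ (I3 (fun x => 2 * (om T x * T1 (Box p f) T x ^+ 2
    + om T x * T2 f T x ^+ 2))%R)).
  apply: le_I3 => x; first exact: sqr_ge0.
  rewrite E// /om; move: (T `^ _) (T1 _ _ _) (T2 _ _ _) => u X Y; rewrite -subr_ge0.
  have -> : 2 * (u ^+ 2 * X ^+ 2 + u ^+ 2 * Y ^+ 2) - (u * (X + Y)) ^+ 2 = (u * (X - Y)) ^+ 2 by ring.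
  exact: sqr_ge0.
have -> := NZ 2 (fun t x => om t x * T1 (Box p f) t x ^+ 2 + om t x * T2 f t x ^+ 2)
  (ler0n _ 2) (ContD s1 s2) _; last first.
  by move=> t x t1; apply: addr_ge0; apply: mulr_ge0; rewrite ?om0 ?sqr_ge0.
rewrite -mulrA; apply: lee_scale => //.
rewrite (ND _ _ s1 s2); last 2 first.
- by move=> t x t1; rewrite mulr_ge0 ?om0 ?sqr_ge0.
- by move=> t x t1; rewrite mulr_ge0 ?om0 ?sqr_ge0.
by rewrite mulrDl EFinD -mulrA; exact: leeD.
Qed.

Definition chi T : 'rV[R]_3 -> R := fun x => pos (ballf (tau p T / 2) T x) ^+ 2.

Lemma interior_hessian n v : (3 <= n)%N -> (size v <= n - 3)%N -> exists2 C : R, 0 <= C &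
  forall f T m, controlled n f T m ->
  (I3 (fun x => chi T x * hess2 (word v f) T x)%R <= (C * (tau p T ^+ 2 * m))%:E)%E.
Proof.
move=> n3 vn.
have [C1 C10 HC1] := energy_word p01 t00 n.
have [C2 C20 HC2] := Box_word_slice n3 vn.
pose B := 1 + (2 * p / (1 - p) - 1) ^+ 2.
have B0 : 0 <= B by rewrite addr_ge0 ?sqr_ge0.
have p1 : 0 < 1 - p by case/andP: p01 => _; rewrite subr_gt0.
(* [KS_density] has five energy densities and one source term, in which $\tau
   t^{2p}=t^{p+1}/(1-p)$. *)
pose C := 5 * C1 + (1 - p)^-1 ^+ 2 * C2.
have C0 : 0 <= C by rewrite addr_ge0// mulr_ge0 ?sqr_ge0.
exists (2 * (2 * B * C + 3 * C1)).
  by apply: mulr_ge0 => //; apply: addr_ge0; apply: mulr_ge0 => //; apply: mulr_ge0.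
move=> f T m cf; have [sf tT m0 _] := cf.
have T0 : 0 < T := lt_trans t00 tT.
have sv : Smooth (word v f) by exact: smooth_word.
have sg i : Smooth (gen p i (word v f)) by exact: smooth_gen.
have sB : Smooth (Box p (word v f)) by exact: smooth_Box.
have [ND NZ NL] := pos_functional_I3 t00 (ltW tT).
have tau0 : 0 <= tau p T / 2 by rewrite divr_ge0 ?tau_ge0.
have El := elliptic sv T0 tau0.
have sE g : Smooth g -> Cont (edens p g).
  by move=> sg'; exact/Cont_smooth/smooth_edens.
have eE i : (I3 (edens p (gen p i (word v f)) T) <= (C1 * m)%:E)%E.
  apply: (HC1 (i :: v)) => //=; apply: (leq_trans _ (leq_subr 2 n)).
  by rewrite (leq_ltn_trans vn)// ltn_sub2l.
have e0 g : ge0_field (edens p g) by move=> t x _; exact: edens_ge0.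
pose h := word v f.
pose i7 : 'I_8 := Ordinal (isT : (7 < 8)%N); pose i4 : 'I_8 := Ordinal (isT : (4 < 8)%N).
pose i5 : 'I_8 := Ordinal (isT : (5 < 8)%N); pose i6 : 'I_8 := Ordinal (isT : (6 < 8)%N).
pose src : field := fun t x => (tau p t * (t `^ p) ^+ 2 * Box p h t x) ^+ 2.
have ctau : Cont (fun t _ => tau p t).
  by rewrite /tau; cont_tac.
have cs : Cont src by rewrite /src; cont_tac.
have src0 : ge0_field src by move=> t x _; exact: sqr_ge0.
have e5 := (sE _ (sg i7)); have e4 := sE _ sv; have e3 := sE _ (sg i4).
have e2 := sE _ (sg i5); have e1 := sE _ (sg i6).
have D1 := ContD e5 e4; have D2 := ContD D1 e3; have D3 := ContD D2 e2; have D4 := ContD D3 e1.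
have P1 : ge0_field (fun t x => edens p (gen p i7 h) t x + edens p h t x).
  by move=> t x t1; apply: addr_ge0; exact: e0.
have P2 : ge0_field (fun t x => edens p (gen p i7 h) t x + edens p h t x + edens p (gen p i4 h) t x).
  by move=> t x t1; apply: addr_ge0; [exact: P1|exact: e0].
have P3 : ge0_field (fun t x => edens p (gen p i7 h) t x + edens p h t x + edens p (gen p i4 h) t x
    + edens p (gen p i5 h) t x).
  by move=> t x t1; apply: addr_ge0; [exact: P2|exact: e0].
have P4 : ge0_field (fun t x => edens p (gen p i7 h) t x + edens p h t x + edens p (gen p i4 h) t x
    + edens p (gen p i5 h) t x + edens p (gen p i6 h) t x).
  by move=> t x t1; apply: addr_ge0; [exact: P3|exact: e0].
have eh : (I3 (edens p h T) <= (C1 * m)%:E)%E.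
  by apply: (HC1 v) => //; apply: (leq_trans vn); exact: leq_subr.
have E0 : (I3 (src T) <= ((1 - p)^-1 ^+ 2 * (C2 * m))%:E)%E.
  have -> : src T = (fun x => (1 - p)^-1 ^+ 2 * (T `^ (p + 1) * Box p h T x) ^+ 2).
    apply/funext => x; rewrite /src -exprMn; congr (_ ^+ 2); rewrite !mulrA; congr (_ * _).
    rewrite tau_powR// powRD ?(gt_eqF T0) ?implybT// powRr1 ?ltW//.
    by ring.
  have cB : Cont (fun t x => (t `^ (p + 1) * Box p h t x) ^+ 2) by cont_tac.
  have -> := NZ ((1 - p)^-1 ^+ 2) _ (sqr_ge0 _) cB (fun t x _ => sqr_ge0 _).
  by apply: lee_scale; [exact: sqr_ge0|exact: HC2].
have E1 : (I3 (KS_density p h T) <= (C * m)%:E)%E.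
  have -> : KS_density p h = (fun t x => edens p (gen p i7 h) t x + edens p h t x
    + edens p (gen p i4 h) t x + edens p (gen p i5 h) t x + edens p (gen p i6 h) t x + src t x) by [].
  rewrite (ND _ _ D4 cs P4 src0) (ND _ _ D3 e1 P3 (e0 _)) (ND _ _ D2 e2 P2 (e0 _)).
  rewrite (ND _ _ D1 e3 P1 (e0 _)) (ND _ _ e5 e4 (e0 _) (e0 _)).
  rewrite /C mulrDl EFinD; apply: leeD; last by rewrite -mulrA.
  have -> : 5 * C1 * m = C1 * m + C1 * m + C1 * m + C1 * m + C1 * m by ring.
  by rewrite !EFinD; apply: leeD (eE _); apply: leeD (eE _); apply: leeD (eE _);
    apply: leeD (eE _) _.
have cK : Cont (KS_density p h) := ContD D4 cs.
have K0 : ge0_field (KS_density p h).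
  by move=> t x t1; apply: addr_ge0; [exact: P4|exact: src0].
pose w : field := fun t x => 2 * (B * tau p t ^+ 2 * KS_density p h t x)
   + 3 * tau p t ^+ 2 * edens p h t x.
have -> : (fun x => chi T x * hess2 h T x) =
   (fun x => 2 * (2^-1 * (pos (ballf (tau p T / 2) T x) ^+ 2 * hess2 h T x))).
  by apply/funext => x; rewrite mulrA divff ?mul1r.
have ch : Cont (fun t x => 2^-1 * (pos (ballf (tau p T / 2) t x) ^+ 2 * hess2 h t x)).
  have sb : Smooth (ballf (tau p T / 2)) by case: (jet_ballf (tau p T / 2)).
  by rewrite /hess2 /grad2; cont_tac.
have -> := NZ 2 _ (ler0n _ 2) ch _; last first.
  by move=> t x _; rewrite mulr_ge0 ?invr_ge0// mulr_ge0 ?sqr_ge0 ?hess2_ge0.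
rewrite -mulrA; apply: lee_scale => //.
apply: (le_trans El).
apply: (@le_trans _ _ (I3 (fun x => 2 * (B * tau p T ^+ 2 * KS_density p h T x)
   + 3 * tau p T ^+ 2 * edens p h T x)%R)).
  apply: le_I3 => x.
    apply: addr_ge0; apply: mulr_ge0 => //; rewrite ?grad2_ge0//.
      by rewrite mulr_ge0 ?sqr_ge0.
    by rewrite mulr_ge0// -expr2 sqr_ge0.
  apply: lerD; first by apply: ler_wpM2l => //; exact: lap_bound.
  have -> : 12 * (tau p T / 2 * (tau p T / 2)) = 3 * tau p T ^+ 2 by field.
  apply: ler_wpM2l; first by rewrite mulr_ge0 ?sqr_ge0.
  rewrite /edens /grad2 -!expr2 lerDr; exact: sqr_ge0.
have c1 : Cont (fun t x => 2 * B * tau p T ^+ 2 * KS_density p h t x) by cont_tac.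
have c2 : Cont (fun t x => 3 * tau p T ^+ 2 * edens p h t x) by cont_tac.
have n1 : 0 <= 2 * B * tau p T ^+ 2 by rewrite mulr_ge0 ?sqr_ge0// mulr_ge0.
have n2 : 0 <= 3 * tau p T ^+ 2 by rewrite mulr_ge0 ?sqr_ge0.
have -> : (fun x => 2 * (B * tau p T ^+ 2 * KS_density p h T x) + 3 * tau p T ^+ 2 * edens p h T x)
  = (fun x => 2 * B * tau p T ^+ 2 * KS_density p h T x + 3 * tau p T ^+ 2 * edens p h T x).
  by apply/funext => x; rewrite !mulrA.
rewrite (ND _ _ c1 c2); last 2 first.
- by move=> t x t1; rewrite mulr_ge0 ?K0.
- by move=> t x t1; rewrite mulr_ge0 ?e0.
rewrite (NZ _ _ n1 cK K0) (NZ _ _ n2 e4 (e0 _)).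
apply: le_trans (leeD (lee_scale n1 E1) (lee_scale n2 eh)) _.
rewrite -EFinD lee_fin le_eqVlt; apply/orP; left; apply/eqP; ring.
Qed.

Lemma chi_ge0 T x : 0 <= chi T x. Proof. exact: sqr_ge0. Qed.

Lemma chi_le T x : chi T x <= (tau p T ^+ 2 / 4) ^+ 2.
Proof.
rewrite /chi ler_sqr ?nnegrE ?pos_ge0 ?divr_ge0 ?sqr_ge0//.
rewrite /pos ge_max divr_ge0 ?sqr_ge0//= /ballf lerBlDr.
rewrite (_ : tau p T / 2 * (tau p T / 2) = tau p T ^+ 2 / 4); last by field.
by rewrite lerDl !addr_ge0// -expr2 sqr_ge0.
Qed.

(** Mixed derivatives reduce to spatial ones through the scaling field: $\tau\partial_i\partial_\tau
    f=\partial_iSf-\partial_if-x\cdot\nabla\partial_if$, and $|x|\le\tau/2$ on the support of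
    [chi]. *)
Lemma Dtau_grad f t x : Smooth f -> 0 < t ->
  chi t x * grad2 (Dtau p f) t x <=
  3 * (chi t x * hess2 f t x) + tau p t ^+ 2 * (edens p (Scal p f) t x + edens p f t x).
Proof.
move=> sf t1; have T0 := tau_gt0 p01 t1; set T := tau p t in T0 *.
have e0 h := edens_ge0 p h t x.
have R0 : 0 <= T ^+ 2 * (edens p (Scal p f) t x + edens p f t x).
  by rewrite mulr_ge0 ?sqr_ge0// addr_ge0.
have [Q0|Q0] := ltP 0 (ballf (T / 2) t x); last first.
  by rewrite /chi -/T /pos (max_l Q0) expr0n /= !mul0r mulr0 add0r.
have r2 : x 0 0 * x 0 0 + x 0 1 * x 0 1 + x 0 2 * x 0 2 <= T ^+ 2 / 4.
  by move: Q0; rewrite /ballf subr_gt0 => /ltW; lra.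
have c0 := chi_ge0 t x.
have cT : chi t x <= T ^+ 4 / 16 by apply: le_trans (chi_le t x) _; rewrite -/T; lra.
have [_ _ D1] := jet_Dtau p sf; have [_ _ S1] := jet_Scal p sf.
have E i : T * Dx i (Dtau p f) t x = Dx i (Scal p f) t x - Dx i f t x
   - (x 0 0 * Dx 0 (Dx i f) t x + x 0 1 * Dx 1 (Dx i f) t x + x 0 2 * Dx 2 (Dx i f) t x).
  rewrite D1// S1// (Dx_Dt i sf)// mulrA tau_powR//.
  rewrite (Dx_Dx 0 i sf)// (Dx_Dx 1 i sf)// (Dx_Dx 2 i sf)//.
  by move: i {D1 S1}; apply: ord3P => /=; atomize; ring.
have B i : T ^+ 2 * Dx i (Dtau p f) t x ^+ 2 <= 3 * (Dx i (Scal p f) t x ^+ 2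
   + Dx i f t x ^+ 2 + T ^+ 2 / 4 * grad2 (Dx i f) t x).
  have [X _ _ _] := rot_sqr_le (Dx 0 (Dx i f) t x) (Dx 1 (Dx i f) t x) (Dx 2 (Dx i f) t x) r2.
  rewrite -exprMn E; move: X; rewrite -/(grad2 _ t x).
  move: (Dx i (Scal p f) t x) (Dx i f t x) (x 0 0 * _ + _ + _) (_ * grad2 _ _ _) => a b c d cd.
  have := sqr_ge0 (a + b); have := sqr_ge0 (a + c); have := sqr_ge0 (b - c).
  have -> : (a - b - c) ^+ 2 = 3 * (a ^+ 2 + b ^+ 2 + c ^+ 2) - (a + b) ^+ 2 - (a + c) ^+ 2
    - (b - c) ^+ 2 by ring.
  lra.
have T2 : 0 < T ^+ 2 by rewrite exprn_gt0.
rewrite -(ler_pM2l T2) mulrCA.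
have B' : T ^+ 2 * grad2 (Dtau p f) t x <= 3 * (grad2 (Scal p f) t x + grad2 f t x
    + T ^+ 2 / 4 * hess2 f t x).
  have := B 0; have := B 1; have := B 2; rewrite /hess2.
  rewrite {4}/grad2 {4}/grad2 {4}/grad2.
  move: (grad2 (Dx 0 f) t x) (grad2 (Dx 1 f) t x) (grad2 (Dx 2 f) t x) => a b c.
  lra.
apply: (le_trans (ler_wpM2l c0 B')).
have g1 h : grad2 h t x <= edens p h t x.
  by rewrite /edens /grad2 -!expr2 lerDr sqr_ge0.
have C1 : chi t x * (grad2 (Scal p f) t x + grad2 f t x) <=
   T ^+ 4 / 16 * (edens p (Scal p f) t x + edens p f t x).
  apply: ler_pM; [exact: c0| |exact: cT|by apply: lerD].
  by apply: addr_ge0; exact: grad2_ge0.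
have H0 : 0 <= T ^+ 2 * (chi t x * hess2 f t x) by rewrite mulr_ge0 ?sqr_ge0// mulr_ge0 ?hess2_ge0.
have W0 : 0 <= T ^+ 4 * (edens p (Scal p f) t x + edens p f t x).
  by apply: mulr_ge0; [exact: exprn_ge0 (ltW T0)|exact: addr_ge0].
move: C1 H0 W0; set E1 := edens _ _ _ _ + _; set G1 := grad2 _ _ _ + _.
move: (chi t x) (hess2 f t x) => c h C1 H0 W0.
have -> : c * (3 * (G1 + T ^+ 2 / 4 * h)) = 3 * (c * G1) + 3 / 4 * (T ^+ 2 * (c * h)) by field.
have -> : T ^+ 2 * (3 * (c * h) + T ^+ 2 * E1) = 3 * (T ^+ 2 * (c * h)) + T ^+ 4 * E1 by ring.
lra.
Qed.

(** For a spatial [g] this is part of the Hessian of the shorter word; for [g] equal to [Dtau] it is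
    [Dtau_grad]. *)
Lemma interior_grad n v (g : 'I_8) : (4 <= n)%N -> (size v <= n - 4)%N -> (g <= 3)%N ->
  exists2 C : R, 0 <= C & forall f T m, controlled n f T m ->
  (I3 (fun x => chi T x * grad2 (word (g :: v) f) T x)%R <= (C * (tau p T ^+ 2 * m))%:E)%E.
Proof.
move=> n4 vn g3.
have n3 : (3 <= n)%N by apply: leq_trans n4.
have vn3 : (size v <= n - 3)%N by apply: (leq_trans vn); apply: leq_sub2l.
have [C C0 HC] := interior_hessian n3 vn3.
have [C1 C10 HC1] := energy_word p01 t00 n.
exists (3 * C + 2 * C1); first by rewrite addr_ge0// mulr_ge0.
move=> f T m cf; have [sf tT m0 _] := cf.
have T0 : 0 < T := lt_trans t00 tT.
have sv : Smooth (word v f) by exact: smooth_word.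
have [ND NZ NL] := pos_functional_I3 t00 (ltW tT).
have Cm : (I3 (fun x => chi T x * hess2 (word v f) T x)%R <= (C * (tau p T ^+ 2 * m))%:E)%E := HC f T m cf.
have tm0 : 0 <= tau p T ^+ 2 * m by rewrite mulr_ge0 ?sqr_ge0.
have [g0|gn] := posnP g; last first.
  apply: (@le_trans _ _ (C * (tau p T ^+ 2 * m))%:E); last first.
    by rewrite lee_fin ler_wpM2r//; lra.
  apply: le_trans _ Cm; apply: le_I3 => x; first by rewrite mulr_ge0 ?chi_ge0 ?grad2_ge0.
  apply: ler_wpM2l; first exact: chi_ge0.
  have h0 := grad2_ge0 (Dx 0 (word v f)) T x; have h1 := grad2_ge0 (Dx 1 (word v f)) T x.
  have h2 := grad2_ge0 (Dx 2 (word v f)) T x.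
  by move: g g3 gn => [[|[|[|[|//]]]] hg] // _ _; rewrite /= /gen /= /hess2; lra.
have s7 : Smooth (Scal p (word v f)) by exact: (@smooth_gen _ p (Ordinal (isT : (7 < 8)%N))).
have eS : (I3 (edens p (Scal p (word v f)) T) <= (C1 * m)%:E)%E.
  apply: (HC1 (Ordinal (isT : (7 < 8)%N) :: v)) => //=; apply: (leq_trans _ (leq_subr 3 n)).
  by rewrite (leq_ltn_trans vn)// ltn_sub2l.
have ev : (I3 (edens p (word v f) T) <= (C1 * m)%:E)%E.
  by apply: HC1 => //; apply: (leq_trans vn); exact: leq_subr.
have e0 h : ge0_field (edens p h) by move=> t x _; exact: edens_ge0.
have cS := Cont_smooth (smooth_edens p s7); have cv := Cont_smooth (smooth_edens p sv).
have sb : Smooth (ballf (tau p T / 2)) by case: (jet_ballf (tau p T / 2)).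
have ch : Cont (fun t x => pos (ballf (tau p T / 2) t x) ^+ 2 * hess2 (word v f) t x).
  by rewrite /hess2 /grad2; cont_tac.
have ch0 : ge0_field (fun t x => pos (ballf (tau p T / 2) t x) ^+ 2 * hess2 (word v f) t x).
  by move=> t x _; rewrite mulr_ge0 ?sqr_ge0 ?hess2_ge0.
have cE := ContD cS cv.
have E0 : ge0_field (fun t x => edens p (Scal p (word v f)) t x + edens p (word v f) t x).
  by move=> t x t1; rewrite addr_ge0 ?e0.
have z1 : Cont (fun t x => 3 * (pos (ballf (tau p T / 2) t x) ^+ 2 * hess2 (word v f) t x)).
  by apply: (@ContM _ (fun _ _ => 3)); [exact: Cont_cst|].
have z2 : Cont (fun t x => tau p T ^+ 2 * (edens p (Scal p (word v f)) t x + edens p (word v f) t x)).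
  by apply: (@ContM _ (fun _ _ => tau p T ^+ 2)); [exact: Cont_cst|].
apply: (@le_trans _ _ (I3 (fun x => 3 * (pos (ballf (tau p T / 2) T x) ^+ 2 * hess2 (word v f) T x)
   + tau p T ^+ 2 * (edens p (Scal p (word v f)) T x + edens p (word v f) T x))%R)).
  apply: le_I3 => x; first by rewrite mulr_ge0 ?chi_ge0 ?grad2_ge0.
  have -> : word (g :: v) f = Dtau p (word v f) by rewrite /= /gen g0.
  exact: Dtau_grad.
rewrite (ND _ _ z1 z2); last 2 first.
- by move=> t x t1; apply: mulr_ge0 => //; exact: ch0.
- by move=> t x t1; rewrite mulr_ge0 ?sqr_ge0 ?E0.
rewrite (NZ _ _ (ler0n _ 3) ch ch0) (NZ _ _ (sqr_ge0 _) cE E0) (ND _ _ cS cv (e0 _) (e0 _)).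
have S2 : (I3 (edens p (Scal p (word v f)) T) + I3 (edens p (word v f) T) <= (2 * C1 * m)%:E)%E.
  by rewrite (_ : 2 * C1 * m = C1 * m + C1 * m); [rewrite EFinD; exact: leeD|ring].
apply: le_trans (leeD (lee_scale (ler0n _ 3) Cm) (lee_scale (sqr_ge0 _) S2)) _.
by rewrite -EFinD lee_fin le_eqVlt; apply/orP; left; apply/eqP; ring.
Qed.

End InteriorSecond.

(** * Pointwise bounds in the exterior *)

Section Exterior.
Context {R : realType}.
Local Notation field := (@field R).
Local Notation mu := (@lebesgue_measure R).
Implicit Types (f h : field) (t a b T m : R) (x : 'rV[R]_3).

(** One-dimensional Sobolev inequality at an endpoint: integrate the derivative of [P] times an
    affine cut-off. *)
Lemma sobolev_endpoint (P P' B : R -> R) a b s : a < b -> s = a \/ s = b ->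
  (forall r, a <= r <= b -> is_derive r (1 : R) P (P' r)) ->
  (forall r, a <= r <= b -> {for r, continuous P'}) ->
  (forall r, a <= r <= b -> {for r, continuous B}) ->
  (forall r, a <= r <= b -> 0 <= P r) ->
  (forall r, a <= r <= b -> P r / (b - a) + `|P' r| <= B r) ->
  ((P s)%:E <= \int[mu]_(r in `[a, b]) (B r)%:E)%E.
Proof.
move=> ab hs dP cP' cB P0 H.
have ba : 0 < b - a by rewrite subr_gt0.
have cP r : a <= r <= b -> {for r, continuous P}.
  by move=> /dP; exact: is_derive_continuous.
(* [c] is the endpoint opposite to [s]: the cut-off [k] vanishes there and has modulus 1 at [s]. *)
have [c [cab cs]] : exists c, (forall r, a <= r <= b -> `|r - c| <= b - a) /\
    (b - c) / (b - a) * P b - (a - c) / (b - a) * P a = P s.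
  case: hs => ->.
    exists b; split=> [r /andP[h1 h2]|]; first by rewrite distrC ger0_norm; lra.
    by field; exact: lt0r_neq0.
  exists a; split=> [r /andP[h1 h2]|]; first by rewrite ger0_norm; lra.
  by field; exact: lt0r_neq0.
pose k r := (r - c) / (b - a).
have dk r : is_derive r (1 : R) k (b - a)^-1.
  have := @is_derive_affine R R k (fun r => r / (b - a)) r 1.
  by rewrite mul1r; apply => h; rewrite /k [h *: 1]mulr1; ring.
have ck r : {for r, continuous k} by exact: is_derive_continuous (dk r).
have := @ftc_le R (fun r => k r * P r) (fun r => k r * P' r + P r * (b - a)^-1) B
  (fun=> 0) a b ab.
rewrite integral0 adde0 => /(_ _ _ cB) K.
have {K} : ((k b * P b)%:E <= (k a * P a)%:E + \int[mu]_(r in `[a, b]) (B r)%:E)%E.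
  apply: K => //.
  - by move=> r rab; exact: is_deriveM (dk r) (dP r rab).
  - move=> r rab; apply: cvgD; first exact: cvgM (ck r) (cP' r rab).
    by apply: cvgM; [exact: cP|exact: cvg_cst].
  - move=> r rab; rewrite subr0; apply: le_trans (H r rab); rewrite addrC lerD2l.
    apply: le_trans (ler_norm _) _; rewrite normrM ler_piMl//.
    by rewrite /k normrM normfV (gtr0_norm ba) ler_pdivrMr// mul1r cab.
rewrite -cs -/(k b) -/(k a) EFinB; case: (\int[mu]_(r in `[a, b]) (B r)%:E)%E => [z| |] //.
  by rewrite -EFinD -EFinB !lee_fin lerBlDl.
by move=> _; rewrite leey.
Qed.

Lemma scale_segment (B : R -> R) a b (X c : R) : 0 <= c ->
  (forall r, a <= r <= b -> {for r, continuous B}) -> (forall r, 0 <= B r) ->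
  (X%:E <= \int[mu]_(r in `[a, b]) (B r)%:E)%E ->
  ((c * X)%:E <= \int[mu]_(r in `[a, b]) (c * B r)%:E)%E.
Proof.
move=> c0 cB B0 H; under eq_integral do rewrite EFinM.
rewrite (@ge0_integralZl_EFin _ _ R mu `[a, b] (measurable_itv _) (fun r => (B r)%:E))//.
- by rewrite EFinM; apply: lee_wpmul2l; rewrite ?lee_fin.
- by move=> r _; rewrite lee_fin.
- exact: measurable_segment.
Qed.

Lemma is_derive_list_sum (I : Type) (l : seq I) (g : I -> R -> R) (g' : I -> R) (s : R) :
  (forall k, is_derive s (1 : R) (g k) (g' k)) ->
  is_derive s (1 : R) (fun r => \sum_(k <- l) g k r) (\sum_(k <- l) g' k).
Proof.
move=> dg; elim: l => [|k l IH].
  rewrite big_nil (_ : (fun r => _) = cst 0); first exact: is_derive_cst.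
  by apply/funext => r; rewrite big_nil.
rewrite big_cons (_ : (fun r => _) = (fun r => g k r + \sum_(j <- l) g j r)).
  exact: is_deriveD (dg k) IH.
by apply/funext => r; rewrite big_cons.
Qed.

Lemma continuous_list_sum (I : Type) (l : seq I) (g : I -> R -> R) (s : R) :
  (forall k, {for s, continuous (g k)}) -> {for s, continuous (fun r => \sum_(k <- l) g k r)}.
Proof.
move=> cg; elim: l => [|k l IH].
  rewrite (_ : (fun r => _) = cst 0); first exact: cvg_cst.
  by apply/funext => r; rewrite big_nil.
rewrite (_ : (fun r => _) = (fun r => g k r + \sum_(j <- l) g j r)).
  exact: cvgD (cg k) IH.
by apply/funext => r; rewrite big_cons.
Qed.

Lemma is_derive_sqr (g : R -> R) (s d : R) : is_derive s (1 : R) g d ->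
  is_derive s (1 : R) (fun r => g r ^+ 2) (2 * g s * d).
Proof.
move=> dg; have := is_deriveM dg dg; rewrite (_ : g s *: d + g s *: d = 2 * g s * d).
  by move=> H; apply: is_derive_eq.
by rewrite /GRing.scale /=; ring.
Qed.

Lemma is_derive_plane_curve f t z i j (al be : R -> R) (s al' be' : R) : Smooth f -> 0 < t ->
  is_derive s (1 : R) al al' -> is_derive s (1 : R) be be' ->
  is_derive s (1 : R) (fun r => f t (z + al r *: delta_mx 0 i + be r *: delta_mx 0 j))
    (al' * Dx i f t (z + al s *: delta_mx 0 i + be s *: delta_mx 0 j)
     + be' * Dx j f t (z + al s *: delta_mx 0 i + be s *: delta_mx 0 j)).
Proof.
move=> sf t1 da db.
have cD := Cont_space (Cont_smooth (smooth_Dx i sf)) t1.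
have DE k y : Dx k f t y = 'D_(delta_mx 0 k) (f t) y by rewrite Dx.unlock.
have dv k y : derivable (f t) y (delta_mx 0 k : 'rV[R]_3).
  have := sf; rewrite SmoothE => sf'.
  have D := smooth_on_derivable sf' (t1 : [set z : R * 'rV[R]_3 | 0 < z.1] (t, y)).
  have {D} := D (0, delta_mx 0 k).
  rewrite /derivable; set F := fun h : R => _; set G := fun h : R => _; have -> // : F = G.
  by apply/funext => h; rewrite /F /G /uncurry_field /= scaler0 add0r.
rewrite !DE; apply: is_derive_curve da db _ _ (dv j _).
  by near=> y; exact: dv.
by have := cD (z + al s *: delta_mx 0 i + be s *: delta_mx 0 j); congr continuous_at;
  apply/funext => y; rewrite DE.
Unshelve. all: by end_near. Qed.

(* On the circle [z_i = sg * sqrt (c - r^2)], [z_j = r], the derivative in [r]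
   is [Omega_ij / z_i]. *)
Lemma circle_step (I : Type) (l : seq I) (F : I -> field) t (z : 'rV[R]_3) (i j : 'I_3)
    (K sg c rho a b s : R) : 0 <= K -> 0 < t -> i != j -> (forall k, Smooth (F k)) -> sg ^+ 2 = 1 -> 0 < rho ->
  b - a = rho / 4 -> s = a \/ s = b -> z 0 i = 0 -> z 0 j = 0 ->
  (forall r, a <= r <= b -> rho ^+ 2 / 4 <= c - r ^+ 2) ->
  forall y : R -> 'rV[R]_3,
  (forall r, y r = z + (sg * Num.sqrt (c - r ^+ 2)) *: delta_mx 0 i + r *: delta_mx 0 j) ->
  ((K * \sum_(k <- l) F k t (y s) ^+ 2)%R%:E <= \int[mu]_(r in `[a, b])
     (K * \sum_(k <- l) 6 / rho * (F k t (y r) ^+ 2 + Rot i j (F k) t (y r) ^+ 2))%R%:E)%E.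
Proof.
move=> K0 t1 ij sF sg1 r0 ba hs zi zj H y0 /funext ->.
set y := fun r : R => z + (sg * Num.sqrt (c - r ^+ 2)) *: delta_mx 0 i + r *: delta_mx 0 j.
have ab : a < b by rewrite -subr_gt0 ba divr_gt0.
pose al r := sg * Num.sqrt (c - r ^+ 2).
have D0 r : a <= r <= b -> 0 < c - r ^+ 2.
  by move=> /H; apply: lt_le_trans; rewrite divr_gt0 ?exprn_gt0.
have al2 r : a <= r <= b -> al r ^+ 2 = c - r ^+ 2.
  by move=> /D0 h; rewrite exprMn sg1 mul1r sqr_sqrtr// ltW.
have al0 r : a <= r <= b -> al r != 0.
  by move=> rab; rewrite -sqrf_eq0 al2// gt_eqF// D0.
have al_inv r : a <= r <= b -> `|(al r)^-1| <= 2 / rho.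
  move=> rab; rewrite normfV -[2 / rho]invf_div.
  have h0 : 0 < `|al r| by rewrite normr_gt0 al0.
  rewrite lef_pV2 ?posrE// ?divr_gt0//.
  have h1 : (rho / 2) ^+ 2 <= `|al r| ^+ 2.
    rewrite real_normK ?num_real// al2// (_ : (rho / 2) ^+ 2 = rho ^+ 2 / 4); first exact: H.
    by field.
  by move: h1; rewrite ler_sqr ?nnegrE// ltW// divr_gt0.
have dal r : a <= r <= b -> is_derive r (1 : R) al (- r / al r).
  move=> rab; have d0 := D0 r rab.
  have d1 : is_derive r (1 : R) (fun r : R => c - r ^+ 2) (- (2 * r * 1)).
    have := is_deriveB (is_derive_cst c r 1) (is_derive_sqr (is_derive_id r (1 : R))).
    by rewrite sub0r.
  have d2 := @is_derive1_comp R Num.sqrt (fun r : R => c - r ^+ 2) r _ _ (is_derive1_sqrt d0) d1.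
  have := is_deriveZ sg d2; rewrite (_ : sg *: _ = - r / al r) //.
  have S0 : Num.sqrt (c - r ^+ 2) != 0 by rewrite gt_eqF// sqrtr_gt0.
  have sg0 : sg != 0 by rewrite -sqrf_eq0 sg1 oner_neq0.
  rewrite /al /GRing.scale /= -[LHS]mulr1 -[X in _ * X](divff sg0).
  rewrite (_ : sg * _ * _ = sg ^+ 2 * ((2 * Num.sqrt (c - r ^+ 2))^-1 * - (2 * r * 1)) / sg).
    by rewrite sg1; field; rewrite S0 sg0.
  by rewrite expr2; ring.
have yi r : y r 0 i = al r.
  by rewrite !mxE !eqxx zi (negPf ij) /= mulr1 mulr0 add0r addr0.
have yj r : y r 0 j = r.
  by rewrite !mxE !eqxx zj eq_sym (negPf ij) /= mulr1 mulr0 !add0r.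
have cal r : a <= r <= b -> {for r, continuous al} by move=> /dal; exact: is_derive_continuous.
have cy r : a <= r <= b -> {for r, continuous y}.
  move=> rab; apply: cvgD; last by apply: cvgZr_tmp; exact: cvg_id.
  by apply: cvgD; [exact: cvg_cst|apply: cvgZr_tmp; exact: cal].
have cg (g : field) r : a <= r <= b -> Cont g -> {for r, continuous (fun r => g t (y r))}.
  move=> rab cg; apply: (@continuous_comp _ _ _ y (g t)); first exact: cy.
  exact: Cont_space cg t1 _.
have cR k : Cont (Rot i j (F k)).
  have sk := sF k; rewrite /Rot; cont_tac.
have cF k := Cont_smooth (sF k).
have dF k r : a <= r <= b -> is_derive r (1 : R) (fun r => F k t (y r)) (Rot i j (F k) t (y r) / al r).
  move=> rab; have := is_derive_plane_curve z i j (sF k) t1 (dal r rab) (is_derive_id r (1 : R)).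
  rewrite -/(y r) mul1r; congr is_derive; rewrite RotE yi yj.
  by move: (Dx _ _ _ _) (Dx _ _ _ _) => u v; field; exact: al0.
have cB r : a <= r <= b -> {for r, continuous (fun r =>
    \sum_(k <- l) 6 / rho * (F k t (y r) ^+ 2 + Rot i j (F k) t (y r) ^+ 2))}.
  move=> rab; apply: continuous_list_sum => k.
  apply: (cg (fun t x => 6 / rho * (F k t x ^+ 2 + Rot i j (F k) t x ^+ 2)) r rab).
  apply: (@ContM _ (fun _ _ => 6 / rho)); first exact: Cont_cst.
  by apply: ContD; [exact: ContX (cF k)|exact: ContX (cR k)].
apply: (scale_segment K0 cB).
  move=> r; apply: sumr_ge0 => k _; rewrite mulr_ge0 ?divr_ge0 ?(ltW r0)//.
  by rewrite addr_ge0 ?sqr_ge0.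
apply: (@sobolev_endpoint (fun r => \sum_(k <- l) F k t (y r) ^+ 2)
  (fun r => \sum_(k <- l) 2 * F k t (y r) * (Rot i j (F k) t (y r) / al r)) _ a b s ab hs).
- by move=> r rab; apply: is_derive_list_sum => k; exact/is_derive_sqr/dF.
- move=> r rab; apply: continuous_list_sum => k.
  apply: cvgM; first by apply: cvgM; [exact: cvg_cst|exact: cg].
  by apply: cvgM; [exact: cg|apply: cvgV; [exact: al0|exact: cal]].
- exact: cB.
- by move=> r _; apply: sumr_ge0 => k _; exact: sqr_ge0.
- move=> r rab; rewrite ba invf_div.
  apply: (@le_trans _ _ (\sum_(k <- l) (4 / rho * F k t (y r) ^+ 2
     + `|2 * F k t (y r) * (Rot i j (F k) t (y r) / al r)|))).
    by rewrite big_split /= -mulr_sumr mulrC lerD2l; exact: ler_norm_sum.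
  apply: ler_sum => k _; move: (F k t (y r)) (Rot i j (F k) t (y r)) => u v.
  have H1 : `|2 * u * (v / al r)| <= (u ^+ 2 + v ^+ 2) * (2 / rho).
    rewrite !normrM mulrA; apply: ler_pM => //; last exact: al_inv.
    have := sqr_ge0 (`|u| - `|v|); rewrite sqrrB !real_normK ?num_real// ger0_norm//; lra.
  (* The first part is the inverse length of the parameter interval, the second bounds the inverse
     of the coordinate [i] along the arc. *)
  have e : 6 / rho = 4 / rho + 2 / rho by rewrite -mulrDl; congr (_ / _); ring.
  have v0 : 0 <= 4 / rho * v ^+ 2 by rewrite mulr_ge0 ?sqr_ge0// divr_ge0// ltW.
  by move: H1 v0; rewrite e; lra.
Qed.

(* The two directions complementary to [i], in the order used by [slice]. *)
Definition slice_be (i : 'I_3) : 'I_3 := if val i == 0%N then 1 else if val i == 1%N then 0 else 1.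
Definition slice_ga (i : 'I_3) : 'I_3 := if val i == 0%N then 2 else if val i == 1%N then 2 else 0.

Lemma sliceE i (al be ga : R) : vec3 (slice i al be ga) =
  ga *: delta_mx 0 (slice_ga i) + al *: delta_mx 0 i + be *: delta_mx 0 (slice_be i) :> 'rV[R]_3.
Proof.
by move: i; apply: ord3P; rewrite /slice /slice_be /slice_ga vec3E; apply/rowP => j;
  rewrite !mxE /=; ring.
Qed.

Lemma slice_dirs i : [/\ i != slice_be i, i != slice_ga i & slice_be i != slice_ga i].
Proof. by move: i; apply: ord3P. Qed.

Lemma slice_coord i x : x = vec3 (slice i (x 0 i) (x 0 (slice_be i)) (x 0 (slice_ga i))).
Proof.
have H : x = vec3 (x 0 0, x 0 1, x 0 2).
  rewrite vec3E; apply/rowP => j; rewrite !mxE; move: j.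
  by apply: ord3P; rewrite /= ?mulr1 ?mulr0 ?add0r ?addr0.
by move: i; apply: ord3P; rewrite /slice /slice_be /slice_ga /= -H.
Qed.

Lemma unit_step (I : Type) (l : seq I) (F : I -> field) t (z : 'rV[R]_3) (i : 'I_3) (K a : R) :
  0 <= K -> 0 < t -> (forall k, Smooth (F k)) ->
  ((K * \sum_(k <- l) F k t (z + a *: delta_mx 0 i) ^+ 2)%R%:E <= \int[mu]_(r in `[a, (a + 1)%R])
    (K * \sum_(k <- l) (2 * F k t (z + r *: delta_mx 0 i) ^+ 2
      + Dx i (F k) t (z + r *: delta_mx 0 i) ^+ 2))%R%:E)%E.
Proof.
move=> K0 t1 sF; have a1 : a < a + 1 by rewrite ltrDl.
have dF k r := is_derive_slice z i r (sF k) t1.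
have cy : continuous (fun r : R => z + r *: delta_mx 0 i) := @continuous_affine R z _.
have cg (g : field) (r : R) : Cont g -> {for r, continuous (fun r : R => g t (z + r *: delta_mx 0 i))}.
  move=> cg; apply: (@continuous_comp _ _ _ (fun r : R => z + r *: delta_mx 0 i) (g t)).
    exact: cy.
  exact: Cont_space cg t1 _.
have cF k := Cont_smooth (sF k); have cD k := Cont_smooth (smooth_Dx i (sF k)).
have cB (r : R) : a <= r <= a + 1 -> {for r, continuous (fun r : R =>
    \sum_(k <- l) (2 * F k t (z + r *: delta_mx 0 i) ^+ 2
      + Dx i (F k) t (z + r *: delta_mx 0 i) ^+ 2))}.
  move=> _; apply: continuous_list_sum => k.
  apply: (cg (fun t x => 2 * F k t x ^+ 2 + Dx i (F k) t x ^+ 2)).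
  apply: ContD; last exact: ContX.
  by apply: (@ContM _ (fun _ _ => 2)); [exact: Cont_cst|exact: ContX].
apply: (scale_segment K0 cB).
  move=> r; apply: sumr_ge0 => k _; apply: addr_ge0; last exact: sqr_ge0.
  by rewrite mulr_ge0 ?sqr_ge0.
apply: (@sobolev_endpoint (fun r => \sum_(k <- l) F k t (z + r *: delta_mx 0 i) ^+ 2)
  (fun r => \sum_(k <- l) 2 * F k t (z + r *: delta_mx 0 i) * Dx i (F k) t (z + r *: delta_mx 0 i))
  _ a (a + 1) a a1 (or_introl erefl)).
- by move=> r _; apply: is_derive_list_sum => k; exact: is_derive_sqr (dF k r).
- move=> r _; apply: continuous_list_sum => k.
  by apply: cvgM; [apply: cvgM; [exact: cvg_cst|exact: cg]|exact: cg].
- exact: cB.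
- by move=> r _; apply: sumr_ge0 => k _; exact: sqr_ge0.
- move=> r _; rewrite addrAC subrr add0r invr1 mulr1.
  apply: (@le_trans _ _ (\sum_(k <- l) (F k t (z + r *: delta_mx 0 i) ^+ 2
     + `|2 * F k t (z + r *: delta_mx 0 i) * Dx i (F k) t (z + r *: delta_mx 0 i)|))).
    by rewrite big_split /= lerD2l; exact: ler_norm_sum.
  apply: ler_sum => k _; move: (F k t _) (Dx i (F k) t _) => u v.
  rewrite !normrM (ger0_norm (ler0n _ 2)).
  by have := sqr_ge0 (`|u| - `|v|); rewrite sqrrB !real_normK ?num_real//; lra.
Qed.

(** The point is left along [slice_ga i], then along [slice_be i], both on the sphere, and finally
    along [i], in the order of the iterated integral of [I3_slice]. The booleans in the index of [F]
    record which of the two rotations have been applied. *)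
Lemma exterior_bound f t x i : Smooth f -> 0 < t -> x 0 i != 0 ->
  (forall j, `|x 0 j| <= `|x 0 i|) ->
  exists F : bool * bool -> field, [/\
    F (false, false) = f, F (false, true) = Rot i (slice_be i) f,
    F (true, false) = Rot i (slice_ga i) f, F (true, true) = Rot i (slice_be i) (Rot i (slice_ga i) f) &
  (((x 0 0 ^+ 2 + x 0 1 ^+ 2 + x 0 2 ^+ 2) * f t x ^+ 2)%R%:E <=
   I3 (fun y => 36 * \sum_(k <- [:: (false, false); (false, true); (true, false); (true, true)])
     (2 * F k t y ^+ 2 + Dx i (F k) t y ^+ 2))%R)%E].
Proof.
move=> sf t1 xi0 xmax.
have [ib ig bg] := slice_dirs i.
set jb := slice_be i in ib bg *; set jg := slice_ga i in ig bg *.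
pose F (k : bool * bool) : field := let h := if k.1 then Rot i jg f else f in
   if k.2 then Rot i jb h else h.
exists F; split => //.
have sR j k h : Smooth h -> Smooth (Rot j k h) by move=> sh; have [] := jet_Rot j k sh.
have sF k : Smooth (F k).
  by rewrite /F; case: k => [[] []] /=; [do 2 apply: (sR)|apply: (sR)|apply: (sR)|].
pose r2 := x 0 0 ^+ 2 + x 0 1 ^+ 2 + x 0 2 ^+ 2.
have r2E : r2 = x 0 i ^+ 2 + x 0 jb ^+ 2 + x 0 jg ^+ 2.
  by rewrite /jb /jg; move: (i); apply: ord3P; rewrite /slice_be /slice_ga /= /r2; ring.
have r2p : 0 < r2.
  by rewrite r2E -addrA ltr_pwDl ?addr_ge0 ?sqr_ge0// lt_def sqr_ge0 sqrf_eq0 xi0.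
pose rho := Num.sqrt r2.
have rp : 0 < rho by rewrite sqrtr_gt0.
have rE : rho ^+ 2 = r2 by rewrite sqr_sqrtr// ltW.
(* The sign selects the hemisphere, as a graph over the other two coordinates, that contains [x]. *)
pose sg : R := Num.sg (x 0 i).
have sg1 : sg ^+ 2 = 1 by rewrite /sg sqr_sg xi0.
pose Y be ga : 'rV[R]_3 := vec3 (slice i (sg * Num.sqrt (r2 - be ^+ 2 - ga ^+ 2)) be ga).
have Y0 : Y (x 0 jb) (x 0 jg) = x.
  rewrite [RHS](slice_coord i) /Y; congr (vec3 (slice _ _ _ _)).
  have -> : r2 - x 0 jb ^+ 2 - x 0 jg ^+ 2 = x 0 i ^+ 2 by rewrite r2E; ring.
  by rewrite sqrtr_sqr /sg -numEsg.
(* intervals ending at [b0], on which [|b|] does not exceed [max |b0| (rho/4)] *)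
have interval b0 : exists a b, [/\ b - a = rho / 4, b0 = a \/ b0 = b &
    forall r, a <= r <= b -> r ^+ 2 <= b0 ^+ 2 \/ r ^+ 2 <= rho ^+ 2 / 16].
  have [b0p|b0n] := leP 0 b0.
    exists (b0 - rho / 4), b0; split; [by ring|by right|move=> r /andP[h1 h2]].
    by have [rp0|rn0] := leP 0 r; [left; nra|right; nra].
  exists b0, (b0 + rho / 4); split; [by ring|by left|move=> r /andP[h1 h2]].
  by have [rp0|rn0] := leP 0 r; [right; nra|left; nra].
have [ab [bb [Lb Eb Hb]]] := interval (x 0 jb).
have [ag [bg' [Lg Eg Hg]]] := interval (x 0 jg).
have mb : x 0 jb ^+ 2 <= x 0 i ^+ 2 by rewrite -[leLHS]real_normK ?num_real// -[leRHS]real_normK ?num_real// ler_sqr ?nnegrE.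
have mg : x 0 jg ^+ 2 <= x 0 i ^+ 2 by rewrite -[leLHS]real_normK ?num_real// -[leRHS]real_normK ?num_real// ler_sqr ?nnegrE.
(* On the arcs the coordinate [i] stays at least [rho / 2] in modulus, because it was the largest at
   [x] and the other two grow in modulus only up to [rho / 4], if at all. *)
have D be ga : (be ^+ 2 <= x 0 jb ^+ 2 \/ be ^+ 2 <= rho ^+ 2 / 16) ->
   (ga ^+ 2 <= x 0 jg ^+ 2 \/ ga ^+ 2 <= rho ^+ 2 / 16) -> rho ^+ 2 / 4 <= r2 - be ^+ 2 - ga ^+ 2.
  have b2 := sqr_ge0 (x 0 jb); have g2 := sqr_ge0 (x 0 jg).
  by rewrite rE => -[] h1 [] h2; lra.
have dz (j k : 'I_3) (u : R) : k != j -> (u *: (delta_mx 0 j : 'rV[R]_3)) 0 k = 0.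
  by move=> jk; rewrite !mxE (negPf jk) andbF mulr0.
(* The two arcs cost [6 / rho] each, so the prefactor $r^2$ is consumed and 36 remains; the last
   step, of length 1, has no power of [rho]. *)
pose U (y : 'rV[R]_3) : R := 36 * \sum_(k <- [:: (false, false); (false, true); (true, false); (true, true)])
     (2 * F k t y ^+ 2 + Dx i (F k) t y ^+ 2).
have U0 y : 0 <= U y.
  apply: mulr_ge0 => //; apply: sumr_ge0 => k _; apply: addr_ge0; last exact: sqr_ge0.
  by rewrite mulr_ge0 ?sqr_ge0.
have cU : continuous U.
  apply: (Cont_space (F := fun t y => 36 * \sum_(k <- [:: (false, false); (false, true); (true, false); (true, true)])
     (2 * F k t y ^+ 2 + Dx i (F k) t y ^+ 2)) _ t1).
  apply: (@ContM _ (fun _ _ => 36)); first exact: Cont_cst.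
  have cc k : Cont (fun t y => 2 * F k t y ^+ 2 + Dx i (F k) t y ^+ 2).
    apply: ContD; last exact/ContX/Cont_smooth/smooth_Dx.
    by apply: (@ContM _ (fun _ _ => 2)); [exact: Cont_cst|exact/ContX/Cont_smooth].
  rewrite (_ : (fun t y => _) = (fun t y => (2 * F (false, false) t y ^+ 2 + Dx i (F (false, false)) t y ^+ 2)
     + ((2 * F (false, true) t y ^+ 2 + Dx i (F (false, true)) t y ^+ 2)
     + ((2 * F (true, false) t y ^+ 2 + Dx i (F (true, false)) t y ^+ 2)
     + (2 * F (true, true) t y ^+ 2 + Dx i (F (true, true)) t y ^+ 2))))); last first.
    by apply/funext => s; apply/funext => y; rewrite !big_cons big_nil addr0.
  by do 3 (apply: ContD; first exact: cc); exact: cc.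
have step1 : ((r2 * \sum_(k <- [:: tt]) f t (Y (x 0 jb) (x 0 jg)) ^+ 2)%R%:E <=
   \int[mu]_(ga in `[ag, bg']) (r2 * \sum_(k <- [:: tt])
     6 / rho * (f t (Y (x 0 jb) ga) ^+ 2 + Rot i jg f t (Y (x 0 jb) ga) ^+ 2))%R%:E)%E.
  apply: (@circle_step _ [:: tt] (fun _ => f) t (x 0 jb *: delta_mx 0 jb) i jg r2 sg
    (r2 - x 0 jb ^+ 2) rho ag bg' (x 0 jg) (ltW r2p) t1 ig (fun _ => sf) sg1 rp Lg Eg
    (dz _ _ _ ib) (dz _ _ _ _)).
  - by rewrite eq_sym.
  - by move=> ga /Hg hg; apply: D => //; left.
  - by move=> ga; rewrite /Y sliceE -/jb -/jg addrC addrA addrAC.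
rewrite big_seq1 Y0 -/r2 in step1.
apply: (le_trans step1); rewrite (I3_slice i cU U0).
apply: (@le_trans _ _ (\int[mu]_(ga in `[ag, bg']) \int[mu]_be \int[mu]_al (U (vec3 (slice i al be ga)))%:E)%E);
  last first.
  apply: le_integral_subset => // ga; apply: integral_ge0 => be _.
  by apply: integral_ge0 => al _; rewrite lee_fin.
apply: le_integral_nonneg => ga /=; rewrite in_itv /= => hga.
  rewrite lee_fin mulr_ge0 ?(ltW r2p)//; apply: sumr_ge0 => k _.
  by rewrite mulr_ge0 ?divr_ge0 ?(ltW rp)// addr_ge0 ?sqr_ge0.
have K1 : 0 <= r2 * (6 / rho) by rewrite mulr_ge0 ?(ltW r2p)// divr_ge0 ?(ltW rp).
have hD be : ab <= be <= bb -> rho ^+ 2 / 4 <= r2 - ga ^+ 2 - be ^+ 2.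
  by move=> /Hb hb; rewrite addrAC; apply: D => //; exact: Hg.
have hY be : Y be ga = ga *: delta_mx 0 jg + (sg * Num.sqrt (r2 - ga ^+ 2 - be ^+ 2)) *: delta_mx 0 i
    + be *: delta_mx 0 jb.
  by rewrite /Y sliceE -/jb -/jg (addrAC r2).
have step2 := @circle_step _ [:: false; true] (fun k => F (k, false)) t (ga *: delta_mx 0 jg) i jb
   (r2 * (6 / rho)) sg (r2 - ga ^+ 2) rho ab bb (x 0 jb) K1 t1 ib (fun k => sF (k, false)) sg1 rp Lb Eb
    (dz _ _ _ ig) (dz _ _ _ bg) hD (Y ^~ ga) hY.
have E2 : r2 * (6 / rho) * \sum_(k <- [:: false; true]) F (k, false) t (Y (x 0 jb) ga) ^+ 2 =
  r2 * \sum_(k <- [:: tt]) 6 / rho * (f t (Y (x 0 jb) ga) ^+ 2 + Rot i jg f t (Y (x 0 jb) ga) ^+ 2).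
  by rewrite big_seq1 !big_cons big_nil addr0 /F /=; ring.
rewrite E2 in step2; apply: (le_trans step2).
apply: (@le_trans _ _ (\int[mu]_(be in `[ab, bb]) \int[mu]_al (U (vec3 (slice i al be ga)))%:E)%E);
  last first.
  apply: le_integral_subset => // be; apply: integral_ge0 => al _.
  by rewrite lee_fin.
apply: le_integral_nonneg => be _.
  rewrite lee_fin mulr_ge0//; apply: sumr_ge0 => k _.
  by rewrite mulr_ge0 ?divr_ge0 ?(ltW rp)// addr_ge0 ?sqr_ge0.
have [z Ez] := slice_line i be ga.
set al0 : R := sg * Num.sqrt (r2 - be ^+ 2 - ga ^+ 2).
have step3 := @unit_step _ [:: (false, false); (false, true); (true, false); (true, true)] F t z i 36 al0
   (ler0n _ _) t1 sF.
apply: le_trans (le_trans _ step3) _.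
  rewrite lee_fin le_eqVlt; apply/orP; left; apply/eqP.
  rewrite !big_cons !big_nil -/al0 -Ez -/(Y be ga) /F /= !addr0.
  by rewrite -rE; field; rewrite gt_eqF.
apply: (@le_trans _ _ (\int[mu]_(al in `[al0, (al0 + 1)%R]) (U (vec3 (slice i al be ga)))%:E)%E).
  by apply: le_integral_nonneg => al _; rewrite ?Ez ?lee_fin// -Ez U0.
by apply: le_integral_subset => // al; rewrite lee_fin.
Qed.

End Exterior.

(** * Pointwise bounds in the interior *)

Lemma swap_integrals d1 d2 (T1 : measurableType d1) (T2 : measurableType d2) (R : realType)
    (m1 : {sigma_finite_measure set T1 -> \bar R}) (m2 : {sigma_finite_measure set T2 -> \bar R})
    (k : T1 * T2 -> \bar R) (A : set T1) (B : set T2) :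
  measurable A -> measurable B -> measurable_fun setT k -> (forall z, (0 <= k z)%E) ->
  (\int[m1]_(x in A) \int[m2]_(y in B) k (x, y) = \int[m2]_(y in B) \int[m1]_(x in A) k (x, y))%E.
Proof.
move=> mA mB mk k0; pose u := k \_ (A `*` B).
have mu_ : measurable_fun setT u.
  by apply/(measurable_restrictT k (measurableX mA mB)); exact: measurable_funTS.
have u0 z : (0 <= u z)%E by rewrite /u /patch; case: ifP.
have E x y : u (x, y) = if x \in A then if y \in B then k (x, y) else 0%E else 0%E.
  by rewrite /u /patch in_setX /=; case: (x \in A) => //; case: (y \in B).
have H := @fubini_tonelli _ _ _ _ _ m1 m2 u mu_ u0.
rewrite integral_mkcond [RHS]integral_mkcond; apply: etrans (etrans H _).
  apply: eq_integral => x _; rewrite /patch; case: ifP => hx.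
    by rewrite integral_mkcond; apply: eq_integral => y _; rewrite /patch E hx.
  by rewrite integral0_eq// => y _; rewrite E hx.
apply: eq_integral => y _; rewrite /patch; case: ifP => hy.
  by rewrite [RHS]integral_mkcond; apply: eq_integral => x _; rewrite /patch E hy; case: ifP.
by rewrite integral0_eq// => x _; rewrite E hy; case: ifP.
Qed.

Lemma patch_ge0 (T : Type) (R : realType) (f : T -> \bar R) (A : set T) x :
  (forall y, (0 <= f y)%E) -> (0 <= (f \_ A) x)%E.
Proof. by move=> f0; rewrite /patch; case: ifP. Qed.

Section ContinuousFor.
Context {R : realType}.
Implicit Types (f g : R -> R) (s : R).

Lemma continuous_forD f g s : {for s, continuous f} -> {for s, continuous g} ->
  {for s, continuous (fun s => f s + g s)}.
Proof. exact: cvgD. Qed.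

Lemma continuous_forN f s : {for s, continuous f} -> {for s, continuous (fun s => - f s)}.
Proof. exact: cvgN. Qed.

Lemma continuous_forM f g s : {for s, continuous f} -> {for s, continuous g} ->
  {for s, continuous (fun s => f s * g s)}.
Proof. exact: cvgM. Qed.

End ContinuousFor.

Ltac continuous_for :=
  cbv beta; lazymatch goal with |- context [continuous ?h] =>
    lazymatch h with
    | (fun s => (@?f s + @?g s)%R) => apply: (@continuous_forD _ f g); continuous_for
    | (fun s => (- @?f s)%R) => apply: (@continuous_forN _ f); continuous_for
    | (fun _ => ?c) => exact: cvg_cst
    | (fun s => s) => exact: cvg_id
    | (fun s => (@?f s * @?g s)%R) => apply: (@continuous_forM _ f g); continuous_for
    | _ => eassumption
    end
  end.

(** * Averages over a cone of rays *)

Section ConeAverage.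
Context {R : realType}.
Local Notation mu := (@lebesgue_measure R).
Implicit Types (W : 'rV[R]_3 -> R) (x : 'rV[R]_3).

Lemma integral_affine (h : R -> R) (x s : R) : 0 < s -> continuous h ->
  (\int[mu]_(a in `[0%R, 1%R]) (s * h (x + s * a))%R%:E = \int[mu]_(a in `[x, (x + s)%R]) (h a)%:E)%E.
Proof.
move=> s0 ch.
have dF (r : R) : is_derive r (1 : R) (fun a : R => x + s * a) s.
  have := is_deriveD (is_derive_cst x r (1 : R)) (is_deriveZ s (is_derive_id r (1 : R))).
  by rewrite add0r [s *: 1]mulr1.
have EF : derive1 (fun a : R => x + s * a) = cst s.
  by apply/funext => r; rewrite derive1E; case: (dF r).
have := @integration_by_substitution_increasing R (fun a => x + s * a) h 0 1 ler01.
rewrite EF mulr0 addr0 mulr1 => ->.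
- by apply: eq_integral => a _; rewrite mulrC.
- by move=> a b _ _ ab; rewrite ltrD2l ltr_pM2l.
- by move=> a _; exact: cvg_cst.
- exact: is_cvg_cst.
- exact: is_cvg_cst.
- split.
  + by move=> a _; case: (dF a).
  + by apply: cvg_at_right_filter; exact: is_derive_continuous (dF 0).
  + by apply: cvg_at_left_filter; exact: is_derive_continuous (dF 1).
- by apply: within_continuous => a _; exact: ch.
Qed.

Lemma swap_segments (k : R -> R -> R) (a b c d : R) :
  (forall x : R, continuous (k x)) -> (forall y : R, continuous (k ^~ y)) ->
  (forall x y : R, 0 <= k x y) ->
  (\int[mu]_(x in `[a, b]) \int[mu]_(y in `[c, d]) (k x y)%:E =
   \int[mu]_(y in `[c, d]) \int[mu]_(x in `[a, b]) (k x y)%:E)%E.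
Proof.
move=> c1 c2 k0.
apply: (@swap_integrals _ _ _ _ R mu mu (fun z => (k z.1 z.2)%:E)); try exact: measurable_itv.
  apply/measurable_EFinP; apply: measurable_fun_caratheodory => [x|y]; first exact: c1.
  exact: continuous_measurable_fun (c2 y).
by move=> z; rewrite lee_fin.
Qed.

(** The rays leave the vertex with slopes in the unit square, and the weight $(c-x_2)^2$ is the
    Jacobian of the map from slopes to the two transverse coordinates. Averaging over slopes
    therefore gives a plain space integral. *)
Lemma cone_average W (x0 x1 x2 l v : R) : 0 < l -> continuous W -> (forall x, 0 <= W x) ->
  (forall a b : R, 0 <= a <= 1 -> 0 <= b <= 1 -> (v%:E <= \int[mu]_(c in `[x2, (x2 + l)%R])
     ((c - x2) ^+ 2 * W (vec3 (x0 + (c - x2) * a, x1 + (c - x2) * b, c)%R))%R%:E)%E) ->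
  (v%:E <= I3 W)%E.
Proof.
move=> l0 cW W0 H.
have cV (f g h : 'rV[R]_3 -> R) : continuous f -> continuous g -> continuous h ->
    continuous (fun y => vec3 (f y, g y, h y)).
  move=> cf cg ch; under eq_fun do rewrite vec3E; move=> y.
  exact: (cvgD (cvgD (cvgZr_tmp (cf y)) (cvgZr_tmp (cg y))) (cvgZr_tmp (ch y))).
have cc i : continuous (fun y : 'rV[R]_3 => y 0 i) by move=> y; exact: coord_continuous.
pose Z (y : 'rV[R]_3) := (y 0 2 - x2) ^+ 2 *
  W (vec3 (x0 + (y 0 2 - x2) * y 0 0, x1 + (y 0 2 - x2) * y 0 1, y 0 2)).
have cZ : continuous Z.
  have cm : continuous (fun y : 'rV[R]_3 => y 0 2 - x2).
    by move=> y; exact: (cvgD (cc 2 y) (cvg_cst _)).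
  move=> y.
  have cA : {for y, continuous (fun y : 'rV[R]_3 => (y 0 2 - x2) ^+ 2)} :=
    @continuous_comp _ _ _ (fun y : 'rV[R]_3 => y 0 2 - x2) (fun r : R => r ^+ 2) y (cm y)
      (@exprn_continuous R 2 _).
  have cM i r : continuous (fun y : 'rV[R]_3 => r + (y 0 2 - x2) * y 0 i).
    by move=> z; exact: (cvgD (cvg_cst r) (cvgM (cm z) (cc i z))).
  have cB : {for y, continuous (fun y : 'rV[R]_3 => W (vec3 (x0 + (y 0 2 - x2) * y 0 0,
      x1 + (y 0 2 - x2) * y 0 1, y 0 2)))} :=
    @continuous_comp _ _ _ (fun y : 'rV[R]_3 => vec3 (x0 + (y 0 2 - x2) * y 0 0,
      x1 + (y 0 2 - x2) * y 0 1, y 0 2)) W y (cV _ _ _ (cM 0 x0) (cM 1 x1) (cc 2) y) (cW _).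
  exact: (cvgM cA cB).
have Z0 y : 0 <= Z y by rewrite mulr_ge0 ?sqr_ge0.
have ZE a b c : Z (vec3 (a, b, c)) = (c - x2) ^+ 2 * W (vec3 (x0 + (c - x2) * a, x1 + (c - x2) * b, c)).
  by rewrite /Z !mxE !(tnth_nth 0).
pose I (a b : R) : set (g_sigma_algebraType (R.-ocitv.-measurable)) := `[a, b]%classic.
have mI a' b' : measurable (I a' b') by exact: measurable_itv.
pose D := (I 0 1 `*` I 0 1) `*` I x2 (x2 + l).
have mD : measurable D by do 2 apply: measurableX => //.
pose u (y : R * R * R) : \bar R := (Z (vec3 y) * \1_D y)%:E.
have mu_ : measurable_fun setT u.
  apply/measurable_EFinP; apply: measurable_funM; first exact: measurable_fun_vec3.
  exact: measurable_indic.
have u0 y : (0 <= u y)%E by rewrite lee_fin mulr_ge0// indicE.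
have T2 := tonelli_slice 2 mu_ u0; rewrite (tonelli_slice 0 mu_ u0) in T2.
have uE a b c : u (a, b, c) = if (a \in I 0 1) && (b \in I 0 1) && (c \in I x2 (x2 + l)) then
    (Z (vec3 (a, b, c)))%:E else 0%:E.
  rewrite /u indicE (_ : ((a, b, c) \in D) = (a \in I 0 1) && (b \in I 0 1) && (c \in I x2 (x2 + l))).
    by case: ifP => _; rewrite ?mulr1 ?mulr0.
  by rewrite /D !in_setX.
have le1 : (v%:E <= \int[mu]_a \int[mu]_b \int[mu]_c u (a, b, c))%E.
  have [v0|v0] := leP v 0; first by apply: (@le_trans _ _ 0%E); [rewrite lee_fin|do 3 (apply: integral_ge0 => ? _)].
  have c1 : (\int[mu]_(_ in `[0%R, 1%R]) v%:E)%E = v%:E.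
    by rewrite (@integral_cst_segment R v 0 1 ler01) subr0 mulr1.
  have -> : v%:E = (\int[mu]_(a in `[0%R, 1%R]) \int[mu]_(b in `[0%R, 1%R]) v%:E)%E by rewrite c1 c1.
  rewrite integral_mkcond; apply: le_integral_nonneg => a _.
    apply: patch_ge0 => a'.
    by apply: integral_ge0 => b _; rewrite lee_fin; exact: ltW.
  rewrite /patch; case: ifP => ha; last by do 2 (apply: integral_ge0 => ? _).
  rewrite integral_mkcond; apply: le_integral_nonneg => b _.
    by apply: patch_ge0 => b'; rewrite lee_fin; exact: ltW.
  rewrite /patch; case: ifP => hb; last by apply: integral_ge0 => ? _.
  have := H a b; move: (ha) (hb); rewrite !inE /= !in_itv /= => ha' hb' /(_ ha' hb') K.
  apply: le_trans K _; rewrite integral_mkcond; apply: le_integral_nonneg => c _.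
    by apply: patch_ge0 => c'; rewrite lee_fin mulr_ge0 ?sqr_ge0.
  by rewrite uE /patch ha hb /= ZE.
apply: (le_trans le1); rewrite -[X in (X <= _)%E]T2 (I3_slice 1 cW W0).
apply: le_integral_nonneg => c _; first by do 2 (apply: integral_ge0 => ? _).
rewrite /slice /=.
have RHS0 : (0 <= \int[mu]_be \int[mu]_al (W (vec3 (be, al, c)))%:E)%E.
  by do 2 (apply: integral_ge0 => ? _); rewrite lee_fin.
have zero : (forall a b, u (a, b, c) = 0%E) ->
    (\int[mu]_be \int[mu]_al u (al, be, c) <= \int[mu]_be \int[mu]_al (W (vec3 (be, al, c)))%:E)%E.
  move=> uz; have E0 b : (\int[mu]_al u (al, b, c) = 0)%E.
    by apply: integral0_eq => a _; exact: uz.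
  by under eq_integral do rewrite E0; rewrite integral0; exact: RHS0.
have [hc|hc] := boolP (c \in I x2 (x2 + l)); last first.
  by apply: zero => a b; rewrite uE (negPf hc) andbF.
have hs : 0 <= c - x2.
  have : `[x2, (x2 + l)%R]%classic c by move: hc; rewrite inE.
  by rewrite /= in_itv /= subr_ge0 => /andP[].
(* In the plane of the vertex the change of variables degenerates, but there the weight vanishes. *)
move: hs; rewrite le_eqVlt => /orP[/eqP s0|s0].
  by apply: zero => a b; rewrite uE ZE -s0 expr0n /= mul0r; case: ifP.
set s := c - x2 in s0 *.
pose k a b := s * W (vec3 (a, x1 + s * b, c)).
have k0 a b : 0 <= k a b := mulr_ge0 (ltW s0) (W0 _).
have cW1 b : continuous (fun a : R => W (vec3 (a, b, c))).
  have [z E] := @slice_line R 0 b c; rewrite /slice /= in E.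
  under eq_fun do rewrite E.
  move=> r; apply: (@continuous_comp _ _ _ (fun r : R => z + r *: delta_mx 0 0) W r).
    exact: continuous_affine.
  exact: cW.
have cW2 a : continuous (fun b : R => W (vec3 (a, b, c))).
  have [z E] := @slice_line R 1 a c; rewrite /slice /= in E.
  under eq_fun do rewrite E.
  move=> r; apply: (@continuous_comp _ _ _ (fun r : R => z + r *: delta_mx 0 1) W r).
    exact: continuous_affine.
  exact: cW.
(* One factor [s] is spent on substituting in the first slope; after exchanging the integrals the
   other factor, kept in [k], is spent on the second. *)
apply: (@le_trans _ _ (\int[mu]_(b in `[0%R, 1%R]) \int[mu]_(a in `[x0, (x0 + s)%R]) (k a b)%:E)%E).
  rewrite [leRHS]integral_mkcond; apply: le_integral_nonneg => b _.
    by apply: integral_ge0 => a _; exact: u0.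
  rewrite /patch; case: ifP => hb; last first.
    have E0 a : u (a, b, c) = 0%E by rewrite uE (_ : (b \in I 0 1) = false) ?andbF.
    by under eq_integral do rewrite E0; rewrite integral0; exact: lexx.
  rewrite -(integral_affine x0 s0 (h := fun a => k a b)); last first.
    by move=> a; apply: cvgM; [exact: cvg_cst|exact: cW1].
  rewrite [leRHS]integral_mkcond; apply: le_integral_nonneg => a _; first exact: u0.
  have -> : u (a, b, c) = if a \in I 0 1 then (Z (vec3 (a, b, c)))%:E else 0%E.
    by rewrite uE hb hc !andbT.
  rewrite /patch -/(I 0 1); case: ifP => _; last exact: lexx.
  by rewrite lee_fin ZE -/s /k expr2 mulrA; exact: lexx.
rewrite -(@swap_segments k); first last.
- exact: k0.
- by move=> b a; apply: cvgM; [exact: cvg_cst|exact: cW1].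
- move=> a b; apply: cvgM; first exact: cvg_cst.
  apply: (@continuous_comp _ _ _ (fun b : R => x1 + s * b) (fun b => W (vec3 (a, b, c)))).
    by apply: cvgD; [exact: cvg_cst|apply: cvgM; [exact: cvg_cst|exact: cvg_id]].
  exact: cW2.
rewrite integral_mkcond; apply: le_integral_nonneg => a _.
  apply: patch_ge0 => a'; apply: integral_ge0 => b _.
  by rewrite lee_fin; exact: k0.
rewrite /patch; case: ifP => _; last by apply: integral_ge0 => b _; rewrite lee_fin.
rewrite (integral_affine x1 s0 (cW2 a)).
apply: le_integral_subset => [b'|]; [rewrite lee_fin; exact: W0|exact: subsetT].
Qed.

(* A primitive argument with the multiplier s(1 - s/c0)(1 - (s/l)^2), cut at
   s = c0; the weight s^2 is that of polar coordinates. *)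
Lemma ray_bound (u u1 u2 : R -> R) (x l c0 : R) : 0 < c0 -> 2 * c0 <= l ->
  (forall s, x <= s <= x + l -> is_derive s (1 : R) u (u1 s)) ->
  (forall s, x <= s <= x + l -> is_derive s (1 : R) u1 (u2 s)) ->
  (forall s, x <= s <= x + l -> {for s, continuous u2}) ->
  ((u x ^+ 2)%:E <= \int[mu]_(s in `[x, (x + l)%R])
     (6 * ((s - x) ^+ 2 * (8 / l ^+ 3 * u s ^+ 2 + 10 / c0 * u1 s ^+ 2 + 2 * c0 * u2 s ^+ 2)))%R%:E)%E.
Proof.
move=> c00 cl du du1 cu2.
have l0 : 0 < l by apply: lt_le_trans cl; rewrite mulr_gt0.
have ln0 : l != 0 by rewrite gt_eqF.
have cn0 : c0 != 0 by rewrite gt_eqF.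
have cll : c0 < l by apply: lt_le_trans cl; rewrite ltr_pMl// ltr1n.
set v := u x.
pose P s := (s - x) ^+ 2 * (8 / l ^+ 3 * u s ^+ 2 + 10 / c0 * u1 s ^+ 2 + 2 * c0 * u2 s ^+ 2).
have cu s : x <= s <= x + l -> {for s, continuous u} by move=> /du; exact: is_derive_continuous.
have cu1 s : x <= s <= x + l -> {for s, continuous u1} by move=> /du1; exact: is_derive_continuous.
have csub (r s : R) : {for s, continuous (fun s => s - r)} by apply: cvgD; [exact: cvg_id|exact: cvg_cst].
have csq (g : R -> R) (s : R) : {for s, continuous g} -> {for s, continuous (fun s => g s ^+ 2)}.
  move=> cg; exact: (@continuous_comp _ _ _ g (fun r : R => r ^+ 2) s cg (@exprn_continuous R 2 _)).
have cP s : x <= s <= x + l -> {for s, continuous P}.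
  move=> sl; apply: cvgM; first exact: (csq _ _ (csub x s)).
  apply: cvgD; first apply: cvgD; apply: cvgM; try exact: cvg_cst; apply: csq.
  - exact: cu.
  - exact: cu1.
  - exact: cu2.
have P0 s : 0 <= P s.
  apply: mulr_ge0; first exact: sqr_ge0.
  have l1 : 0 <= 8 / l ^+ 3 by rewrite divr_ge0// exprn_ge0// ltW.
  apply: addr_ge0; first apply: addr_ge0; apply: mulr_ge0; try exact: sqr_ge0.
  - exact: l1.
  - by rewrite divr_ge0// ltW.
  - by rewrite mulr_ge0// ltW.
have dsig (s : R) : is_derive s (1 : R) (fun s => s - x) 1.
  by have := is_deriveB (is_derive_id s (1 : R)) (is_derive_cst x s (1 : R)); rewrite subr0.
(* [ze] is 1 at the vertex and 0 at the far end; [ka] vanishes at distances 0 and [c0], so that [u1]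
   contributes no boundary terms. *)
pose ze s := 1 - (s - x) ^+ 2 / l ^+ 2.
pose ka s := (s - x) - (s - x) ^+ 2 / c0.
have dze (s : R) : is_derive s (1 : R) ze (- (2 * (s - x) / l ^+ 2)).
  apply: is_derive_eq; rewrite /GRing.scale /=; field; exact: ln0.
have dka (s : R) : is_derive s (1 : R) ka (1 - 2 * (s - x) / c0).
  apply: is_derive_eq; rewrite /GRing.scale /=; field; exact: cn0.
(* The linear term prepays the losses from completing squares in [leA]: one of $v^2/(8l)$ and three
   of $v^2/(8c_0)$. *)
pose fA s := - v * (ze s * u s) + v * (ka s * ze s * u1 s) - v ^+ 2 * ((8 * l)^-1 + 3 / (8 * c0)) * (s - x).
pose fA' s := 2 * v * (s - x) / l ^+ 2 * u s - 2 * v * ze s * (s - x) / c0 * u1 s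
  - v * ka s * (2 * (s - x) / l ^+ 2) * u1 s + v * ka s * ze s * u2 s - v ^+ 2 * ((8 * l)^-1 + 3 / (8 * c0)).
have dfA (s : R) : x <= s <= x + l -> is_derive s (1 : R) fA (fA' s).
  move=> sl; have := du s sl; have := du1 s sl => d1 d2.
  apply: is_derive_eq; rewrite /fA' /ka /GRing.scale /=.
  by move: (u s) (u1 s) (u2 s) (ze s) => a b c z; field; rewrite cn0 ln0.
(* Beyond [c0] no second derivative is used. The term in $1/(s-x)$ pays for the first-derivative
   term, whose square must carry the weight $(s-x)^2$. *)
pose fB s := - v * (ze s * u s) + c0 / 8 * v ^+ 2 / (s - x) - v ^+ 2 / (8 * l) * (s - x).
pose fB' s := 2 * v * (s - x) / l ^+ 2 * u s - v * ze s * u1 s - c0 / 8 * v ^+ 2 / (s - x) ^+ 2 - v ^+ 2 / (8 * l).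
have dfB (s : R) : x + c0 <= s <= x + l -> is_derive s (1 : R) fB (fB' s).
  move=> /andP[h1 h2]; have sl : x <= s <= x + l by rewrite h2 andbT; lra.
  have sx : s - x != 0 by rewrite gt_eqF// subr_gt0; lra.
  have := du s sl; have := du1 s sl => d1 d2.
  apply: is_derive_eq; rewrite /fB' /GRing.scale /=.
  by move: (u s) (u1 s) (ze s) => a b z; field; rewrite sx ln0.
have cze (s : R) : {for s, continuous ze} := is_derive_continuous (dze s).
have cka (s : R) : {for s, continuous ka} := is_derive_continuous (dka s).
have cfA s : x <= s <= x + l -> {for s, continuous fA'}.
  move=> sl; have := cu s sl; have := cu1 s sl; have := cu2 s sl; have := cze s; have := cka s.
  have := csub x s; rewrite /fA' => k1 k2 k3 k4 k5 k6.
  continuous_for.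
have cfB s : x + c0 <= s <= x + l -> {for s, continuous fB'}.
  move=> /andP[h1 h2]; have sl : x <= s <= x + l by rewrite h2 andbT; lra.
  have sx : (s - x) ^+ 2 != 0 by rewrite sqrf_eq0 gt_eqF// subr_gt0; lra.
  have := cu s sl; have := cu1 s sl; have := cze s; have := cka s.
  have k0 : {for s, continuous (fun s => ((s - x) ^+ 2)^-1)} by exact: (cvgV sx (csq _ _ (csub x s))).
  have := csub x s; rewrite /fB' => k1 k2 k3 k4 k5.
  continuous_for.
have ze01 s : x <= s <= x + l -> 0 <= ze s <= 1.
  move=> /andP[h1 h2]; rewrite /ze; have [h3 h4] : 0 <= s - x /\ s - x <= l by split; lra.
  rewrite subr_ge0 gerBl ler_pdivrMr ?exprn_gt0// mul1r ler_sqr ?nnegrE ?(ltW l0)// h4 /=.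
  by rewrite divr_ge0 ?sqr_ge0.
have leA s : x <= s <= x + c0 -> fA' s <= P s.
  move=> /andP[h1 h2]; have sl : x <= s <= x + l by apply/andP; split; lra.
  have /andP[z0 z1] := ze01 s sl.
  rewrite /fA' /P /ka; move: (u s) (u1 s) (u2 s) (ze s) z0 z1 => a b c z z0 z1.
  set g := s - x; have [g0 gc] : 0 <= g /\ g <= c0 by rewrite /g; split; lra.
  have [k kE] : exists k, k = g - g ^+ 2 / c0 by eexists.
  rewrite -kE.
  have [k0 kg] : 0 <= k /\ k <= g.
    rewrite kE; split; last by rewrite gerBl divr_ge0 ?sqr_ge0// ltW.
    by rewrite subr_ge0 ler_pdivrMr// expr2 ler_wpM2l.
  have [w wE] : exists w, w = 2 * g / l ^+ 2 by eexists.
  have [w0 w1] : 0 <= w /\ c0 * w <= 1.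
    rewrite wE; split; first by rewrite divr_ge0 ?sqr_ge0// mulr_ge0.
    rewrite mulrA ler_pdivrMr ?exprn_gt0// mul1r; nra.
  have k1 : 0 <= k ^+ 2 <= g ^+ 2 by rewrite sqr_ge0 /= ler_sqr ?nnegrE.
  have z2 : z ^+ 2 <= 1 by rewrite expr_le1.
  have w2 : (c0 * w) ^+ 2 <= 1 by rewrite expr_le1// mulr_ge0// ltW.
  rewrite -subr_ge0 -wE.
  have -> : g ^+ 2 * (8 / l ^+ 3 * a ^+ 2 + 10 / c0 * b ^+ 2 + 2 * c0 * c ^+ 2) -
    (2 * v * g / l ^+ 2 * a - 2 * v * z * g / c0 * b - v * k * w * b + v * k * z * c
      - v ^+ 2 * ((8 * l)^-1 + 3 / (8 * c0))) =
    (8 * l)^-1 * (v - 8 * g * a / l) ^+ 2 + (8 * c0)^-1 * (v + 8 * z * g * b) ^+ 2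
    + (8 * c0)^-1 * (v + 4 * c0 * k * w * b) ^+ 2 + (8 * c0)^-1 * (v - 4 * c0 * k * z * c) ^+ 2
    + 8 / c0 * g ^+ 2 * b ^+ 2 * (1 - z ^+ 2) + 2 / c0 * b ^+ 2 * (g ^+ 2 - k ^+ 2 * (c0 * w) ^+ 2)
    + 2 * c0 * c ^+ 2 * (g ^+ 2 - k ^+ 2 * z ^+ 2) by field; rewrite cn0 ln0.
  have kk (t : R) : 0 <= t -> t <= 1 -> k ^+ 2 * t <= g ^+ 2.
    move=> t0 t1; case/andP: k1 => k1 k2; apply: le_trans k2.
    by rewrite ler_piMr.
  repeat apply: addr_ge0; repeat (first [exact: sqr_ge0 | apply: mulr_ge0]); rewrite ?invr_ge0 ?subr_ge0 ?mulr_ge0 ?(ltW l0) ?(ltW c00) ?sqr_ge0//.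
    by apply: kk; [exact: sqr_ge0|exact: w2].
  by apply: kk; [exact: sqr_ge0|exact: z2].
have leB s : x + c0 <= s <= x + l -> fB' s <= P s.
  move=> /andP[h1 h2]; have sl : x <= s <= x + l by apply/andP; split; lra.
  have /andP[z0 z1] := ze01 s sl.
  rewrite /fB' /P; move: (u s) (u1 s) (u2 s) (ze s) z0 z1 => a b c z z0 z1.
  set g := s - x; have g0 : 0 < g by rewrite /g; lra.
  have gn0 : g != 0 by rewrite gt_eqF.
  have z2 : z ^+ 2 <= 1 by rewrite expr_le1.
  rewrite -subr_ge0.
  have -> : g ^+ 2 * (8 / l ^+ 3 * a ^+ 2 + 10 / c0 * b ^+ 2 + 2 * c0 * c ^+ 2) -
    (2 * v * g / l ^+ 2 * a - v * z * b - c0 / 8 * v ^+ 2 / g ^+ 2 - v ^+ 2 / (8 * l)) =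
    (8 * l)^-1 * (v - 8 * g * a / l) ^+ 2 + c0 / 8 * (v / g + 4 / c0 * g * z * b) ^+ 2
    + 2 / c0 * g ^+ 2 * b ^+ 2 * (1 - z ^+ 2) + 8 / c0 * g ^+ 2 * b ^+ 2
    + 2 * c0 * g ^+ 2 * c ^+ 2 by field; rewrite cn0 ln0 gn0.
  repeat apply: addr_ge0; repeat (first [exact: sqr_ge0 | apply: mulr_ge0]); rewrite ?invr_ge0 ?subr_ge0 ?mulr_ge0 ?(ltW l0) ?(ltW c00) ?sqr_ge0//.
pose I := (\int[mu]_(s in `[x, (x + l)%R]) (P s)%:E)%E.
have part (f f' : R -> R) (a b : R) : a < b -> x <= a -> b <= x + l ->
    (forall s, a <= s <= b -> is_derive s (1 : R) f (f' s)) ->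
    (forall s, a <= s <= b -> {for s, continuous f'}) ->
    (forall s, a <= s <= b -> f' s <= P s) -> ((f b)%:E <= (f a)%:E + I)%E.
  move=> ab xa bl df cf' H.
  have sl s : a <= s <= b -> x <= s <= x + l.
    by move=> /andP[h1 h2]; apply/andP; split; lra.
  have := @ftc_le R f f' P (fun=> 0) a b ab df cf' (fun s sab => cP s (sl s sab))
    (fun _ _ => lexx 0).
  rewrite integral0 adde0 => K; apply: le_trans (K _) _.
    by move=> s /H; rewrite subr0.
  rewrite leeD2l//; apply: le_integral_subset => [s|s /=]; first by rewrite lee_fin.
  by rewrite !in_itv /=; exact: sl.
have xc : x < x + c0 by rewrite ltrDl.
have xl : x + c0 <= x + l by rewrite lerD2l ltW.
have xcl : x + c0 < x + l by rewrite ltrD2l.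
have sub1 s : x <= s <= x + c0 -> x <= s <= x + l.
  by case/andP=> -> h; exact: le_trans h xl.
have HA : ((fA (x + c0))%:E <= (fA x)%:E + I)%E :=
  part fA fA' x (x + c0) xc (lexx x) xl (fun s h => dfA s (sub1 s h)) (fun s h => cfA s (sub1 s h)) leA.
have HB : ((fB (x + l))%:E <= (fB (x + c0))%:E + I)%E :=
  part fB fB' (x + c0) (x + l) xcl (ltW xc) (lexx _) dfB cfB leB.
have I0 : (0 <= I)%E by apply: integral_ge0 => s _; rewrite lee_fin.
have e1 : x + c0 - x = c0 by ring.
have e2 : x + l - x = l by ring.
have zx : ze x = 1 by rewrite /ze subrr expr0n /= mul0r subr0.
have kx : ka x = 0 by rewrite /ka subrr expr0n /= mul0r subr0.
have zl : ze (x + l) = 0 by rewrite /ze e2 divff ?subrr// expf_neq0.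
have kc : ka (x + c0) = 0.
  by rewrite /ka e1 expr2 mulfK// subrr.
(* The values of [u] at [x + c0] cancel between the two parts. Each increment is at most [I], so
   $2I\ge\frac38v^2$, which suffices for the factor 6. *)
have E : fA (x + c0) - fA x + (fB (x + l) - fB (x + c0)) = v ^+ 2 * (3 / 8 + c0 / (8 * l)).
  rewrite /fA /fB kc kx zl zx e1 e2 subrr -/v.
  by move: (u _) (u1 _) (u1 _) (ze _) (u (x + l)) => a b b' z d; field; rewrite ln0 cn0.
have K : ((v ^+ 2 / 6)%:E <= I)%E.
  have p0 : 0 <= v ^+ 2 * (c0 / (8 * l)).
    by rewrite mulr_ge0 ?sqr_ge0// divr_ge0 ?mulr_ge0 ?(ltW l0) ?(ltW c00).
  have v0 := sqr_ge0 v.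
  move: HA HB E I0 p0 v0 => {part}; move: I (fA _) (fA _) (fB _) (fB _) => J a b c d.
  case: J => [i| |] //; last by move=> *; rewrite leey.
  by rewrite -!EFinD !lee_fin => h1 h2 E _; move: E; rewrite mulrDr; lra.
have := @scale_segment R P x (x + l) (v ^+ 2 / 6) 6 (ler0n _ 6) cP P0 K.
by rewrite mulrC divfK.
Qed.
End ConeAverage.

Section InteriorPoint.
Context {R : realType}.
Local Notation field := (@field R).
Local Notation mu := (@lebesgue_measure R).
Implicit Types (f h : field) (t a b T m : R) (x : 'rV[R]_3).

Lemma is_derive_ray f T (x0 x1 x2 a b c : R) : Smooth f -> 0 < T ->
  is_derive c (1 : R) (fun c => f T (vec3 (x0 + (c - x2) * a, x1 + (c - x2) * b, c)))
   (a * Dx 0 f T (vec3 (x0 + (c - x2) * a, x1 + (c - x2) * b, c))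
    + b * Dx 1 f T (vec3 (x0 + (c - x2) * a, x1 + (c - x2) * b, c))
    + Dx 2 f T (vec3 (x0 + (c - x2) * a, x1 + (c - x2) * b, c))).
Proof.
rewrite SmoothE => sf T0.
pose d i : R * 'rV[R]_3 := (0, delta_mx 0 i).
pose e := a *: d 0 + b *: d 1 + d 2.
pose z : R * 'rV[R]_3 := (T, vec3 (x0 - x2 * a, x1 - x2 * b, 0)).
have E r : z + r *: e = (T, vec3 (x0 + (r - x2) * a, x1 + (r - x2) * b, r)).
  rewrite /z /e /d; congr pair.
    by change (T + r *: (a *: 0 + b *: 0 + 0) = T :> R); rewrite !scaler0 !addr0 scaler0 addr0.
  change (vec3 (x0 - x2 * a, x1 - x2 * b, 0) + r *: (a *: delta_mx 0 0 + b *: delta_mx 0 1 + delta_mx 0 2)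
    = vec3 (x0 + (r - x2) * a, x1 + (r - x2) * b, r) :> 'rV[R]_3).
  by rewrite !vec3E; apply/rowP => j; rewrite !mxE /=; ring.
have U r : [set z : R * 'rV[R]_3 | 0 < z.1] (z + r *: e) by rewrite E.
have := is_derive_line (smooth_on_derivable (v := e) sf (U c)).
rewrite /e !(deriveDv open_future _ _ sf (U c)) !(deriveZv open_future _ _ sf (U c)) -/e E -!DxE.
by under eq_fun do rewrite E.
Qed.

Lemma sqr_ray_le (a b X Y Z : R) : 0 <= a <= 1 -> 0 <= b <= 1 ->
  (a * X + b * Y + Z) ^+ 2 <= 3 * (X ^+ 2 + Y ^+ 2 + Z ^+ 2).
Proof.
move=> /andP[a0 a1] /andP[b0 b1].
have a2 : a ^+ 2 <= 1 by rewrite expr_le1.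
have b2 : b ^+ 2 <= 1 by rewrite expr_le1.
have h1 : (a * X) ^+ 2 <= X ^+ 2 by rewrite exprMn ler_piMl ?sqr_ge0.
have h2 : (b * Y) ^+ 2 <= Y ^+ 2 by rewrite exprMn ler_piMl ?sqr_ge0.
have := sqr_ge0 (a * X - b * Y); have := sqr_ge0 (a * X - Z); have := sqr_ge0 (b * Y - Z).
by lra.
Qed.

(** [ray_bound] on each ray, then [cone_average]; all rays stay in the cube with corner [x] and side
    [l], so [W] has to dominate only there. *)
Lemma interior_point f T (W : 'rV[R]_3 -> R) x (l c0 : R) : Smooth f -> 0 < T ->
  0 < c0 -> 2 * c0 <= l -> continuous W -> (forall y, 0 <= W y) ->
  (forall y : 'rV[R]_3, (forall i, x 0 i <= y 0 i <= x 0 i + l) ->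
    48 / l ^+ 3 * f T y ^+ 2 + 180 / c0 * grad2 f T y + 108 * c0 * hess2 f T y <= W y) ->
  ((f T x ^+ 2)%:E <= I3 W)%E.
Proof.
move=> sf T0 c00 cl cW W0 HW.
have l0 : 0 < l by apply: lt_le_trans cl; rewrite mulr_gt0.
apply: (@cone_average R W (x 0 0) (x 0 1) (x 0 2) l _ l0 cW W0) => a b a01 b01.
pose y (c : R) : 'rV[R]_3 := vec3 (x 0 0 + (c - x 0 2) * a, x 0 1 + (c - x 0 2) * b, c).
have yx : y (x 0 2) = x.
  by rewrite /y subrr !mul0r !addr0 [RHS](slice_coord 0).
have dy (h : field) (c : R) : Smooth h -> is_derive c (1 : R) (fun c => h T (y c))
    (a * Dx 0 h T (y c) + b * Dx 1 h T (y c) + Dx 2 h T (y c)).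
  by move=> sh; exact: is_derive_ray.
pose D (h : field) : field := fun T y => a * Dx 0 h T y + b * Dx 1 h T y + Dx 2 h T y.
have s0 i := smooth_Dx i sf.
have dD (c : R) : is_derive c (1 : R) (fun c => D f T (y c)) (a * D (Dx 0 f) T (y c) + b * D (Dx 1 f) T (y c) + D (Dx 2 f) T (y c)).
  apply: is_deriveD (dy _ c (s0 2)).
  by apply: is_deriveD; apply: is_deriveZ; exact: dy.
have cy (h : field) (c : R) : Smooth h -> {for c, continuous (fun c => h T (y c))}.
  by move=> /dy H; exact: is_derive_continuous (H c).
have := @ray_bound R (fun c => f T (y c)) (fun c => D f T (y c))
  (fun c => a * D (Dx 0 f) T (y c) + b * D (Dx 1 f) T (y c) + D (Dx 2 f) T (y c)) (x 0 2) l c0 c00 cl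
  (fun c _ => dy f c sf) (fun c _ => dD c).
rewrite yx => /(_ _)/le_trans; apply.
  move=> c _; rewrite /D; have s1 i j := smooth_Dx j (s0 i).
  have k00 := cy _ c (s1 0 0); have k01 := cy _ c (s1 0 1); have k02 := cy _ c (s1 0 2).
  have k10 := cy _ c (s1 1 0); have k11 := cy _ c (s1 1 1); have k12 := cy _ c (s1 1 2).
  have k20 := cy _ c (s1 2 0); have k21 := cy _ c (s1 2 1); have k22 := cy _ c (s1 2 2).
  continuous_for.
have lc3 : 0 <= 8 / l ^+ 3 by rewrite divr_ge0// exprn_ge0// ltW.
have cc1 : 0 <= 10 / c0 by rewrite divr_ge0// ltW.
apply: le_integral_nonneg => c /=; rewrite in_itv /= => /andP[c1 c2]; rewrite lee_fin.
  apply: mulr_ge0 => //; apply: mulr_ge0; first exact: sqr_ge0.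
  apply: addr_ge0; first apply: addr_ge0; apply: mulr_ge0; try exact: sqr_ge0; try done.
  by rewrite mulr_ge0// ltW.
rewrite mulrCA; apply: ler_wpM2l; first exact: sqr_ge0.
have g0 : 0 <= c - x 0 2 by lra.
have gl : c - x 0 2 <= l by lra.
apply: le_trans (HW (y c) _); last first.
  have [/andP[a0 a1] /andP[b0 b1]] := (a01, b01).
  have h1 : 0 <= (c - x 0 2) * a <= l by rewrite mulr_ge0//=; apply: le_trans gl; rewrite ler_piMr.
  have h2 : 0 <= (c - x 0 2) * b <= l by rewrite mulr_ge0//=; apply: le_trans gl; rewrite ler_piMr.
  have [/andP[h3 h4] /andP[h5 h6]] := (h1, h2).
  by apply: ord3P; rewrite /y !mxE !(tnth_nth 0) /=; apply/andP; split; lra.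
have H1 : D f T (y c) ^+ 2 <= 3 * grad2 f T (y c) by exact: sqr_ray_le.
have H2 : (a * D (Dx 0 f) T (y c) + b * D (Dx 1 f) T (y c) + D (Dx 2 f) T (y c)) ^+ 2 <= 9 * hess2 f T (y c).
  apply: le_trans (sqr_ray_le _ _ _ a01 b01) _; rewrite /hess2.
  have k i : D (Dx i f) T (y c) ^+ 2 <= 3 * grad2 (Dx i f) T (y c) by exact: sqr_ray_le.
  by have := k 0; have := k 1; have := k 2; lra.
move: H1 H2; move: (D f T _) (_ + _ + _) (f T (y c)) (grad2 _ _ _) (hess2 _ _ _) => u1 u2 u G H h1 h2.
have := ler_wpM2l cc1 h1; have := ler_wpM2l (ltW c00) h2.
(* The constants of [ray_bound], times 6, are further multiplied by 3 for the first and by 9 for the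
   second derivative along a ray, from expanding the direction. *)
rewrite (_ : 48 / l ^+ 3 = 6 * (8 / l ^+ 3)) 1?(_ : 180 / c0 = 18 * (10 / c0)); [|by field; rewrite gt_eqF|by field; rewrite gt_eqF].
by move: (8 / _) (10 / _) => L C; lra.
Qed.
End InteriorPoint.

Lemma box_norm (R : realFieldType) (s x y : R) :
  `|x| <= s / 16 -> x <= y <= x + s / 16 -> `|y| <= s / 8.
Proof. by rewrite !ler_norml => /andP[h1 h2] /andP[h3 h4]; apply/andP; split; lra. Qed.

(** * Pointwise decay in the interior *)

Section InteriorSup.
Context {R : realType} {p t0 : R} (p01 : 0 < p < 1) (t00 : 0 < t0).
Local Notation field := (@field R).
Local Notation word := (word p).
Local Notation controlled := (controlled p t0).
Implicit Types (f h : field) (t a b T m : R) (x : 'rV[R]_3) (v w : seq 'I_8).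

(** With $l=\tau/16$ the function itself contributes $O(\tau^{-3})$; its gradient and its Hessian
    are both $O(1/\tau)$ in $L^2$, so they contribute $O(\tau^{-2})$ for any fixed [c0]. *)
Lemma interior_sup n v (g : 'I_8) : (4 <= n)%N -> (size v <= n - 4)%N -> (g <= 3)%N ->
  exists2 C : R, 0 <= C & forall f T m x, controlled n f T m ->
  (forall i, `|x 0 i| <= tau p T / 16) ->
  tau p T ^+ 2 * word (g :: v) f T x ^+ 2 <= C * m.
Proof.
move=> n4 vn g3.
have [C1 C10 HC1] := derivative_word p01 t00 n.
have [C2 C20 HC2] := interior_grad p01 t00 n4 vn g3.
have n3 : (3 <= n)%N by apply: leq_trans n4.
have gvn : (size (g :: v) <= n - 3)%N by apply: (@leq_ltn_trans (n - 4)) => //; rewrite ltn_sub2l.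
have [C3 C30 HC3] := interior_hessian p01 t00 n3 gvn.
have vn' : (size v <= n)%N by apply: leq_trans vn (leq_subr _ _).
have tau0 : 0 < tau p t0 := tau_gt0 p01 t00.
(* The length is fixed, since one of size $\tau$ would spoil the Hessian term; this value satisfies
   [2 * c0 <= l] at all later times. *)
pose c0 := tau p t0 / 32.
have c00 : 0 < c0 by rewrite divr_gt0.
pose K := (48 * 16 ^+ 3 / tau p t0 * C1 + 64 * (180 / c0) * C2 + 64 * (108 * c0) * C3).
have k1 : 0 <= 48 * 16 ^+ 3 / tau p t0 by rewrite divr_ge0 ?(ltW tau0)// mulr_ge0 ?exprn_ge0.
have k2 : 0 <= 180 / c0 by rewrite divr_ge0 ?(ltW c00).
have k3 : 0 <= 108 * c0 by rewrite mulr_ge0 ?(ltW c00).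
exists K.
  apply: addr_ge0; first apply: addr_ge0; apply: mulr_ge0 => //; exact: mulr_ge0.
move=> f T m x cf xT; have [sf tT m0 _] := cf.
have T0 : 0 < T by exact: lt_trans tT.
have tt : tau p t0 <= tau p T by apply: (le_tau p01); rewrite t00 ltW.
have H1 := HC1 g v f T m g3 vn' cf; have H2 := HC2 f T m cf; have H3 := HC3 f T m cf.
have sh : Smooth (word (g :: v) f) by exact: smooth_word.
move: H1 H2 H3 sh; move: (word (g :: v) f) => h H1 H2 H3 sh.
have s0 : 0 < tau p T by exact: lt_le_trans tt.
have sn0 : tau p T != 0 by rewrite gt_eqF.
have sb : Smooth (ballf (tau p T / 2)) by case: (@jet_ballf R (tau p T / 2)).
have cT := ContX (n := 2) (Cont_pos (Cont_smooth sb)).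
have c1 : continuous (fun y => h T y ^+ 2) := Cont_space (ContX (n := 2) (Cont_smooth sh)) T0.
have cg (h' : field) : Smooth h' -> Cont (grad2 h').
  by move=> sh'; rewrite /grad2; cont_tac.
have c2 : continuous (fun y => chi p T y * grad2 h T y).
  exact: (Cont_space (ContM cT (cg h sh)) T0).
have c3 : continuous (fun y => chi p T y * hess2 h T y).
  have ch : Cont (hess2 h).
    have g0 := cg _ (smooth_Dx 0 sh); have g1 := cg _ (smooth_Dx 1 sh); have g2 := cg _ (smooth_Dx 2 sh).
    by rewrite /hess2; cont_tac.
  exact: (Cont_space (ContM cT ch) T0).
have p2 y : 0 <= chi p T y * grad2 h T y := mulr_ge0 (chi_ge0 p T y) (grad2_ge0 h T y).
have p3 y : 0 <= chi p T y * hess2 h T y := mulr_ge0 (chi_ge0 p T y) (hess2_ge0 h T y).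
pose l := tau p T / 16.
have l0 : 0 < l by rewrite divr_gt0.
have K10 : 0 <= 48 / l ^+ 3 by rewrite divr_ge0// exprn_ge0// ltW.
have t4 : 0 <= 64 / tau p T ^+ 4 by rewrite divr_ge0// exprn_ge0// ltW.
have K20 := mulr_ge0 t4 k2; have K30 := mulr_ge0 t4 k3.
have cl : 2 * c0 <= l by rewrite /c0 /l; move: tt; lra.
pose W y := 48 / l ^+ 3 * h T y ^+ 2 + 64 / tau p T ^+ 4 * (180 / c0) * (chi p T y * grad2 h T y)
  + 64 / tau p T ^+ 4 * (108 * c0) * (chi p T y * hess2 h T y).
have cZ (k : R) (F : 'rV[R]_3 -> R) : continuous F -> continuous (fun y => k * F y).
  by move=> cF y; exact: (cvgM (cvg_cst k) (cF y)).
have cW : continuous W.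
  by move=> y; exact: (cvgD (cvgD (cZ _ _ c1 y) (cZ _ _ c2 y)) (cZ _ _ c3 y)).
have q1 y := mulr_ge0 K10 (sqr_ge0 (h T y)).
have q2 y := mulr_ge0 K20 (p2 y).
have q3 y := mulr_ge0 K30 (p3 y).
have W0 y : 0 <= W y := addr_ge0 (addr_ge0 (q1 y) (q2 y)) (q3 y).
have := @interior_point R h T W x l c0 sh T0 c00 cl cW W0.
have -> : I3 W = ((48 / l ^+ 3)%R%:E * I3 (fun y => (h T y ^+ 2)%R)
    + (64 / tau p T ^+ 4 * (180 / c0))%R%:E * I3 (fun y => (chi p T y * grad2 h T y)%R)
    + (64 / tau p T ^+ 4 * (108 * c0))%R%:E * I3 (fun y => (chi p T y * hess2 h T y)%R))%E.
  rewrite -(I3Z K10 c1 (fun y => sqr_ge0 _)) -(I3Z K20 c2 p2) -(I3Z K30 c3 p3).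
  rewrite -(I3D (cZ _ _ c1) (cZ _ _ c2) q1 q2) -I3D; [by []| |exact: cZ| |exact: q3].
    by move=> y; exact: (cvgD (cZ _ _ c1 y) (cZ _ _ c2 y)).
  by move=> y; exact: addr_ge0 (q1 y) (q2 y).
move=> /(_ _)/le_trans H.
have {}H : ((h T x ^+ 2)%:E <= (48 / l ^+ 3 * (C1 * m) + 64 / tau p T ^+ 4 * (180 / c0) * (C2 * (tau p T ^+ 2 * m))
    + 64 / tau p T ^+ 4 * (108 * c0) * (C3 * (tau p T ^+ 2 * m)))%R%:E)%E.
  apply: H; last by rewrite !EFinD; apply: leeD; [apply: leeD|]; exact: lee_scale.
  move=> y yx; rewrite /W -addrA -[leRHS]addrA lerD2l.
  (* On the cube all coordinates are at most $\tau/8$ in modulus, so [ballf] is at least $\tau^2/8$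
     and [chi] at least $\tau^4/64$. *)
  have chi1 : 1 <= 64 / tau p T ^+ 4 * chi p T y.
    have yb i : y 0 i ^+ 2 <= (tau p T / 8) ^+ 2.
      have t8 : 0 <= tau p T / 8 by apply: ltW; rewrite divr_gt0.
      rewrite -(real_normK (num_real (y 0 i))) ler_sqr ?nnegrE//.
      exact: box_norm (xT i) (yx i).
    have ball : tau p T ^+ 2 / 8 <= ballf (tau p T / 2) T y.
      have := yb 0; have := yb 1; have := yb 2; have := sqr_ge0 (tau p T); rewrite /ballf -!expr2 !exprMn; lra.
    have pb : tau p T ^+ 2 / 8 <= pos (ballf (tau p T / 2) T y) by rewrite /pos le_max ball orbT.
    rewrite mulrAC ler_pdivlMr ?exprn_gt0// mul1r.
    have t8 : 0 <= tau p T ^+ 2 / 8 by rewrite mulr_ge0 ?sqr_ge0.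
    have := pb; rewrite -ler_sqr ?nnegrE ?pos_ge0// exprMn -exprM /chi.
    by move: (pos _) (_ ^+ (2 * 2)) => a b; lra.
  have G0 := mulr_ge0 k2 (grad2_ge0 h T y); have H0 := mulr_ge0 k3 (hess2_ge0 h T y).
  have := ler_wpM2r G0 chi1; have := ler_wpM2r H0 chi1.
  move: (chi p T y) (grad2 h T y) (hess2 h T y) (64 / _) (180 / _) (108 * _) => ? ? ? ? ? ?.
  by rewrite !mul1r; lra.
move: H; rewrite lee_fin => /(ler_wpM2l (sqr_ge0 (tau p T)))/le_trans; apply.
have -> : tau p T ^+ 2 * (48 / l ^+ 3 * (C1 * m) + 64 / tau p T ^+ 4 * (180 / c0) * (C2 * (tau p T ^+ 2 * m))
    + 64 / tau p T ^+ 4 * (108 * c0) * (C3 * (tau p T ^+ 2 * m))) =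
  48 * 16 ^+ 3 / tau p T * C1 * m + 64 * (180 / c0) * C2 * m + 64 * (108 * c0) * C3 * m.
  rewrite /l; move: (180 / c0) (108 * c0) => a b; field; exact: sn0.
rewrite /K [leRHS]mulrDl lerD2r [leRHS]mulrDl lerD2r.
apply: ler_wpM2r => //; apply: ler_wpM2r => //; apply: ler_wpM2l; first by rewrite mulr_ge0 ?exprn_ge0.
by rewrite lef_pV2 ?posrE.
Qed.
End InteriorSup.

(** * Pointwise decay in the exterior *)

Section ExteriorSup.
Context {R : realType} {p t0 : R} (p01 : 0 < p < 1) (t00 : 0 < t0).
Local Notation field := (@field R).
Local Notation word := (word p).
Local Notation gen := (gen p).
Local Notation controlled := (controlled p t0).
Implicit Types (f h : field) (t a b m : R) (x : 'rV[R]_3) (v w : seq 'I_8).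

(** The energy bounds in $L^2$ only words whose outermost letter is a derivative, while the exterior
    estimate puts rotations outside. This class is what such words reduce to once the derivative is
    moved to the front. *)
Definition starts_derivative n a w := a = 0 /\
  exists (h : 'I_8) w', [/\ w = h :: w', (h <= 3)%N & (size w' <= n)%N].
Local Notation sd := starts_derivative.

Lemma starts_word n (g : 'I_8) v : (g <= 3)%N -> (size v <= n)%N ->
  tspan p (sd n) (word (g :: v)).
Proof. by move=> g3 vn; apply: tspan_word0; split => //; exists g, v. Qed.

(** Exchanging the new letter with the leading derivative leaves a bracket, which is a multiple of a
    derivative because derivatives form an ideal. *)
Lemma starts_gen n i (T : field -> field) : tspan p (sd n) T -> tspan p (sd n.+1) (fun f => gen i (T f)).
Proof.
apply: (tspan_gen_cst p01) => [a w [] //|a w [_ [h [w' [-> h3 sw']]]]].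
have [e [d [hd _ Ed]]] := gen_bracket p01 i h.
have H1 : sd n.+1 0 [:: h, i & w'] by split=> //; exists h, (i :: w').
have H2 : sd n.+1 0 (d :: w').
  split => //; exists d, w'; split => //; last exact: leqW.
  by apply: hd; rewrite h3 orbT.
have H3 := tspan_add (@tspan_word0 R p (sd n.+1) _ H1) (@tspan_word R p (sd n.+1) e _ _ H2).
apply: tspan_eq H3 => f sf t x t1 /=.
by rewrite (Ed _ (smooth_word p w' sf) _ _ t1) oppr0 powRr0 mulr1.
Qed.

Lemma starts_Rot n i j (T : field -> field) : i != j -> tspan p (sd n) T ->
  tspan p (sd n.+1) (fun f => Rot i j (T f)).
Proof.
move=> ij H; have H4 := starts_gen 4 H; have H5 := starts_gen 5 H; have H6 := starts_gen 6 H.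
have opp (q : 'I_8) k l : (forall f, gen q f = Rot l k f) -> tspan p (sd n.+1) (fun f => gen q (T f)) ->
    tspan p (sd n.+1) (fun f => Rot k l (T f)).
  move=> E /(tspan_cscale (-1)); apply: tspan_eq => f sf t x t1.
  by rewrite E !RotE; ring.
move: i j ij; apply: ord3P; apply: ord3P => // _.
- exact: opp H4.
- exact: opp H5.
- exact: opp H6.
Qed.

Lemma starts_Dx n i (T : field -> field) : tspan p (sd n) T ->
  tspan p (sd n.+1) (fun f => Dx i (T f)).
Proof.
move=> H; move: i; apply: ord3P.
- exact: (starts_gen 1 H).
- exact: (starts_gen 2 H).
- exact: (starts_gen 3 H).
Qed.

Lemma starts_mono n n' (T : field -> field) : (n <= n')%N -> tspan p (sd n) T -> tspan p (sd n') T.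
Proof.
move=> nn; apply: tspan_mono => a v [a0 [h [w [-> h3 sw]]]]; split => //.
by exists h, w; split => //; exact: leq_trans nn.
Qed.

Lemma starts_L2 n (T' : field -> field) : tspan p (sd n) T' ->
  exists2 C : R, 0 <= C & forall f T m, controlled n f T m ->
  (I3 (fun x => T' f T x ^+ 2)%R <= (C * m)%:E)%E.
Proof.
move=> HT; have [C C0 HC] := derivative_word p01 t00 n.
have He a v : sd n a v -> 0 <= a by case=> ->.
have [K K0 HK] := quad_tspan t00 HT He.
exists (K * C); first exact: mulr_ge0.
move=> f T m cf; have [sf tT m0 _] := cf.
have PN := @pos_functional_I3 _ _ t00 T (ltW tT).
have := HK T _ (fun _ _ => 1) f (C * m) PN sf (@Cont_cst R 1) (fun _ _ _ => ler01) (mulr_ge0 C0 m0).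
rewrite -mulrA => H; apply: le_trans (H _).
  by apply: le_I3 => x; [exact: sqr_ge0|rewrite mul1r].
move=> a v [_ [h [w [-> h3 sw]]]]; apply: le_trans (HC h w f T m h3 sw cf).
apply: le_I3 => x; first by rewrite mul1r sqr_ge0.
by rewrite mul1r oppr0 powRr0 mul1r.
Qed.

Lemma exterior_sup n v (g : 'I_8) i : (4 <= n)%N -> (size v <= n - 4)%N -> (g <= 3)%N ->
  exists2 C : R, 0 <= C & forall f T m x, controlled n f T m ->
  tau p T / 16 < `|x 0 i| -> (forall j, `|x 0 j| <= `|x 0 i|) ->
  tau p T ^+ 2 * word (g :: v) f T x ^+ 2 <= C * m.
Proof.
move=> n4 vn g3.
have [ib ig bg] := slice_dirs i.
have B0 := starts_word g3 vn.
have Bb := starts_Rot ib B0; have Bg := starts_Rot ig B0; have Bbg := starts_Rot ib Bg.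
have nn j : (j <= 4)%N -> (n - 4 + j <= n)%N.
  by move=> j4; rewrite -[X in (_ <= X)%N](subnK n4) leq_add2l.
have le k (T : field -> field) : (k <= (n - 4).+4)%N -> tspan p (sd k) T -> tspan p (sd n) T.
  by move=> h; apply: starts_mono; apply: (leq_trans h); rewrite -addn4 subnK.
pose Op (k : bool * bool) (f : field) : field :=
  match k with
  | (false, false) => word (g :: v) f
  | (false, true) => Rot i (slice_be i) (word (g :: v) f)
  | (true, false) => Rot i (slice_ga i) (word (g :: v) f)
  | (true, true) => Rot i (slice_be i) (Rot i (slice_ga i) (word (g :: v) f))
  end.
have HOp k : tspan p (sd (n - 4).+2) (Op k).
  case: k => [[] []]; rewrite /Op.
  - exact: Bbg.
  - exact: starts_mono Bg.
  - exact: starts_mono Bb.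
  - by apply: starts_mono B0; exact: leqW.
have HDx k := starts_Dx i (HOp k).
have H1 k : exists2 C : R, 0 <= C & forall f T m, controlled n f T m ->
  (I3 (fun x => Op k f T x ^+ 2)%R <= (C * m)%:E)%E.
  by apply: starts_L2; apply: le (HOp k); do 2 apply: leqW.
have H2 k : exists2 C : R, 0 <= C & forall f T m, controlled n f T m ->
  (I3 (fun x => Dx i (Op k f) T x ^+ 2)%R <= (C * m)%:E)%E.
  by apply: starts_L2; apply: le (HDx k); apply: leqW.
have {H1 H2} [C C0 HC] : exists2 C : bool * bool -> R, (forall k, 0 <= C k) &
    forall k f T m, controlled n f T m ->
    (I3 (fun x => Op k f T x ^+ 2)%R <= (C k * m)%:E)%E /\
    (I3 (fun x => Dx i (Op k f) T x ^+ 2)%R <= (C k * m)%:E)%E.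
  have H k : exists C : R, 0 <= C /\ forall f T m, controlled n f T m ->
    (I3 (fun x => Op k f T x ^+ 2)%R <= (C * m)%:E)%E /\
    (I3 (fun x => Dx i (Op k f) T x ^+ 2)%R <= (C * m)%:E)%E.
    have [C1 C10 HC1] := H1 k; have [C2 C20 HC2] := H2 k.
    exists (C1 + C2); split; first exact: addr_ge0.
    move=> f T m cf; have [_ _ m0 _] := cf; split.
      apply: le_trans (HC1 f T m cf) _; rewrite lee_fin; apply: ler_wpM2r => //.
      by rewrite lerDl.
    apply: le_trans (HC2 f T m cf) _; rewrite lee_fin; apply: ler_wpM2r => //.
    by rewrite lerDr.
  by have [C HC] := choice H; exists C => k; have [] := HC k.
pose L := [:: (false, false); (false, true); (true, false); (true, true)].
(* $16^2$ turns $r^2\ge(\tau/16)^2$ into $\tau^2$; 36 is from [exterior_bound], and 3 adds its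
   coefficients 2 and 1. *)
exists (16 ^+ 2 * (36 * \sum_(k <- L) 3 * C k)).
  by rewrite mulr_ge0// mulr_ge0// sumr_ge0// => k _; rewrite mulr_ge0.
move=> f T m x cf xT xmax; have [sf tT m0 _] := cf.
have T0 : 0 < T by exact: lt_trans tT.
have s0 := tau_gt0 p01 T0.
have s16 : 0 < tau p T / 16 by rewrite divr_gt0.
have sh : Smooth (word (g :: v) f) by exact: smooth_word.
have xi0 : x 0 i != 0 by rewrite -normr_gt0; exact: lt_trans xT.
have [F [F0 F1 F2 F3 HF]] := @exterior_bound R (word (g :: v) f) T x i sh T0 xi0 xmax.
have FE k : F k = Op k f by case: k => [[] []]; rewrite ?F0 ?F1 ?F2 ?F3.
have sO k : Smooth (Op k f) := smooth_tspan (HOp k) sf.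
have cO k : Cont (fun t x => 2 * Op k f t x ^+ 2 + Dx i (Op k f) t x ^+ 2).
  by have s1 := sO k; have c1 := Cont_smooth s1; have c2 := Cont_smooth (smooth_Dx i s1); cont_tac.
have pO k : ge0_field (fun t y => 2 * Op k f t y ^+ 2 + Dx i (Op k f) t y ^+ 2).
  by move=> t y _; apply: addr_ge0; [apply: mulr_ge0 => //|]; exact: sqr_ge0.
have PN := @pos_functional_I3 _ _ t00 T (ltW tT).
have B1 k : (I3 (fun y => (2 * Op k f T y ^+ 2 + Dx i (Op k f) T y ^+ 2)%R) <= (3 * C k * m)%:E)%E.
  have [h1 h2] := HC k f T m cf.
  have c1 : Cont (fun t y => Op k f t y ^+ 2) := ContX (Cont_smooth (sO k)).
  have c2 : Cont (fun t y => Dx i (Op k f) t y ^+ 2) := ContX (Cont_smooth (smooth_Dx i (sO k))).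
  have [ND NZ _] := PN.
  have s1 : ge0_field (fun t y => Op k f t y ^+ 2) by move=> t y _; exact: sqr_ge0.
  have s2 : ge0_field (fun t y => Dx i (Op k f) t y ^+ 2) by move=> t y _; exact: sqr_ge0.
  have c3 : Cont (fun t y => 2 * Op k f t y ^+ 2) := ContM (@Cont_cst R 2) c1.
  have s3 : ge0_field (fun t y => 2 * Op k f t y ^+ 2) by move=> t y _; rewrite mulr_ge0 ?sqr_ge0.
  have -> := ND _ _ c3 c2 s3 s2; have -> := NZ _ _ (ler0n _ 2) c1 s1.
  rewrite (_ : 3 * C k * m = 2 * (C k * m) + C k * m); last by ring.
  rewrite [X in (_ <= X)%E]EFinD; exact: leeD (lee_scale (ler0n _ 2) h1) h2.
have B2 := functional_sum (l := L) PN cO pO (fun k _ => B1 k).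
have cS : Cont (fun t y => \sum_(k <- L) (2 * Op k f t y ^+ 2 + Dx i (Op k f) t y ^+ 2)).
  rewrite /L (_ : (fun t y => _) = (fun t y => 2 * Op (false, false) f t y ^+ 2 + Dx i (Op (false, false) f) t y ^+ 2
    + (2 * Op (false, true) f t y ^+ 2 + Dx i (Op (false, true) f) t y ^+ 2
    + (2 * Op (true, false) f t y ^+ 2 + Dx i (Op (true, false) f) t y ^+ 2
    + (2 * Op (true, true) f t y ^+ 2 + Dx i (Op (true, true) f) t y ^+ 2))))).
    exact: ContD (cO _) (ContD (cO _) (ContD (cO _) (cO _))).
  by apply/funext => t; apply/funext => y; rewrite !big_cons big_nil addr0.
have pS : ge0_field (fun t y => \sum_(k <- L) (2 * Op k f t y ^+ 2 + Dx i (Op k f) t y ^+ 2)).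
  by move=> t y t1; apply: sumr_ge0 => k _; exact: pO.
have [_ NZ _] := PN.
have B3 := lee_scale (ler0n _ 36) B2.
rewrite -(NZ _ _ (ler0n _ 36) cS pS) in B3.
have B4 : (\sum_(k <- L) 3 * C k * m = (\sum_(k <- L) 3 * C k) * m) by rewrite mulr_suml.
have {HF} HF : (((x 0 0 ^+ 2 + x 0 1 ^+ 2 + x 0 2 ^+ 2) * word (g :: v) f T x ^+ 2)%R%:E
    <= (36 * (\sum_(k <- L) 3 * C k * m))%R%:E)%E.
  apply: le_trans HF _; apply: le_trans B3; apply: le_I3 => y.
    by apply: mulr_ge0 => //; apply: sumr_ge0 => k _; rewrite FE; exact: pO T0.
  by rewrite /L !big_cons !big_nil !FE; exact: lexx.
rewrite lee_fin B4 in HF.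
have xi2 : (tau p T / 16) ^+ 2 <= x 0 i ^+ 2.
  by rewrite -[leRHS]real_normK ?num_real// ler_sqr ?nnegrE// ltW.
have r2 : (tau p T / 16) ^+ 2 <= x 0 0 ^+ 2 + x 0 1 ^+ 2 + x 0 2 ^+ 2.
  apply: le_trans xi2 _; have := sqr_ge0 (x 0 0); have := sqr_ge0 (x 0 1); have := sqr_ge0 (x 0 2).
  by move: (i); apply: ord3P => h0 h1 h2; lra.
have := ler_wpM2r (sqr_ge0 (word (g :: v) f T x)) r2.
move: HF; move: (_ + _ + _) (word (g :: v) f T x) (\sum_(k <- L) _) (tau p T) => X w S s h1 h2.
have h3 : (s / 16) ^+ 2 * w ^+ 2 <= 36 * (S * m) by exact: le_trans h2 h1.
have -> : s ^+ 2 * w ^+ 2 = 16 ^+ 2 * ((s / 16) ^+ 2 * w ^+ 2) by field.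
by rewrite -mulrA; apply: ler_wpM2l; [exact: exprn_ge0|rewrite -mulrA].
Qed.
End ExteriorSup.

(** * The norms of the statement *)

Section Norms.
Context {R : realType}.
Local Notation field := (@field R).
Implicit Types (f : field) (t m c : R) (x : 'rV[R]_3) (g : 'rV[R]_3 -> R).

Lemma sqrte_le (X : \bar R) m : (0 <= X)%E -> 0 <= m -> (sqrte X <= m%:E)%E ->
  (X <= (m ^+ 2)%:E)%E.
Proof.
move=> X0 m0; rewrite -[m in (_ <= m%:E)%E](ger0_norm m0) -sqrtr_sqr.
by rewrite (_ : (Num.sqrt (m ^+ 2))%:E = sqrte (m ^+ 2)%:E)// lee_sqrt// lee_fin sqr_ge0.
Qed.

Lemma L2x_le g m : 0 <= m -> (L2x g <= m%:E)%E -> (I3 (fun x => g x ^+ 2)%R <= (m ^+ 2)%:E)%E.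
Proof.
move=> m0; rewrite /L2x unlock => H.
have E : (\int[leb3]_x `|([eta EFin] \o (g \o vec3)) x| `^ 2)%E = I3 (fun x => g x ^+ 2).
  apply: eq_integral => y _.
  by rewrite /comp /abse poweR_EFin powR_mulrn// real_normK// num_real.
have I0 : (0 <= I3 (fun x => g x ^+ 2)%R)%E by apply: I3_ge0 => x; exact: sqr_ge0.
rewrite E poweR12_sqrt// in H.
exact: sqrte_le.
Qed.

Lemma Linftyx_le g c : 0 <= c -> (forall x, `|g x| <= c) -> (Linftyx g <= c%:E)%E.
Proof.
move=> c0 H; rewrite /Linftyx unlock; case: ifP => _; last by rewrite lee_fin.
by apply/ess_sup_inf.ess_supP; apply: nearW => y; rewrite /comp /= lee_fin.
Qed.

Lemma L2tx_le f t0 t1 m : 0 <= m -> (L2tx t0 t1 f <= m%:E)%E ->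
  (\int[lebesgue_measure]_(t in `[t0, t1]) I3 (fun x => f t x ^+ 2)%R <= (m ^+ 2)%:E)%E.
Proof.
move=> m0; rewrite /L2tx => H.
have E : (\int[lebesgue_measure]_(t in `[t0, t1]) I3 (fun x => f t x ^+ 2)%R)%E =
    (\int[lebesgue_measure]_(t in `[t0, t1]) \int[leb3]_y (`|f t (vec3 y)| ^+ 2)%:E)%E.
  by apply: eq_integral => t _; apply: eq_integral => y _; rewrite real_normK// num_real.
rewrite -E in H; apply: sqrte_le m0 H.
by apply: integral_ge0 => t _; apply: I3_ge0 => x; exact: sqr_ge0.
Qed.

Lemma edensE p f t x : edens p f t x =
  t `^ (2 * p) * dt f t x ^+ 2 + \sum_(i < 3) dx i f t x ^+ 2.
Proof. by rewrite sum3E /edens Dt.unlock Dx.unlock powR2p !expr2 mulrACA. Qed.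

Lemma energyE p f t : energy p f t = ((2^-1)%:E * I3 (edens p f t))%E.
Proof. by rewrite /energy; congr (_ * _)%E; apply: eq_integral => y _; rewrite edensE. Qed.

Lemma energy_le p f t m : 0 <= m -> (sqrte (energy p f t) <= m%:E)%E ->
  (I3 (edens p f t) <= (2 * m ^+ 2)%:E)%E.
Proof.
move=> m0; have I0 : (0 <= I3 (edens p f t))%E by apply: I3_ge0 => x; exact: edens_ge0.
rewrite energyE => /(sqrte_le (mule_ge0 _ I0) m0); rewrite lee_fin invr_ge0 => /(_ (ler0n _ 2)) H.
have := lee_scale (ler0n _ 2) H.
by rewrite muleA -EFinM divff ?mul1e.
Qed.
End Norms.

(** * From all words to the monomials of the norms *)

Section Pointwise.
Context {R : realType} {p t0 : R} (p01 : 0 < p < 1) (t00 : 0 < t0).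
Local Notation field := (@field R).
Local Notation word := (word p).
Local Notation gen := (gen p).
Local Notation controlled := (controlled p t0).
Implicit Types (f h : field) (t a b m : R) (x : 'rV[R]_3) (v w : seq 'I_8).

(** The two regimes are separated by comparing the largest coordinate of [x] in modulus with
    $\tau/16$; the interior cube and the exterior threshold match. *)
Lemma pointwise_word n : (4 <= n)%N -> exists2 C : R, 0 <= C &
  forall v, (size v <= n - 4)%N -> forall (g : 'I_8) f T m x, (g <= 3)%N -> controlled n f T m ->
  tau p T ^+ 2 * word (g :: v) f T x ^+ 2 <= C * m.
Proof.
move=> n4.
have one v (g : 'I_8) : exists C : R, 0 <= C /\ ((size v <= n - 4)%N -> (g <= 3)%N ->
    forall f T m x, controlled n f T m -> tau p T ^+ 2 * word (g :: v) f T x ^+ 2 <= C * m).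
  have [vn|vn] := leqP (size v) (n - 4); last by exists 0.
  have [g3|g3] := leqP g 3; last by exists 0.
  have [C C0 HC] := interior_sup p01 t00 n4 vn g3.
  have [D HD] := choice (fun i : 'I_3 => let: ex_intro2 D D0 HD := exterior_sup p01 t00 i n4 vn g3 in
    ex_intro (fun D : R => 0 <= D /\ _) D (conj D0 HD)).
  have D0 i : 0 <= D i by case: (HD i).
  have DS i : D i <= \sum_i D i.
    by rewrite (bigD1 i)//= lerDl; exact: sumr_ge0.
  have S0 : 0 <= \sum_i D i by apply: sumr_ge0 => i _.
  exists (C + \sum_i D i); split; first exact: addr_ge0.
  move=> _ _ f T m x cf; have [_ _ m0 _] := cf.
  pose i := [arg max_(i > (0 : 'I_3)) `|x 0 i|]%O.
  have imax j : `|x 0 j| <= `|x 0 i|.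
    by rewrite /i; case: arg_maxP => // k _; apply.
  have [xi|xi] := leP `|x 0 i| (tau p T / 16).
    apply: le_trans (HC f T m x cf (fun j => le_trans (imax j) xi)) _.
    by apply: ler_wpM2r => //; rewrite lerDl.
  apply: le_trans ((HD i).2 f T m x cf xi imax) _.
  by apply: ler_wpM2r => //; apply: le_trans (DS i) _; rewrite lerDr.
pose Q v C := forall (g : 'I_8) f T m x, (g <= 3)%N -> controlled n f T m ->
  tau p T ^+ 2 * word (g :: v) f T x ^+ 2 <= C * m.
apply: (@bounded_words R (n - 4) Q) => [v vn|v C C' H CC' g f T m x g3 cf].
  have [D HD] := choice (one v).
  have D0 i : 0 <= D i by case: (HD i).
  exists (\sum_i D i); first by apply: sumr_ge0 => i _.
  move=> g f T m x g3 cf; have [_ _ m0 _] := cf.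
  apply: le_trans ((HD g).2 vn g3 f T m x cf) _; apply: ler_wpM2r => //.
  by rewrite (bigD1 g)//= lerDl; exact: sumr_ge0.
have [_ _ m0 _] := cf; apply: le_trans (H g f T m x g3 cf) _.
exact: ler_wpM2r.
Qed.

(* Sorted words are the monomials of [apply_mi]. *)
Definition canonically_controlled n f T m := [/\ Smooth f, t0 < T, 0 <= m &
  [/\ forall v, sorted leI v -> (size v <= n)%N -> (I3 (edens p (word v f) t0) <= m%:E)%E,
  forall v, sorted leI v -> (size v <= n)%N ->
    (IT t0 T (fun t x => (t * (t `^ p * word v (Box p f) t x) ^+ 2)%R) <= m%:E)%E &
  forall v, sorted leI v -> (size v <= n - 3)%N ->
    (I3 (fun x => ((T `^ (p + 1) * word v (Box p f) T x) ^+ 2)%R) <= m%:E)%E]].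

(** Only the tail is sorted. The letter [i] must stay in front, since the energy of a monomial
    controls derivatives of it and not the monomial itself. *)
Lemma I3_word_canonical n v (i : 'I_8) : (size v <= n)%N -> exists2 K : R, 0 <= K &
  forall f b, Smooth f -> 0 <= b ->
  (forall u, sorted leI u -> (size u <= n)%N -> (I3 (fun x => word (i :: u) f t0 x ^+ 2)%R <= b%:E)%E) ->
  (I3 (fun x => word (i :: v) f t0 x ^+ 2)%R <= (K * b)%:E)%E.
Proof.
move=> vn; pose P' a w := a = 0 :> R /\ exists2 u, w = i :: u & sorted leI u /\ (size u <= n)%N.
have HT : tspan p P' (word (i :: v)).
  apply: (tspan_gen_cst p01 _ _ (pbw p01 vn)) => [a w [] //|a w [_ sw nw]].
  by apply: tspan_word0; split => //; exists w.
have He a w : P' a w -> 0 <= a by case=> ->.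
have [K K0 HK] := quad_tspan t00 HT He.
exists K => // f b sf b0 H.
have PN := @pos_functional_I3 _ _ t00 t0 (lexx t0).
have := HK t0 _ (fun _ _ => 1) f b PN sf (@Cont_cst R 1) (fun _ _ _ => ler01) b0.
move=> L; apply: le_trans (L _).
  by apply: le_I3 => x; [exact: sqr_ge0|rewrite mul1r].
move=> a w [_ [u -> [su nu]]]; apply: le_trans (H u su nu).
apply: le_I3 => x; first by rewrite mul1r sqr_ge0.
by rewrite mul1r oppr0 powRr0 mul1r.
Qed.

Lemma edens_gen h t x : edens p h t x =
  \sum_(i <- [:: 0; 1; 2; 3 : 'I_8]) gen i h t x ^+ 2.
Proof. by rewrite /edens !big_cons big_nil addr0 -!addrA /gen /= DtauE -!expr2. Qed.

(** [pbw] applied to each of the three norms; for the two norms of the source the weight in [t]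
    passes through, the expansion into sorted words having constant coefficients. *)
Lemma controlled_canonical n : exists2 C : R, 0 <= C &
  forall f T m, canonically_controlled n f T m -> controlled n f T (C * m).
Proof.
pose l := [:: 0; 1; 2; 3 : 'I_8].
have [C1 C10 HC1] : exists2 C : R, 0 <= C & forall v, (size v <= n)%N ->
    forall f T m, canonically_controlled n f T m -> (I3 (edens p (word v f) t0) <= (C * m)%:E)%E.
  pose Q v C := forall f T m, canonically_controlled n f T m ->
    (I3 (edens p (word v f) t0) <= (C * m)%:E)%E.
  apply: (@bounded_words R n Q) => [v vn|v C C' H CC' f T m cf].
    have [K HK] := choice (fun i : 'I_8 => let: ex_intro2 K K0 HK := I3_word_canonical i vn in
      ex_intro (fun K : R => 0 <= K /\ _) K (conj K0 HK)).
    exists (\sum_(i <- l) K i); first by apply: sumr_ge0 => i _; case: (HK i).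
    move=> f T m [sf tT m0 [H _ _]].
    have PN := @pos_functional_I3 _ _ t00 t0 (lexx t0).
    have c1 i : Cont (fun t x => gen i (word v f) t x ^+ 2).
      apply: ContX; exact: Cont_smooth (smooth_word p (i :: v) sf).
    have := functional_sum (l := l) PN c1 (fun i t x _ => sqr_ge0 _) (b := fun i => K i * m).
    rewrite -mulr_suml => L; apply: le_trans (L _).
      by apply: le_I3 => x; [exact: edens_ge0|rewrite edens_gen; exact: lexx].
    move=> i il; apply: (HK i).2 => // u su un.
    apply: le_trans (H u su un); apply: le_I3 => x; first exact: sqr_ge0.
    rewrite edens_gen (perm_big (i :: rem i l)); last exact: perm_to_rem.
    rewrite big_cons lerDl; apply: sumr_ge0 => j _; exact: sqr_ge0.
  have [_ _ m0 _] := cf; apply: le_trans (H f T m cf) _.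
  by rewrite lee_fin; exact: ler_wpM2r.
have [C2 C20 HC2] : exists2 C : R, 0 <= C & forall v, (size v <= n)%N ->
    forall f T m, canonically_controlled n f T m ->
    (IT t0 T (fun t x => (t * (t `^ p * word v (Box p f) t x) ^+ 2)%R) <= (C * m)%:E)%E.
  pose Q v C := forall f T m, canonically_controlled n f T m ->
    (IT t0 T (fun t x => (t * (t `^ p * word v (Box p f) t x) ^+ 2)%R) <= (C * m)%:E)%E.
  apply: (@bounded_words R n Q) => [v vn|v C C' H CC' f T m cf].
    have He (a : R) w : canonical n a w -> 0 <= a by case=> ->.
    have [K K0 HK] := quad_tspan t00 (pbw p01 vn) He.
    exists K => // f T m [sf tT m0 [_ H _]].
    have PN := @pos_functional_IT _ _ t00 T (ltW tT).
    have com : Cont (fun t (_ : 'rV[R]_3) => t * (t `^ p * t `^ p)).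
      by have h1 := @Cont_time_id R; have h2 := @Cont_powR R p; cont_tac.
    have om0 : ge0_field (fun t (_ : 'rV[R]_3) => t * (t `^ p * t `^ p)).
      by move=> t x t1; apply: mulr_ge0; [exact: ltW|apply: mulr_ge0; exact: powR_ge0].
    have E (u : seq 'I_8) t x : t * (t `^ p * t `^ p) * (t `^ (- 0) * word u (Box p f) t x) ^+ 2 =
        t * (t `^ p * word u (Box p f) t x) ^+ 2.
      by rewrite oppr0 powRr0 mul1r; ring.
    have := HK T _ _ (Box p f) m PN (smooth_Box p sf) com om0 m0.
    move=> L; apply: le_trans (L _).
      rewrite le_eqVlt; apply/orP; left; apply/eqP; apply: eq_IT => t x _; ring.
    move=> a w [_ sw wn]; apply: le_trans (H w sw wn).
    by rewrite le_eqVlt; apply/orP; left; apply/eqP; apply: eq_IT => t x _; exact: E.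
  have [_ _ m0 _] := cf; apply: le_trans (H f T m cf) _.
  by rewrite lee_fin; exact: ler_wpM2r.
have [C3 C30 HC3] : exists2 C : R, 0 <= C & forall v, (size v <= n - 3)%N ->
    forall f T m, canonically_controlled n f T m ->
    (I3 (fun x => ((T `^ (p + 1) * word v (Box p f) T x) ^+ 2)%R) <= (C * m)%:E)%E.
  pose Q v C := forall f T m, canonically_controlled n f T m ->
    (I3 (fun x => ((T `^ (p + 1) * word v (Box p f) T x) ^+ 2)%R) <= (C * m)%:E)%E.
  apply: (@bounded_words R (n - 3) Q) => [v vn|v C C' H CC' f T m cf].
    have He (a : R) w : canonical (n - 3) a w -> 0 <= a by case=> ->.
    have [K K0 HK] := quad_tspan t00 (pbw p01 vn) He.
    exists K => // f T m [sf tT m0 [_ _ H]].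
    have PN := @pos_functional_I3 _ _ t00 T (ltW tT).
    have com : Cont (fun t (_ : 'rV[R]_3) => t `^ (p + 1) * t `^ (p + 1)).
      by have h2 := @Cont_powR R (p + 1); cont_tac.
    have om0 : ge0_field (fun t (_ : 'rV[R]_3) => t `^ (p + 1) * t `^ (p + 1)).
      by move=> t x t1; apply: mulr_ge0; exact: powR_ge0.
    have := HK T _ _ (Box p f) m PN (smooth_Box p sf) com om0 m0.
    move=> L; apply: le_trans (L _).
      by rewrite le_eqVlt; apply/orP; left; apply/eqP; apply: eq_I3 => x; ring.
    move=> a w [_ sw wn]; apply: le_trans (H w sw wn).
    rewrite le_eqVlt; apply/orP; left; apply/eqP; apply: eq_I3 => x.
    by rewrite oppr0 powRr0 mul1r; ring.
  have [_ _ m0 _] := cf; apply: le_trans (H f T m cf) _.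
  by rewrite lee_fin; exact: ler_wpM2r.
exists (C1 + C2 + C3); first by rewrite !addr_ge0.
move=> f T m cf; have [sf tT m0 _] := cf.
have le1 X C : 0 <= C -> C <= C1 + C2 + C3 -> (X <= (C * m)%:E)%E -> (X <= ((C1 + C2 + C3) * m)%:E)%E.
  by move=> _ h /le_trans; apply; rewrite lee_fin; exact: ler_wpM2r.
split; [exact: sf|exact: tT|by rewrite mulr_ge0 ?addr_ge0|split].
- by move=> v vn; apply: (le1 _ C1) => //; [lra|exact: HC1 cf].
- by move=> v vn; apply: (le1 _ C2) => //; [lra|exact: HC2 cf].
- by move=> v vn; apply: (le1 _ C3) => //; [lra|exact: HC3 cf].
Qed.
End Pointwise.

(** * Assembly of the estimate *)

Section Assembly.
Context {R : realType} {p t0 : R} (p01 : 0 < p < 1) (t00 : 0 < t0).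
Local Notation field := (@field R).
Local Notation word := (word p).
Implicit Types (f h : field) (t a b m : R) (x : 'rV[R]_3) (v w : seq 'I_8).

Lemma sum_le_ge0 n (N : field -> \bar R) f : (forall h, (0 <= N h)%E) -> (0 <= sum_le p n N f)%E.
Proof. by move=> N0; apply: sume_ge0 => a _. Qed.

Lemma le_sum_le n (N : field -> \bar R) f (c : \bar R) (a : multiindex n) :
  (forall h, (0 <= N h)%E) -> (mi_size a <= n)%N -> (sum_le p n N f <= c)%E ->
  (N (apply_mi p a f) <= c)%E.
Proof.
move=> N0 an; apply: le_trans; rewrite /sum_le (bigD1 a)//= leeDl//.
by apply: sume_ge0 => j _.
Qed.

Lemma sum_le_bound n (N : field -> \bar R) f b :
  (forall a : multiindex n, (mi_size a <= n)%N -> (N (apply_mi p a f) <= b%:E)%E) ->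
  (sum_le p n N f <= (#|{: multiindex n}|%:R * `|b|)%:E)%E.
Proof.
move=> H; apply: (@le_trans _ _ (\sum_(a : multiindex n | (mi_size a <= n)%N) `|b|%:E)%E).
  by apply: lee_sum => a an; apply: le_trans (H a an) _; rewrite lee_fin ler_norm.
rewrite sumEFin lee_fin mulr_natl -sumr_const.
rewrite [leRHS](bigID (fun a : multiindex n => (mi_size a <= n)%N)) /= lerDl.
by apply: sumr_ge0 => a _.
Qed.

(** The factor 2 undoes the one half in the energy. The slice norm of order [k + 1] is exactly the
    one demanded at length [n - 3] for [n = k + 4]. *)
Lemma controlled_norms k f (t1 T m : R) : t0 < T < t1 -> Smooth f -> 0 <= m ->
  (sum_le p (k + 4) (fun f => sqrte (energy p f t0)) f <= m%:E)%E ->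
  (sum_le p (k + 4) (fun f => L2tx t0 t1
     (fun s x => (s `^ (p + 2^-1) * f s x)%R)) (box p f) <= m%:E)%E ->
  (sum_le p (k + 1) (fun f => L2x (fun x => (T `^ (p + 1) * f T x)%R)) (box p f) <= m%:E)%E ->
  @canonically_controlled R p t0 (k + 4) f T (2 * m ^+ 2).
Proof.
move=> /andP[tT Tt] sf m0 H1 H2 H3.
have T0 : 0 < T by exact: lt_trans tT.
have m2 : 0 <= m ^+ 2 by exact: sqr_ge0.
have m22 : m ^+ 2 <= 2 * m ^+ 2 by lra.
rewrite boxE in H2 H3.
split; [exact: sf|exact: tT|by rewrite mulr_ge0|split].
- move=> v sv vn; have [a an Ea] := sorted_word_mi p sv vn.
  have K := le_sum_le (fun h => sqrte_ge0 (energy p h t0)) an H1.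
  apply: le_trans _ (energy_le m0 K); apply: le_I3 => x; first exact: edens_ge0.
  by rewrite /edens (eq_pos_dt (Ea f) _ t00) !(eq_pos_dx _ (Ea f) _ t00).
- move=> v sv vn; have [a an Ea] := sorted_word_mi p sv vn.
  have K := le_sum_le (fun h => sqrte_ge0 _) an H2.
  apply: le_trans _ (le_trans (L2tx_le m0 K) _); last by rewrite lee_fin.
  apply: (@le_trans _ _ (\int[lebesgue_measure]_(s in `[t0, T])
    I3 (fun x => (s `^ (p + 2^-1) * apply_mi p a (Box p f) s x) ^+ 2)%R)%E).
    apply: le_IT => // [t x t1'|t x /andP[tt _]]; first by apply: mulr_ge0; [exact: ltW|exact: sqr_ge0].
    have t1' : 0 < t by exact: lt_le_trans tt.
    rewrite (Ea _ _ _ t1') powRD ?(gt_eqF t1') ?implybT// powR12_sqrt ?(ltW t1')//.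
    by rewrite !exprMn sqr_sqrtr ?(ltW t1')// mulrCA mulrA.
  apply: le_integral_subset => [s|s /=]; first by apply: I3_ge0 => x; exact: sqr_ge0.
  by rewrite !in_itv /= => /andP[-> h]; exact: le_trans h (ltW Tt).
- rewrite (_ : (k + 4 - 3 = k + 1)%N); last by rewrite -addnBA.
  move=> v sv vn; have [a an Ea] := sorted_word_mi p sv vn.
  have K := le_sum_le (N := fun f => L2x (fun x => (T `^ (p + 1) * f T x)%R))
    (fun h => Lnorm_ge0 _ _ _) an H3.
  apply: le_trans _ (le_trans (L2x_le m0 K) _); last by rewrite lee_fin.
  by apply: le_I3 => x; [exact: sqr_ge0|rewrite (Ea _ _ _ T0)].
Qed.

(** $t\partial_t=t^{1-p}\partial_\tau$ and $t^{1-p}=(1-p)\tau\le\tau$. The factor 2 covers the three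
    components of the gradient, as $3\le 2^2$. *)
Lemma pointwise_norms k f (C T m : R) (a : multiindex k) : 0 <= C -> 0 < T -> 0 <= m -> (mi_size a <= k)%N ->
  (forall v, (size v <= k)%N -> forall (g : 'I_8) x, (g <= 3)%N ->
    tau p T ^+ 2 * word (g :: v) f T x ^+ 2 <= (C * m) ^+ 2) ->
  (Linftyx (fun x => (T * dt (apply_mi p a f) T x)%R) <= (2 * (C * m))%:E)%E /\
  (Linftyx (fun x => (T `^ (1 - p) * grad_norm (apply_mi p a f) T x)%R) <= (2 * (C * m))%:E)%E.
Proof.
move=> C0 T0 m0 ak H.
have Cm := mulr_ge0 C0 m0.
have [w wa Ew] := apply_mi_word p a; rewrite -wa in ak.
have p1 : 0 < 1 - p by case/andP: p01 => _; rewrite subr_gt0.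
have pl : 1 - p <= 1 by case/andP: p01 => h _; lra.
have tE : T `^ (1 - p) = (1 - p) * tau p T by rewrite /tau mulrCA divff ?mulr1// gt_eqF.
have s0 : 0 <= tau p T := tau_ge0 p01 T.
have B (g : 'I_8) x : (g <= 3)%N -> tau p T * `|word (g :: w) f T x| <= C * m.
  move=> g3; have := H w ak g x g3.
  rewrite -(ler_sqr (x := tau p T * _)) ?nnegrE ?(mulr_ge0 s0)//.
  by rewrite [(tau p T * _) ^+ 2]exprMn real_normK ?num_real.
split; apply: Linftyx_le; rewrite ?mulr_ge0// => x.
  have -> : dt (apply_mi p a f) T x = Dt (word w f) T x.
    by rewrite -(eq_pos_dt (Ew f) _ T0) Dt.unlock.
  have TE : T = T `^ (1 - p) * T `^ p.
    by rewrite -powRD ?(gt_eqF T0) ?implybT// subrK powRr1// ltW.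
  rewrite {1}TE -mulrA -DtauE tE normrM (ger0_norm (mulr_ge0 (ltW p1) s0)) -mulrA.
  have := B 0 x isT; have h0 := mulr_ge0 s0 (normr_ge0 (word (0 :: w) f T x)).
  rewrite (_ : word (0 :: w) f = Dtau p (word w f))// in h0 * => h1.
  apply: (@le_trans _ _ (1 * (C * m))); last by rewrite mul1r; lra.
  by apply: ler_pM => //; exact: ltW.
rewrite tE normrM (ger0_norm (mulr_ge0 (ltW p1) s0)) ger0_norm ?sqrtr_ge0//.
rewrite -mulrA -[leRHS]mul1r; apply: ler_pM; [exact: ltW|exact: mulr_ge0 s0 (sqrtr_ge0 _)|exact: pl|].
rewrite -(ler_sqr (x := tau p T * _)) ?nnegrE ?(mulr_ge0 s0 (sqrtr_ge0 _))//; last by rewrite mulr_ge0.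
rewrite exprMn sqr_sqrtr; last by apply: sumr_ge0 => i _; exact: sqr_ge0.
have D i : dx i (apply_mi p a f) T x = Dx i (word w f) T x.
  by rewrite -(eq_pos_dx i (Ew f) _ T0) Dx.unlock.
rewrite sum3E !D.
have := H w ak 1 x isT; have := H w ak 2 x isT; have := H w ak 3 x isT.
rewrite /word /= /gen /=.
have := sqr_ge0 (C * m); rewrite (exprMn 2); lra.
Qed.

End Assembly.

Theorem theorem1p2 (R : realType) (p : R) (k : nat) (t0 : R) :
  0 < p < 1 -> 0 < t0 ->
  exists2 A : R, 0 < A &
    forall (t1 : R) (phi : R -> 'rV[R]_3 -> R),
      t0 < t1 ->
      smooth_field phi ->
      (forall t : R, t0 < t < t1 -> test_function (phi t)) ->
      forall t : R, t0 < t < t1 ->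
        (sum_le p k (fun f => Linftyx (fun x => (t * dt f t x)%R)) phi
         + sum_le p k
             (fun f => Linftyx (fun x => (t `^ (1 - p) * grad_norm f t x)%R)) phi
         <= A%:E *
            (sum_le p (k + 4) (fun f => sqrte (energy p f t0)) phi
             + sum_le p (k + 4)
                 (fun f => L2tx t0 t1
                    (fun s x => (s `^ (p + 2^-1) * f s x)%R)) (box p phi)
             + sum_le p (k + 1)
                 (fun f => L2x (fun x => (t `^ (p + 1) * f t x)%R))
                 (box p phi)))%E.
Proof.
move=> p01 t00.
have k4 : (4 <= k + 4)%N by rewrite leq_addl.
have [C C0 HC] := pointwise_word p01 t00 k4.
have [C' C'0 HC'] := controlled_canonical p01 t00 (k + 4).
(* The square root passes from the quadratic estimates back to norms; the 2 is that of
   [controlled_norms]. *)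
pose D := Num.sqrt (C * (C' * 2)).
have D0 : 0 <= D by exact: sqrtr_ge0.
pose M : R := #|{: multiindex k}|%:R.
have M0 : 0 <= M by exact: ler0n.
(* [M] counts the multi-indices and the outer 2 the two sums on the left; the summand 1 makes the
   constant positive even if [D] vanishes. *)
have A0 : 0 < 1 + 2 * (M * (2 * D)).
  by apply: ltr_pwDl => //; rewrite mulr_ge0// mulr_ge0// mulr_ge0.
exists (1 + 2 * (M * (2 * D))); first exact: A0.
move=> t1 phi t01 sphi _ t tt.
have [tt0 _] := andP tt; have tp : 0 < t by exact: lt_trans tt0.
have sf : Smooth phi by rewrite Smooth.unlock.
set X1 := sum_le p (k + 4) _ phi; set X2 := sum_le p (k + 4) _ _; set X3 := sum_le p (k + 1) _ _.
have X10 : (0 <= X1)%E by apply: sum_le_ge0 => h; exact: sqrte_ge0.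
have X20 : (0 <= X2)%E by apply: sum_le_ge0 => h; exact: sqrte_ge0.
have X30 : (0 <= X3)%E by apply: sum_le_ge0 => h; exact: Lnorm_ge0.
have X0 : (0 <= X1 + X2 + X3)%E by rewrite !adde_ge0.
(* If the right-hand side is infinite the claim is trivial, thanks to the positivity of the
   constant; otherwise [m] bounds each of the three norms. *)
case E : (X1 + X2 + X3)%E X0 => [m| |] //; last first.
  by move=> _; rewrite gt0_muley ?lte_fin// leey.
rewrite lee_fin => m0.
have X12 : (0 <= X1 + X2)%E by exact: adde_ge0.
have H1 : (X1 <= m%:E)%E by rewrite -E -addeA leeDl// adde_ge0.
have H2 : (X2 <= m%:E)%E by rewrite -E addeAC leeDr// adde_ge0.
have H3 : (X3 <= m%:E)%E by rewrite -E leeDr.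
have cf := HC' _ _ _ (controlled_norms t00 tt sf m0 H1 H2 H3).
have H v : (size v <= k)%N -> forall (g : 'I_8) x, (g <= 3)%N ->
    tau p t ^+ 2 * word p (g :: v) phi t x ^+ 2 <= (D * m) ^+ 2.
  move=> vk g x g3; have vk' : (size v <= k + 4 - 4)%N by rewrite addnK.
  apply: le_trans (HC v vk' g phi t _ x g3 cf) _.
  rewrite exprMn sqr_sqrtr ?mulr_ge0//.
  by rewrite le_eqVlt; apply/orP; left; apply/eqP; ring.
have S1 := @sum_le_bound R p k (fun f => Linftyx (fun x => (t * dt f t x)%R)) phi (2 * (D * m))
  (fun a ak => (pointwise_norms p01 D0 tp m0 ak H).1).
have S2 := @sum_le_bound R p k (fun f => Linftyx (fun x => (t `^ (1 - p) * grad_norm f t x)%R)) phi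
  (2 * (D * m)) (fun a ak => (pointwise_norms p01 D0 tp m0 ak H).2).
apply: le_trans (leeD S1 S2) _; rewrite -EFinD -EFinM lee_fin -/M.
have Dm : 0 <= D * m by exact: mulr_ge0.
rewrite ger0_norm; last by rewrite mulr_ge0.
by rewrite mulrDl mul1r; have := mulr_ge0 M0 Dm; lra.
Qed.
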